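(* Let $\mathfrak h$ be a finite dimensional complex vector space, $W\subset GL(\mathfrak h)$ a finite subgroup, $c$ a conjugation-invariant complex function on the set of reflections of $W$, $b\in\mathfrak h$, $W'=W_b$ its stabilizer, and $c'$ the restriction of $c$ to the reflections in $W'$. Then the parabolic induction functor $\mathrm{Ind}_b:\mathcal O_{c'}(W',\mathfrak h/\mathfrak h^{W'})_0\to\mathcal O_c(W,\mathfrak h)_0$ is right adjoint to the parabolic restriction functor $\mathrm{Res}_b:\mathcal O_c(W,\mathfrak h)_0\to\mathcal O_{c'}(W',\mathfrak h/\mathfrak h^{W'})_0$.
   Context: A reflection in $W$ is an element $s\neq1$ with $\mathrm{rk}(s-1)=1$; $S$ is the set of reflections. For $s\in S$, $\alpha_s\in\mathfrak h^*$ and $\alpha_s^\vee\in\mathfrak h$ generate $\mathrm{Im}((s-1)|_{\mathfrak h^*})$ and $\mathrm{Im}((s-1)|_{\mathfrak h})$, with $(\alpha_s,\alpha_s^\vee)=2$; $\lambda_s$ is the nontrivial eigenvalue of $s$ in $\mathfrak h^*$. $H_c(W,\mathfrak h)$ is the quotient of $\mathbb C[W]\ltimes T(\mathfrak h\oplus\mathfrak h^* )$ by $[x,x']=0$, $[y,y']=0$, $[y,x]=(y,x)-\sum_{s\in S}c_s(y,\alpha_s)(x,\alpha_s^\vee)s$ ($x,x'\in\mathfrak h^*$, $y,y'\in\mathfrak h$). $\mathcal O_c(W,\mathfrak h)_0$ is the category of $H_c(W,\mathfrak h)$-modules finitely generated over $\mathbb C[\mathfrak h]$ and locally nilpotent under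 $\mathfrak h$. Completions. $\widehat{H_c}(W,\mathfrak h)_b=\widehat{\mathbb C[\mathfrak h]^W}\otimes_{\mathbb C[\mathfrak h]^W}H_c(W,\mathfrak h)$, with $\mathbb C[\mathfrak h]^W$ completed at the image of $b$ in $\mathfrak h/W$. $\widehat{\mathcal O}_c(W,\mathfrak h)^b$ is the category of $\widehat{H_c}(W,\mathfrak h)_b$-modules finitely generated over the algebra of functions on the formal neighborhood of the orbit $Wb$. For $M\in\mathcal O_c(W,\mathfrak h)_0$ put $\widehat M_b=\widehat{H_c}(W,\mathfrak h)_b\otimes_{H_c(W,\mathfrak h)}M$. For $N\in\widehat{\mathcal O}_c(W,\mathfrak h)^b$, $E^b(N)\in\mathcal O_c(W,\mathfrak h)_0$ is the space of $\mathfrak h$-nilpotent vectors in $N$. For $b=0$ write $E=E^0$. These notations apply also to $(W',\mathfrak h)$ with parameter $c'$. Centralizer algebra. For finite groups $G\supset H$ and an algebra $A\supset\mathbb C[H]$, let $P=\mathrm{Fun}_H(G,A)$ be the right $A$-module of functions $f:G\to A$ with $f(hg)=hf(g)$, and $Z(G,H,A)=\mathrm{End}_A(P)$. The functor $I(N)=P\otimes_AN=\mathrm{Fun}_H(G,N)$ is an equivalence from $A$-modules to $Z(G,H,A)$-modules. Isomorphism $\theta$. There is an isomorphism $\theta:\widehat{H_c}(W,\mathfrak h)_b\to Z(W,W_b,\widehat{H_{c'}}(W_b,\mathfrak h)_0)$ given, for $f\in\mathrm{Fun}_{W_b}(W,\widehat{H_{c'}}(W_b,\mathfrak h)_0)$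 and $w\in W$, by $(\theta(u)f)(w)=f(wu)$ ($u\in W$); $(\theta(x_\alpha)f)(w)=(x^{(b)}_{w\alpha}+(w\alpha,b))f(w)$ ($\alpha\in\mathfrak h^*$); and $(\theta(y_a)f)(w)=y^{(b)}_{wa}f(w)+\sum_{s\in S,\,s\notin W_b}\frac{2c_s}{1-\lambda_s}\frac{\alpha_s(wa)}{x^{(b)}_{\alpha_s}+\alpha_s(b)}(f(sw)-f(w))$ ($a\in\mathfrak h$). Here $x_\alpha,y_a\in H_c(W,\mathfrak h)$ and $x^{(b)}_\alpha,y^{(b)}_a\in H_{c'}(W_b,\mathfrak h)$ are the generators attached to $\alpha,a$. Let $\theta_*$ be the induced equivalence from $\widehat{H_c}(W,\mathfrak h)_b$-modules to $Z(W,W_b,\widehat{H_{c'}}(W_b,\mathfrak h)_0)$-modules. The equivalence $\zeta:\mathcal O_{c'}(W',\mathfrak h)_0\to\mathcal O_{c'}(W',\mathfrak h/\mathfrak h^{W'})_0$ is $\zeta(M)=\{v\in M: yv=0\ \forall y\in\mathfrak h^{W'}\}$ (identifying $\mathfrak h/\mathfrak h^{W'}$ with the $W'$-stable complement of $\mathfrak h^{W'}$). Functors: $\mathrm{Res}_b(M)=(\zeta\circ E\circ I^{-1}\circ\theta_* )(\widehat M_b)$ and $\mathrm{Ind}_b(N)=(E^b\circ\theta_*^{-1}\circ I)(\widehat{\zeta^{-1}(N)}_0)$. *)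

(* Defs.v *)
From HB Require Import structures.
From mathcomp Require Import all_boot all_order all_algebra all_fingroup.
From mathcomp Require Import boolp classical_sets functions reals complex.

Set Implicit Arguments.
Unset Strict Implicit.
Unset Printing Implicit Defensive.

Import GRing.Theory.
Local Open Scope ring_scope.

Section Quotient.
Variables (T : Type) (e : T -> T -> Prop).

Record quotient := Quotient {
  qpred : T -> Prop;
  qpredP : exists x, qpred = e x
}.

HB.instance Definition _ := gen_eqMixin quotient.
HB.instance Definition _ := gen_choiceMixin quotient.

Definition qclass (x : T) : quotient := Quotient (ex_intro _ x erefl).

Definition qrepr (q : quotient) : T := projT1 (cid (qpredP q)).

Lemma quotient_eq p q : qpred p = qpred q -> p = q.
Proof.
by case: p q => [p pP] [q qP] /= epq; case: _ / epq qP => qP; congr Quotient.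
Qed.

Lemma qreprK q : qclass (qrepr q) = q.
Proof. by apply: quotient_eq; rewrite /qrepr /=; case: cid => x /= ->. Qed.

Hypothesis e_refl : forall x, e x x.
Hypothesis e_sym : forall x y, e x y -> e y x.
Hypothesis e_trans : forall x y z, e x y -> e y z -> e x z.

Lemma qclassP x y : qclass x = qclass y <-> e x y.
Proof.
split=> [[exy]|exy]; first by rewrite exy.
apply: quotient_eq; apply/funext => z; apply/propext; split.
  exact/e_trans/e_sym.
exact: e_trans.
Qed.

Lemma qrepr_class x : e (qrepr (qclass x)) x.
Proof. by apply/qclassP; rewrite qreprK. Qed.

Lemma quotW (P : quotient -> Prop) : (forall x, P (qclass x)) -> forall q, P q.
Proof. by move=> Pc q; rewrite -(qreprK q). Qed.

End Quotient.

(* Unital associative C-algebras given by generators and relations: terms   *)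
(* in the generators modulo the congruence generated by the algebra axioms  *)
(* and the relations.                                                       *)
Section Presented.
Variables (C : fieldType) (G : Type).

Inductive aterm : Type :=
  | Cst of C | Gen of G | Add of aterm & aterm | Mul of aterm & aterm.

Definition asub s t := Add s (Mul (Cst (-1)) t).
Definition acomm s t := asub (Mul s t) (Mul t s).

Variable rel : aterm -> aterm -> Prop.

Inductive aeq : aterm -> aterm -> Prop :=
  | aeq_refl t : aeq t t
  | aeq_sym s t : aeq s t -> aeq t s
  | aeq_trans r s t : aeq r s -> aeq s t -> aeq r t
  | aeq_add s s' t t' : aeq s s' -> aeq t t' -> aeq (Add s t) (Add s' t')
  | aeq_mul s s' t t' : aeq s s' -> aeq t t' -> aeq (Mul s t) (Mul s' t')
  | aeq_addA r s t : aeq (Add r (Add s t)) (Add (Add r s) t)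
  | aeq_addC s t : aeq (Add s t) (Add t s)
  | aeq_add0 t : aeq (Add (Cst 0) t) t
  | aeq_addN t : aeq (Add (Mul (Cst (-1)) t) t) (Cst 0)
  | aeq_mulA r s t : aeq (Mul r (Mul s t)) (Mul (Mul r s) t)
  | aeq_mul1 t : aeq (Mul (Cst 1) t) t
  | aeq_mulDl r s t : aeq (Mul (Add r s) t) (Add (Mul r t) (Mul s t))
  | aeq_mulDr r s t : aeq (Mul r (Add s t)) (Add (Mul r s) (Mul r t))
  | aeq_cstD a b : aeq (Cst (a + b)) (Add (Cst a) (Cst b))
  | aeq_cstM a b : aeq (Cst (a * b)) (Mul (Cst a) (Cst b))
  | aeq_cstC a t : aeq (Mul (Cst a) t) (Mul t (Cst a))
  | aeq_rel s t : rel s t -> aeq s t.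

Definition palg := quotient aeq.

HB.instance Definition _ := Choice.on palg.

Definition pclass (t : aterm) : palg := @qclass _ aeq t.
Local Notation cl := pclass.

Lemma palgW (P : palg -> Prop) : (forall t, P (cl t)) -> forall p, P p.
Proof. exact: quotW. Qed.

Lemma aeqP s t : cl s = cl t <-> aeq s t.
Proof. exact: (qclassP aeq_refl aeq_sym aeq_trans). Qed.

Lemma arepr t : aeq (qrepr (cl t)) t.
Proof. exact: (qrepr_class aeq_refl aeq_sym aeq_trans). Qed.

Let add (p q : palg) : palg := cl (Add (qrepr p) (qrepr q)).
Let mul (p q : palg) : palg := cl (Mul (qrepr p) (qrepr q)).
Let opp (p : palg) : palg := cl (Mul (Cst (-1)) (qrepr p)).

Let addE s t : add (cl s) (cl t) = cl (Add s t).
Proof. by apply/aeqP/aeq_add; exact: arepr. Qed.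
Let mulE s t : mul (cl s) (cl t) = cl (Mul s t).
Proof. by apply/aeqP/aeq_mul; exact: arepr. Qed.
Let oppE t : opp (cl t) = cl (Mul (Cst (-1)) t).
Proof. by apply/aeqP/aeq_mul; [exact: aeq_refl | exact: arepr]. Qed.

Let addA : associative add.
Proof.
elim/palgW=> r; elim/palgW=> s; elim/palgW=> t.
by rewrite !addE; apply/aeqP/aeq_addA.
Qed.
Let addC : commutative add.
Proof.
by elim/palgW=> r; elim/palgW=> s; rewrite !addE; apply/aeqP/aeq_addC.
Qed.
Let add0 : left_id (cl (Cst 0)) add.
Proof. by elim/palgW=> r; rewrite addE; apply/aeqP/aeq_add0. Qed.
Let addN : left_inverse (cl (Cst 0)) opp add.
Proof. by elim/palgW=> r; rewrite oppE addE; apply/aeqP/aeq_addN. Qed.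
Let mulA : associative mul.
Proof.
elim/palgW=> r; elim/palgW=> s; elim/palgW=> t.
by rewrite !mulE; apply/aeqP/aeq_mulA.
Qed.
Let mul1 : left_id (cl (Cst 1)) mul.
Proof. by elim/palgW=> r; rewrite mulE; apply/aeqP/aeq_mul1. Qed.
Let mulr1 : right_id (cl (Cst 1)) mul.
Proof.
elim/palgW=> r; rewrite mulE; apply/aeqP.
by apply: aeq_trans (aeq_mul1 r); apply/aeq_sym/aeq_cstC.
Qed.
Let mulDl : left_distributive mul add.
Proof.
elim/palgW=> r; elim/palgW=> s; elim/palgW=> t.
by rewrite !(mulE, addE); apply/aeqP/aeq_mulDl.
Qed.
Let mulDr : right_distributive mul add.
Proof.
elim/palgW=> r; elim/palgW=> s; elim/palgW=> t.
by rewrite !(mulE, addE); apply/aeqP/aeq_mulDr.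
Qed.

HB.instance Definition _ := GRing.isZmodule.Build palg addA addC add0 addN.
HB.instance Definition _ :=
  GRing.Zmodule_isPzRing.Build palg mulA mul1 mulr1 mulDl mulDr.

Lemma palgD s t : cl (Add s t) = cl s + cl t. Proof. by rewrite -addE. Qed.
Lemma palgM s t : cl (Mul s t) = cl s * cl t. Proof. by rewrite -mulE. Qed.

Definition pgen (g : G) : palg := cl (Gen g).
Definition pcst (a : C) : palg := cl (Cst a).

Let pcst_zmod : zmod_morphism pcst.
Proof.
move=> a b; apply/eqP; rewrite eq_sym subr_eq -palgD; apply/eqP/aeqP.
by rewrite -{1}[a](subrK b); exact: aeq_cstD.
Qed.
Let pcst_monoid : monoid_morphism pcst.
Proof. by split=> // a b; rewrite -palgM; exact/aeqP/aeq_cstM. Qed.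

HB.instance Definition _ := GRing.isZmodMorphism.Build C palg pcst pcst_zmod.
HB.instance Definition _ :=
  GRing.isMonoidMorphism.Build C palg pcst pcst_monoid.

Lemma pcstC a (p : palg) : pcst a * p = p * pcst a.
Proof. by elim/palgW: p => t; rewrite -!palgM; exact/aeqP/aeq_cstC. Qed.

Lemma palg_ind (P : palg -> Prop) :
  (forall a, P (pcst a)) -> (forall g, P (pgen g)) ->
  (forall p q, P p -> P q -> P (p + q)) ->
  (forall p q, P p -> P q -> P (p * q)) -> forall p, P p.
Proof.
move=> Pc Pg PD PM; elim/palgW; elim=> [a|g|s IHs t IHt|s IHs t IHt].
- exact: Pc.
- exact: Pg.
- by rewrite palgD; exact: PD.
- by rewrite palgM; exact: PM.
Qed.

Section Lift.
Variables (R : pzRingType) (k : {rmorphism C -> R}) (v : G -> R).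

Fixpoint aeval (t : aterm) : R :=
  match t with
  | Cst a => k a
  | Gen g => v g
  | Add s t => aeval s + aeval t
  | Mul s t => aeval s * aeval t
  end.

Lemma aeval_sub s t : aeval (asub s t) = aeval s - aeval t.
Proof. by rewrite /= rmorphN1 mulN1r. Qed.

Lemma aeval_comm s t :
  aeval (acomm s t) = aeval s * aeval t - aeval t * aeval s.
Proof. exact: aeval_sub. Qed.

Lemma aeval_sum (I : Type) (r : seq I) (P : pred I) (F : I -> aterm) :
  aeval (\big[Add/Cst 0]_(i <- r | P i) F i) = \sum_(i <- r | P i) aeval (F i).
Proof. by apply: big_morph => //=; rewrite rmorph0. Qed.

Definition central_scalars := forall a x, k a * x = x * k a.
Definition respects_rel := forall s t, rel s t -> aeval s = aeval t.

Lemma aeval_aeq : central_scalars -> respects_rel ->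
  forall s t, aeq s t -> aeval s = aeval t.
Proof.
move=> kC vP s t; elim=> {s t} //=.
- by move=> r s t _ -> _.
- by move=> s s' t t' _ -> _ ->.
- by move=> s s' t t' _ -> _ ->.
- by move=> *; rewrite addrA.
- by move=> *; rewrite addrC.
- by move=> *; rewrite rmorph0 add0r.
- by move=> *; rewrite rmorph0 rmorphN1 mulN1r addNr.
- by move=> *; rewrite mulrA.
- by move=> *; rewrite rmorph1 mul1r.
- by move=> *; rewrite mulrDl.
- by move=> *; rewrite mulrDr.
- by move=> *; rewrite rmorphD.
- by move=> *; rewrite rmorphM.
Qed.

Definition plift_fun of central_scalars & respects_rel :=
  fun p : palg => aeval (qrepr p).

Variables (kC : central_scalars) (vP : respects_rel).

Lemma plift_class t : plift_fun kC vP (cl t) = aeval t.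
Proof. exact/(aeval_aeq kC vP)/arepr. Qed.

Let plift_zmod : zmod_morphism (plift_fun kC vP).
Proof.
elim/palgW=> s; elim/palgW=> t.
have -> : cl s - cl t = cl (asub s t).
  by rewrite palgD palgM -/(pcst _) rmorphN1 mulN1r.
by rewrite !plift_class aeval_sub.
Qed.
Let plift_monoid : monoid_morphism (plift_fun kC vP).
Proof.
split; first by rewrite -(rmorph1 pcst) plift_class /= rmorph1.
by elim/palgW=> s; elim/palgW=> t; rewrite -palgM !plift_class.
Qed.

HB.instance Definition _ :=
  GRing.isZmodMorphism.Build palg R (plift_fun kC vP) plift_zmod.
HB.instance Definition _ :=
  GRing.isMonoidMorphism.Build palg R (plift_fun kC vP) plift_monoid.

Definition plift : {rmorphism palg -> R} := plift_fun kC vP.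

Lemma plift_gen g : plift (pgen g) = v g. Proof. exact: plift_class. Qed.
Lemma plift_cst a : plift (pcst a) = k a. Proof. exact: plift_class. Qed.

End Lift.
End Presented.

Section RingQuotient.
Variable R : pzRingType.

Record ideal := Ideal {
  in_ideal :> R -> Prop;
  ideal0 : in_ideal 0;
  idealD : forall x y, in_ideal x -> in_ideal y -> in_ideal (x + y);
  idealMl : forall a x, in_ideal x -> in_ideal (a * x);
  idealMr : forall a x, in_ideal x -> in_ideal (x * a)
}.

Variable I : ideal.

Lemma idealN x : I x -> I (- x).
Proof. by rewrite -mulN1r; exact: idealMl. Qed.

Definition ideal_eq (x y : R) := I (x - y).

Lemma ideal_eq_refl x : ideal_eq x x.
Proof. by rewrite /ideal_eq subrr; exact: ideal0. Qed.
Lemma ideal_eq_sym x y : ideal_eq x y -> ideal_eq y x.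
Proof. by move=> /idealN; rewrite opprB. Qed.
Lemma ideal_eq_trans x y z : ideal_eq x y -> ideal_eq y z -> ideal_eq x z.
Proof. by move=> xy yz; have := idealD xy yz; rewrite addrA subrK. Qed.

Definition rquot := quotient ideal_eq.

HB.instance Definition _ := Choice.on rquot.

Definition rproj (x : R) : rquot := @qclass _ ideal_eq x.
Local Notation cl := rproj.

Lemma rquotW (P : rquot -> Prop) : (forall x, P (cl x)) -> forall p, P p.
Proof. exact: quotW. Qed.

Lemma rquotP x y : cl x = cl y <-> I (x - y).
Proof. exact: (qclassP ideal_eq_refl ideal_eq_sym ideal_eq_trans). Qed.

Let repr x : I (qrepr (cl x) - x).
Proof. exact: (qrepr_class ideal_eq_refl ideal_eq_sym ideal_eq_trans). Qed.

Let add (p q : rquot) : rquot := cl (qrepr p + qrepr q).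
Let mul (p q : rquot) : rquot := cl (qrepr p * qrepr q).
Let opp (p : rquot) : rquot := cl (- qrepr p).

Let addE x y : add (cl x) (cl y) = cl (x + y).
Proof. by apply/rquotP; rewrite opprD addrACA; exact: idealD. Qed.
Let mulE x y : mul (cl x) (cl y) = cl (x * y).
Proof.
apply/rquotP; set x' := qrepr _; set y' := qrepr _.
have -> : x' * y' - x * y = (x' - x) * y' + x * (y' - y).
  by rewrite mulrBl mulrBr addrA subrK.
by apply: idealD; [apply: idealMr | apply: idealMl]; exact: repr.
Qed.
Let oppE x : opp (cl x) = cl (- x).
Proof. by apply/rquotP; rewrite -opprB opprK addrC; exact/idealN/repr. Qed.

Let addA : associative add.
Proof.
by elim/rquotW=> r; elim/rquotW=> s; elim/rquotW=> t; rewrite !addE addrA.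
Qed.
Let addC : commutative add.
Proof. by elim/rquotW=> r; elim/rquotW=> s; rewrite !addE addrC. Qed.
Let add0 : left_id (cl 0) add.
Proof. by elim/rquotW=> r; rewrite addE add0r. Qed.
Let addN : left_inverse (cl 0) opp add.
Proof. by elim/rquotW=> r; rewrite oppE addE addNr. Qed.
Let mulA : associative mul.
Proof.
by elim/rquotW=> r; elim/rquotW=> s; elim/rquotW=> t; rewrite !mulE mulrA.
Qed.
Let mul1 : left_id (cl 1) mul.
Proof. by elim/rquotW=> r; rewrite mulE mul1r. Qed.
Let mulr1 : right_id (cl 1) mul.
Proof. by elim/rquotW=> r; rewrite mulE mulr1. Qed.
Let mulDl : left_distributive mul add.
Proof.
elim/rquotW=> r; elim/rquotW=> s; elim/rquotW=> t.
by rewrite !(mulE, addE) mulrDl.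
Qed.
Let mulDr : right_distributive mul add.
Proof.
elim/rquotW=> r; elim/rquotW=> s; elim/rquotW=> t.
by rewrite !(mulE, addE) mulrDr.
Qed.

HB.instance Definition _ := GRing.isZmodule.Build rquot addA addC add0 addN.
HB.instance Definition _ :=
  GRing.Zmodule_isPzRing.Build rquot mulA mul1 mulr1 mulDl mulDr.

Let rproj_zmod : zmod_morphism rproj.
Proof.
move=> x y.
by have -> : cl (x - y) = cl x - cl y by rewrite -addE -oppE.
Qed.
Let rproj_monoid : monoid_morphism rproj.
Proof. by split=> // x y; rewrite -mulE. Qed.

HB.instance Definition _ := GRing.isZmodMorphism.Build R rquot rproj rproj_zmod.
HB.instance Definition _ :=
  GRing.isMonoidMorphism.Build R rquot rproj rproj_monoid.

End RingQuotient.

Section AdicCompletion.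
Variables (A : pzRingType) (m : ideal A).

Inductive ideal_pow : nat -> A -> Prop :=
  | ipow_all a : ideal_pow 0 a
  | ipow0 k : ideal_pow k 0
  | ipowD k a b : ideal_pow k a -> ideal_pow k b -> ideal_pow k (a + b)
  | ipowM k a b : m a -> ideal_pow k b -> ideal_pow k.+1 (a * b).

Lemma ipowMl k a x : ideal_pow k x -> ideal_pow k (a * x).
Proof.
elim=> {k x} [x|k|k x y _ ax _ ay|k x y mx y_k ay].
- exact: ipow_all.
- by rewrite mulr0; exact: ipow0.
- by rewrite mulrDr; exact: ipowD.
- by rewrite mulrA; apply: ipowM => //; exact: idealMl.
Qed.

Lemma ipowMr k a x : ideal_pow k x -> ideal_pow k (x * a).
Proof.
elim=> {k x} [x|k|k x y _ ax _ ay|k x y mx y_k ay].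
- exact: ipow_all.
- by rewrite mul0r; exact: ipow0.
- by rewrite mulrDl; exact: ipowD.
- by rewrite -mulrA; exact: ipowM.
Qed.

Definition ipow k : ideal A :=
  Ideal (ipow0 k) (@ipowD k) (@ipowMl k) (@ipowMr k).

Definition is_compatible (u : nat -> A) : bool :=
  `[< forall k, ideal_pow k (u k.+1 - u k) >].

Let compatible_subring : subring_closed is_compatible.
Proof.
split=> [|u v /asboolP uC /asboolP vC|u v /asboolP uC /asboolP vC];
  apply/asboolP=> k.
- by rewrite subrr; exact: ipow0.
- have -> : (u - v) k.+1 - (u - v) k = (u k.+1 - u k) - (v k.+1 - v k).
    rewrite -[LHS]/(u k.+1 - v k.+1 - (u k - v k)) !opprB.
    by rewrite [v k - u k]addrC [v k - v _]addrC addrACA.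
  by apply: ipowD => //; exact: (@idealN _ (ipow k)).
- have -> : (u * v) k.+1 - (u * v) k =
      (u k.+1 - u k) * v k.+1 + u k * (v k.+1 - v k).
    rewrite -[LHS]/(u k.+1 * v k.+1 - u k * v k).
    by rewrite mulrBl mulrBr addrA subrK.
  by apply: ipowD; [exact: ipowMr | exact: ipowMl].
Qed.

Record compatible := Compatible {
  seq_of :> nat -> A;
  _ : is_compatible seq_of
}.

HB.instance Definition _ := [isSub for seq_of].
HB.instance Definition _ := [Choice of compatible by <:].
HB.instance Definition _ := 
  GRing.SubChoice_isSubPzRing.Build _ _ compatible compatible_subring.

Definition null_seq : ideal compatible.
Proof.
exists (fun u : compatible => forall k, ideal_pow k (u k)).
- by move=> k; exact: ipow0.
- by move=> u v u0 v0 k; exact: ipowD.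
- by move=> a u u0 k; exact: ipowMl.
- by move=> a u u0 k; exact: ipowMr.
Defined.

(* The inverse limit of the A / m^k: compatible sequences modulo equality   *)
(* in all the A / m^k.                                                      *)
Definition adic_completion : pzRingType := rquot null_seq.

Lemma cst_compatible a : is_compatible (fun=> a).
Proof. by apply/asboolP=> k; rewrite subrr; exact: ipow0. Qed.

Definition to_completion (a : A) : adic_completion :=
  rproj null_seq (Compatible (cst_compatible a)).

Let to_completion_zmod : zmod_morphism to_completion.
Proof.
move=> a b; rewrite /to_completion -rmorphB.
by congr rproj; apply/val_inj.
Qed.
Let to_completion_monoid : monoid_morphism to_completion.
Proof.
split; rewrite /to_completion.
  by rewrite -(rmorph1 (rproj null_seq)); congr rproj; apply/val_inj.
by move=> a b; rewrite -rmorphM; congr rproj; apply/val_inj.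
Qed.

HB.instance Definition _ :=
  GRing.isZmodMorphism.Build A adic_completion to_completion to_completion_zmod.
HB.instance Definition _ := GRing.isMonoidMorphism.Build A adic_completion
  to_completion to_completion_monoid.

End AdicCompletion.

Record category := Category {
  obj :> Type;
  arr : obj -> obj -> Type;
  idm : forall x, arr x x;
  cmp : forall x y z, arr y z -> arr x y -> arr x z;
  cmp1m : forall x y (f : arr x y), cmp (idm y) f = f;
  cmpm1 : forall x y (f : arr x y), cmp f (idm x) = f;
  cmpA : forall x y z t (f : arr z t) (g : arr y z) (k : arr x y),
    cmp f (cmp g k) = cmp (cmp f g) k
}.
Arguments idm {c} x.
Arguments cmp {c x y z} f g.

Record functor (C D : category) := Functor {
  fobj :> C -> D;
  fmap : forall x y, arr x y -> arr (fobj x) (fobj y);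
  fmap1 : forall x, fmap (idm x) = idm (fobj x);
  fmapM : forall x y z (f : arr y z) (g : arr x y),
    fmap (cmp f g) = cmp (fmap f) (fmap g)
}.
Arguments fmap {C D} F {x y} f : rename.

Definition id_functor (C : category) : functor C C :=
  @Functor C C id (fun x y f => f) (fun=> erefl) (fun _ _ _ _ _ => erefl).

Definition comp_functor (C D E : category) (F : functor D E) (G : functor C D) :
  functor C E.
Proof.
exists (fun x => F (G x)) (fun x y f => fmap F (fmap G f)).
- by move=> x; rewrite !fmap1.
- by move=> x y z f g; rewrite !fmapM.
Defined.
Notation "F \oF G" := (comp_functor F G) (at level 40, left associativity).

Definition is_iso (C : category) (x y : C) (f : arr x y) : Prop :=
  exists g : arr y x, cmp f g = idm y /\ cmp g f = idm x.

Definition nat_isomorphic (C D : category) (F G : functor C D) : Prop :=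
  exists eta : forall x, arr (F x) (G x),
    (forall x y (f : arr x y), cmp (eta y) (fmap F f) = cmp (fmap G f) (eta x))
    /\ (forall x, is_iso (eta x)).

Definition quasi_inverse (C D : category) (F : functor C D) (G : functor D C) :
  Prop :=
  nat_isomorphic (G \oF F) (id_functor C)
  /\ nat_isomorphic (F \oF G) (id_functor D).

Definition right_adjoint (C D : category) (R : functor D C) (L : functor C D) :
  Prop :=
  exists phi : forall (x : C) (y : D), arr (L x) y -> arr x (R y),
    (forall x y, bijective (@phi x y))
    /\ (forall x x' y y' (f : arr x' x) (g : arr y y') (u : arr (L x) y),
          phi x' y' (cmp g (cmp u (fmap L f)))
          = cmp (fmap R g) (cmp (phi x y u) f)).

Section FullSubcategory.
Variables (C : category) (P : C -> Prop).

Definition full_sub : category := @Category {x : C | P x}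
  (fun x y => arr (sval x) (sval y)) (fun x => idm (sval x))
  (fun x y z f g => cmp f g) (fun x y => @cmp1m C _ _) (fun x y => @cmpm1 C _ _)
  (fun x y z t => @cmpA C _ _ _ _).

Definition full_incl : functor full_sub C :=
  @Functor full_sub C sval (fun x y f => f)
    (fun=> erefl) (fun _ _ _ _ _ => erefl).

End FullSubcategory.

Definition corestrict (C D : category) (P : D -> Prop) (F : functor C D)
    (FP : forall x, P (F x)) : functor C (full_sub P) :=
  @Functor C (full_sub P)
    (fun x => exist P (F x) (FP x)) (fun x y f => fmap F f)
    (fmap1 F) (fmapM F).

Section Modules.
Variable A : pzRingType.

Lemma linear_ext (M N : lmodType A) (f g : {linear M -> N}) : f =1 g -> f = g.
Proof.
case: f g => [f [[fz] [fs]]] [g [[gz] [gs]]] /= /funext efg.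
case: _ / efg gz gs => gz gs.
by rewrite (Prop_irrelevance fz gz) (Prop_irrelevance fs gs).
Qed.

Definition lin_id (M : lmodType A) : {linear M -> M} := idfun.
Definition lin_comp (M N P : lmodType A) (f : {linear N -> P})
  (g : {linear M -> N}) : {linear M -> P} := f \o g.

Definition Mod : category.
Proof.
exists (lmodType A : Type) (fun M N : lmodType A => {linear M -> N})
  lin_id lin_comp.
- by move=> M N f; exact: linear_ext.
- by move=> M N f; exact: linear_ext.
- by move=> M N P Q f g k; exact: linear_ext.
Defined.

Record submodule (M : lmodType A) := Submodule {
  in_sub :> M -> Prop;
  in_sub0 : in_sub 0;
  in_subD : forall u v, in_sub u -> in_sub v -> in_sub (u + v);
  in_subZ : forall a u, in_sub u -> in_sub (a *: u)
}.

Section SubmoduleType.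
Variables (M : lmodType A) (S : submodule M).

Definition sub_pred (v : M) : bool := `[< S v >].

Record submodT := SubMod { sub_val :> M; sub_valP : sub_pred sub_val }.

HB.instance Definition _ := [isSub for sub_val].
HB.instance Definition _ := [Choice of submodT by <:].

Let sub_pred_closed : submod_closed sub_pred.
Proof.
split; first exact/asboolP/in_sub0.
move=> a u v /asboolP uS /asboolP vS; apply/asboolP/in_subD => //.
exact: in_subZ.
Qed.

HB.instance Definition _ :=
  GRing.SubChoice_isSubLmodule.Build _ _ _ submodT sub_pred_closed.

End SubmoduleType.
End Modules.

Definition restr (A B : pzRingType) (phi : {rmorphism A -> B})
  (M : lmodType B) : Type := M.

Section Restriction.
Variables (A B : pzRingType) (phi : {rmorphism A -> B}).

Local Notation restr := (restr phi).

Section RestrModule.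
Variable M : lmodType B.
HB.instance Definition _ := GRing.Zmodule.on (restr M).

Let scale (a : A) (v : restr M) : restr M := phi a *: (v : M).
Let scaleA a b v : scale a (scale b v) = scale (a * b) v.
Proof. by rewrite /scale scalerA rmorphM. Qed.
Let scale1 : left_id 1 scale.
Proof. by move=> v; rewrite /scale rmorph1 scale1r. Qed.
Let scaleDr : right_distributive scale +%R.
Proof. by move=> a u v; rewrite /scale scalerDr. Qed.
Let scaleDl v : {morph scale^~ v : a b / a + b}.
Proof. by move=> a b; rewrite /scale rmorphD scalerDl. Qed.

HB.instance Definition _ :=
  GRing.Zmodule_isLmodule.Build A (restr M) scaleA scale1 scaleDr scaleDl.
End RestrModule.

Lemma restrE (M : lmodType B) (a : A) (v : restr M) :
  a *: v = phi a *: (v : M).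
Proof. by []. Qed.

Definition restr_map_fun (M N : lmodType B) (f : {linear M -> N}) :
  restr M -> restr N := f.

Section RestrMap.
Variables (M N : lmodType B) (f : {linear M -> N}).
Let restr_map_linear : linear (restr_map_fun f).
Proof. by move=> a u v; exact: linearP. Qed.
HB.instance Definition _ :=
  GRing.isLinear.Build A (restr M) (restr N) _
    (restr_map_fun f) restr_map_linear.
End RestrMap.

Definition restr_functor : functor (Mod B) (Mod A).
Proof.
exists (fun M : lmodType B => restr M : lmodType A)
  (fun (M N : lmodType B) (f : {linear M -> N}) =>
     restr_map_fun f : {linear restr M -> restr N}).
- by move=> M; exact: linear_ext.
- by move=> M N P f g; exact: linear_ext.
Defined.

End Restriction.

Section Subfunctor.
Variables (A : pzRingType) (S : forall M : lmodType A, submodule M).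
Hypothesis S_map : forall (M N : lmodType A) (f : {linear M -> N}) v,
  S M v -> S N (f v).

Section Map.
Variables (M N : lmodType A) (f : {linear M -> N}).
Lemma sub_mapP (v : submodT (S M)) : sub_pred (S N) (f (sub_val v)).
Proof. by apply/asboolP/S_map; case: v => v /= /asboolP. Qed.
Definition sub_map (v : submodT (S M)) : submodT (S N) := SubMod (sub_mapP v).
Let sub_map_linear : linear sub_map.
Proof. by move=> a u v; apply: val_inj; rewrite /= linearP. Qed.
HB.instance Definition _ :=
  GRing.isLinear.Build A (submodT (S M)) (submodT (S N)) _
    sub_map sub_map_linear.
End Map.

Definition sub_functor : functor (Mod A) (Mod A).
Proof.
exists (fun M : lmodType A => submodT (S M) : lmodType A)
  (fun (M N : lmodType A) (f : {linear M -> N}) =>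
     sub_map f : {linear submodT (S M) -> submodT (S N)}).
- by move=> M; apply: linear_ext => v; exact: val_inj.
- by move=> M N P f g; apply: linear_ext => v; exact: val_inj.
Defined.
End Subfunctor.

(* P (x)_A N for a (Z, A)-bimodule P: formal sums of tensors modulo the     *)
(* congruence generated by the abelian group axioms, biadditivity and       *)
(* A-balancedness.                                                          *)
Record bimodule (Z A : pzRingType) := Bimodule {
  bimod_sort :> lmodType Z;
  ract : bimod_sort -> A -> bimod_sort;
  ractDl : forall p q a, ract (p + q) a = ract p a + ract q a;
  ractDr : forall p a b, ract p (a + b) = ract p a + ract p b;
  ractM : forall p a b, ract p (a * b) = ract (ract p a) b;
  ract1 : forall p, ract p 1 = p;
  ractZ : forall z p a, ract (z *: p) a = z *: ract p a
}.

Section Tensor.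
Variables (Z A : pzRingType) (P : bimodule Z A) (N : lmodType A).

Inductive tterm : Type :=
  | TZero | TAdd of tterm & tterm | TOpp of tterm | TGen of P & N.

Inductive teq : tterm -> tterm -> Prop :=
  | teq_refl t : teq t t
  | teq_sym s t : teq s t -> teq t s
  | teq_trans r s t : teq r s -> teq s t -> teq r t
  | teq_add s s' t t' : teq s s' -> teq t t' -> teq (TAdd s t) (TAdd s' t')
  | teq_opp s s' : teq s s' -> teq (TOpp s) (TOpp s')
  | teq_addA r s t : teq (TAdd r (TAdd s t)) (TAdd (TAdd r s) t)
  | teq_addC s t : teq (TAdd s t) (TAdd t s)
  | teq_add0 t : teq (TAdd TZero t) t
  | teq_addN t : teq (TAdd (TOpp t) t) TZero
  | teq_genDl p q n : teq (TGen (p + q) n) (TAdd (TGen p n) (TGen q n))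
  | teq_genDr p n n' : teq (TGen p (n + n')) (TAdd (TGen p n) (TGen p n'))
  | teq_bal p a n : teq (TGen (ract p a) n) (TGen p (a *: n)).

Definition tensor := quotient teq.

HB.instance Definition _ := Choice.on tensor.

Definition tclass (t : tterm) : tensor := @qclass _ teq t.
Local Notation cl := tclass.

Lemma tensorW (Q : tensor -> Prop) : (forall t, Q (cl t)) -> forall p, Q p.
Proof. exact: quotW. Qed.

Lemma tensorP s t : cl s = cl t <-> teq s t.
Proof. exact: (qclassP teq_refl teq_sym teq_trans). Qed.

Lemma trepr t : teq (qrepr (cl t)) t.
Proof. exact: (qrepr_class teq_refl teq_sym teq_trans). Qed.

Let add (p q : tensor) : tensor := cl (TAdd (qrepr p) (qrepr q)).
Let opp (p : tensor) : tensor := cl (TOpp (qrepr p)).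

Let addE s t : add (cl s) (cl t) = cl (TAdd s t).
Proof. by apply/tensorP/teq_add; exact: trepr. Qed.
Let oppE t : opp (cl t) = cl (TOpp t).
Proof. by apply/tensorP/teq_opp; exact: trepr. Qed.

Let addA : associative add.
Proof.
elim/tensorW=> r; elim/tensorW=> s; elim/tensorW=> t.
by rewrite !addE; apply/tensorP/teq_addA.
Qed.
Let addC : commutative add.
Proof.
by elim/tensorW=> r; elim/tensorW=> s; rewrite !addE; apply/tensorP/teq_addC.
Qed.
Let add0 : left_id (cl TZero) add.
Proof. by elim/tensorW=> r; rewrite addE; apply/tensorP/teq_add0. Qed.
Let addN : left_inverse (cl TZero) opp add.
Proof. by elim/tensorW=> r; rewrite oppE addE; apply/tensorP/teq_addN. Qed.

HB.instance Definition _ := GRing.isZmodule.Build tensor addA addC add0 addN.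

Lemma tensorD s t : cl (TAdd s t) = cl s + cl t. Proof. by rewrite -addE. Qed.
Lemma tensorN t : cl (TOpp t) = - cl t. Proof. by rewrite -oppE. Qed.
Lemma tensor0 : cl TZero = 0. Proof. by []. Qed.

Definition pure (p : P) (n : N) : tensor := cl (TGen p n).

Lemma pureDl p q n : pure (p + q) n = pure p n + pure q n.
Proof. by rewrite -tensorD; apply/tensorP/teq_genDl. Qed.
Lemma pureDr p n n' : pure p (n + n') = pure p n + pure p n'.
Proof. by rewrite -tensorD; apply/tensorP/teq_genDr. Qed.
Lemma pure_bal p a n : pure (ract p a) n = pure p (a *: n).
Proof. exact/tensorP/teq_bal. Qed.

Lemma tensor_ind (Q : tensor -> Prop) :
  Q 0 -> (forall s t, Q s -> Q t -> Q (s + t)) -> (forall t, Q t -> Q (- t)) ->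
  (forall p n, Q (pure p n)) -> forall t, Q t.
Proof.
move=> Q0 QD QN Qp; elim/tensorW; elim=> [|s Qs t Qt|s Qs|p n].
- by rewrite tensor0.
- by rewrite tensorD; exact: QD.
- by rewrite tensorN; exact: QN.
- exact: Qp.
Qed.

Section Extend.
Variables (V : zmodType) (f : P -> N -> V).

Fixpoint teval (t : tterm) : V :=
  match t with
  | TZero => 0
  | TAdd s t => teval s + teval t
  | TOpp t => - teval t
  | TGen p n => f p n
  end.

Definition balanced : Prop :=
  [/\ forall p q n, f (p + q) n = f p n + f q n,
      forall p n n', f p (n + n') = f p n + f p n'
    & forall p a n, f (ract p a) n = f p (a *: n)].

Definition text (t : tensor) : V := teval (qrepr t).

Hypothesis f_bal : balanced.

Lemma text_class t : text (cl t) = teval t.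
Proof.
case: f_bal => fDl fDr fb.
suff: forall s t, teq s t -> teval s = teval t by apply; exact: trepr.
move=> r s; elim=> {r s} //=.
- by move=> r s u _ -> _.
- by move=> s s' u u' _ -> _ ->.
- by move=> s s' _ ->.
- by move=> *; rewrite addrA.
- by move=> *; rewrite addrC.
- by move=> *; rewrite add0r.
- by move=> *; rewrite addNr.
Qed.

Lemma text_pure p n : text (pure p n) = f p n.
Proof. exact: text_class. Qed.
Lemma textD s t : text (s + t) = text s + text t.
Proof.
by elim/tensorW: s => s; elim/tensorW: t => t; rewrite -tensorD !text_class.
Qed.
Lemma text0 : text 0 = 0. Proof. by rewrite -tensor0 text_class. Qed.
Lemma textN t : text (- t) = - text t.
Proof. by elim/tensorW: t => t; rewrite -tensorN !text_class. Qed.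

End Extend.

Lemma text_ext (V : zmodType) (f g : tensor -> V) :
  {morph f : x y / x + y} -> {morph g : x y / x + y} ->
  (forall p n, f (pure p n) = g (pure p n)) -> f =1 g.
Proof.
move=> fD gD fg.
have f0 : f 0 = 0 by apply: (addIr (f 0)); rewrite -fD !add0r.
have g0 : g 0 = 0 by apply: (addIr (g 0)); rewrite -gD !add0r.
apply: tensor_ind => [|s t es et|t et|p n].
- by rewrite f0 g0.
- by rewrite fD gD es et.
- by apply: (addrI (f t)); rewrite -fD subrr f0 et -gD subrr g0.
- exact: fg.
Qed.

Let scale (z : Z) : tensor -> tensor := text (fun p n => pure (z *: p) n).

Let scale_bal z : balanced (fun p n => pure (z *: p) n).
Proof.
split=> [p q n|p n n'|p a n].
- by rewrite scalerDr pureDl.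
- by rewrite pureDr.
- by rewrite -ractZ pure_bal.
Qed.

Let scaleE z p n : scale z (pure p n) = pure (z *: p) n.
Proof. exact: (text_pure (scale_bal z)). Qed.
Let scaleDr : right_distributive scale +%R.
Proof. by move=> z s t; exact: (textD (scale_bal z)). Qed.
Let scaleA a b v : scale a (scale b v) = scale (a * b) v.
Proof.
move: v; apply: text_ext => [s t|s t|p n]; try by rewrite !scaleDr.
by rewrite !scaleE scalerA.
Qed.
Let scale1 : left_id 1 scale.
Proof.
by apply: text_ext => [s t|s t|p n]; rewrite ?scaleDr // scaleE scale1r.
Qed.
Let scaleDl v : {morph scale^~ v : a b / a + b}.
Proof.
move=> a b; move: v.
apply: text_ext => [s t|s t|p n].
- exact: scaleDr.
- by rewrite !scaleDr addrACA.
- by rewrite !scaleE scalerDl pureDl.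
Qed.

HB.instance Definition _ :=
  GRing.Zmodule_isLmodule.Build Z tensor scaleA scale1 scaleDr scaleDl.

Lemma pureZ z p n : z *: pure p n = pure (z *: p) n.
Proof. exact: scaleE. Qed.

End Tensor.

Section TensorFunctor.
Variables (Z A : pzRingType) (P : bimodule Z A).

Section Map.
Variables (M N : lmodType A) (f : {linear M -> N}).

Definition tmap : tensor P M -> tensor P N := text (fun p n => pure p (f n)).

Let tmap_bal : balanced (fun p n => pure p (f n) : tensor P N).
Proof.
split=> [p q n|p n n'|p a n].
- by rewrite pureDl.
- by rewrite linearD pureDr.
- by rewrite linearZ pure_bal.
Qed.

Lemma tmap_pure p n : tmap (pure p n) = pure p (f n).
Proof. exact: (text_pure tmap_bal). Qed.

Let tmapD : {morph tmap : s t / s + t}.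
Proof. exact: (textD tmap_bal). Qed.

Let tmap_linear : linear tmap.
Proof.
move=> z s t; rewrite tmapD; congr (_ + _); move: s.
apply: text_ext => [s s'|s s'|p n].
- by rewrite scalerDr tmapD.
- by rewrite tmapD scalerDr.
- by rewrite pureZ !tmap_pure pureZ.
Qed.

HB.instance Definition _ :=
  GRing.isLinear.Build Z (tensor P M) (tensor P N) _ tmap tmap_linear.
End Map.

Definition tensor_functor : functor (Mod A) (Mod Z).
Proof.
exists (fun M : lmodType A => tensor P M : lmodType Z)
  (fun (M N : lmodType A) (f : {linear M -> N}) =>
     tmap f : {linear tensor P M -> tensor P N}).
- move=> M; apply: linear_ext.
  apply: text_ext => [s t|s t|p n]; rewrite ?linearD //.
  exact: (tmap_pure (lin_id M)).
- move=> M N Q f g; apply: linear_ext.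
  apply: text_ext => [s t|s t|p n]; rewrite ?linearD //.
  by rewrite /= (tmap_pure (lin_comp f g)) !tmap_pure.
Defined.

End TensorFunctor.

(* B as a (B, A)-bimodule; tensoring with it is extension of scalars. *)
Definition ext_bimodule (A B : pzRingType) (phi : {rmorphism A -> B}) :
  bimodule B A.
Proof.
exists (B^o : lmodType B) (fun (b : B) a => b * phi a).
- by move=> p q a; rewrite mulrDl.
- by move=> p a b; rewrite rmorphD mulrDr.
- by move=> p a b; rewrite rmorphM mulrA.
- by move=> p; rewrite rmorph1 mulr1.
- by move=> z p a; rewrite /GRing.scale /= mulrA.
Defined.

(* Fun_H(G, A) and Z(G, H, A); G is a whole finGroupType, the inclusion of  *)
(* C[H] in A is given on group elements.                                    *)
Section Centralizer.
Variables (G : finGroupType) (H : {group G}) (A : pzRingType).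
Variable iota : subg_of H -> A.

Definition equivariant (f : G -> A) : bool :=
  `[< forall (k : subg_of H) g, f (sgval k * g)%g = iota k * f g >].

Record funH := FunH { fun_val :> G -> A; fun_valP : equivariant fun_val }.

HB.instance Definition _ := [isSub for fun_val].
HB.instance Definition _ := [Choice of funH by <:].

Let equivariant_zmod : zmod_closed equivariant.
Proof.
split=> [|f f' /asboolP fE /asboolP f'E]; apply/asboolP=> k g.
  by rewrite mulr0.
by rewrite -[LHS]/(f _ - f' _) fE f'E -mulrBr.
Qed.

HB.instance Definition _ :=
  GRing.SubChoice_isSubZmodule.Build _ _ funH equivariant_zmod.

Lemma funH_ract_subproof (f : funH) (a : A) : equivariant (fun g => f g * a).
Proof.
by case: f => f /= /asboolP fE; apply/asboolP=> k g; rewrite fE mulrA.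
Qed.
Definition funH_ract (f : funH) (a : A) : funH := FunH (funH_ract_subproof f a).

Definition right_linear (z : funH -> funH) : bool :=
  `[< (forall f f', z (f + f') = z f + z f') /\
      (forall f a, z (funH_ract f a) = funH_ract (z f) a) >].

Record centralizer := Centralizer {
  cent_fun :> funH -> funH;
  cent_funP : right_linear cent_fun
}.

HB.instance Definition _ := [isSub for cent_fun].
HB.instance Definition _ := [Choice of centralizer by <:].

Let funH_ractB f f' a : funH_ract (f - f') a = funH_ract f a - funH_ract f' a.
Proof. by apply: val_inj; apply/funext => g; exact: mulrBl. Qed.

Let right_linear_zmod : zmod_closed right_linear.
Proof.
split=> [|z z' /asboolP[zD zR] /asboolP[z'D z'R]]; apply/asboolP; split.
- by move=> f f'; rewrite addr0.
- by move=> f a; apply: val_inj; apply/funext => g; rewrite /= mul0r.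
- by move=> f f'; rewrite -[LHS]/(z _ - z' _) zD z'D opprD addrACA.
- by move=> f a; rewrite -[LHS]/(z _ - z' _) zR z'R -funH_ractB.
Qed.

HB.instance Definition _ :=
  GRing.SubChoice_isSubZmodule.Build _ _ centralizer right_linear_zmod.

Let one_subproof : right_linear id. Proof. exact/asboolP. Qed.
Let one := Centralizer one_subproof.
Let mul_subproof (z z' : centralizer) : right_linear (z \o z').
Proof.
case: z z' => z /= /asboolP[zD zR] [z' /= /asboolP[z'D z'R]].
by apply/asboolP; split=> [f f'|f a] /=; rewrite ?z'D ?zD // z'R zR.
Qed.
Let mul z z' := Centralizer (mul_subproof z z').

Let mulA : associative mul. Proof. by move=> x y z; exact: val_inj. Qed.
Let mul1 : left_id one mul. Proof. by move=> x; exact: val_inj. Qed.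
Let mulr1 : right_id one mul. Proof. by move=> x; exact: val_inj. Qed.
Let mulDl : left_distributive mul +%R.
Proof. by move=> x y z; exact: val_inj. Qed.
Let mulDr : right_distributive mul +%R.
Proof.
move=> [x /= xP] y z; apply: val_inj; apply/funext => f /=.
by case/asboolP: xP => xD _; exact: xD.
Qed.

HB.instance Definition _ :=
  GRing.Zmodule_isPzRing.Build centralizer mulA mul1 mulr1 mulDl mulDr.

Let scale (z : centralizer) (f : funH) : funH := z f.
Let scaleA a b v : scale a (scale b v) = scale (a * b) v. Proof. by []. Qed.
Let scale1 : left_id 1 scale. Proof. by []. Qed.
Let scaleDr : right_distributive scale +%R.
Proof. by case=> z /= /asboolP[zD _] u v; exact: zD. Qed.
Let scaleDl v : {morph scale^~ v : a b / a + b}. Proof. by []. Qed.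

HB.instance Definition _ :=
  GRing.Zmodule_isLmodule.Build centralizer funH scaleA scale1 scaleDr scaleDl.

Definition funH_bimodule : bimodule centralizer A.
Proof.
exists (funH : lmodType centralizer) funH_ract.
- by move=> f f' a; apply: val_inj; apply/funext => g; exact: mulrDl.
- by move=> f a b; apply: val_inj; apply/funext => g; exact: mulrDr.
- by move=> f a b; apply: val_inj; apply/funext => g; exact: mulrA.
- by move=> f; apply: val_inj; apply/funext => g; exact: GRing.mulr1.
- by case=> z /= zP f a; case/asboolP: (zP) => _; exact.
Defined.

Definition induce : functor (Mod A) (Mod centralizer) :=
  tensor_functor funH_bimodule.

End Centralizer.

(* A subgroup of GL(h) is given as an abstract group W with a faithful      *)
(* representation rho. The vectors alpha_s, alpha_s^vee (alphav) are part   *)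
(* of the data, being only defined up to scalars with fixed pairing; lam is *)
(* the nontrivial eigenvalue on the dual of h and cpar is the parameter c.  *)
(* The values at elements which are not reflections are irrelevant.         *)
Record cherednik_data (C : fieldType) (h : vectType C) (W : finGroupType) :=
  CherednikData {
    rho : W -> 'End(h);
    alpha : W -> 'Hom(h, C^o);
    alphav : W -> h;
    lam : W -> C;
    cpar : W -> C
  }.

Section Datum.
Variables (C : fieldType) (h : vectType C) (W : finGroupType).
Variable D : cherednik_data h W.

Definition dact (w : W) (x : 'Hom(h, C^o)) : 'Hom(h, C^o) :=
  (x \o rho D w^-1%g)%VF.

Definition reflections : {set W} :=
  [set s | \dim (limg (rho D s - \1%VF)) == 1%N].

Record is_cherednik_data : Prop := IsCherednikData {
  rho1 : rho D 1%g = \1%VF;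
  rhoM : forall u w, rho D (u * w)%g = (rho D u \o rho D w)%VF;
  rho_inj : injective (rho D);
  alphaP : forall s, s \in reflections -> forall x : 'Hom(h, C^o),
    (exists k : C, x = k *: alpha D s) <-> (exists z, x = dact s z - z);
  alphavP : forall s, s \in reflections ->
    <[alphav D s]>%VS = limg (rho D s - \1%VF);
  alpha_alphav : forall s, s \in reflections -> alpha D s (alphav D s) = 2;
  lamP : forall s, s \in reflections ->
    lam D s != 1 /\ exists2 x, x != 0 & dact s x = lam D s *: x;
  cparJ : forall s w, s \in reflections -> cpar D (s ^ w)%g = cpar D s
}.

Definition fix_space : {vspace h} := (\bigcap_(w : W) fixedSpace (rho D w))%VS.

(* C[h], as the symmetric algebra of the dual of h. *)
Inductive poly_rel :
    aterm C 'Hom(h, C^o) -> aterm C 'Hom(h, C^o) -> Prop :=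
  | poly_lin k x x' :
      poly_rel (Gen _ (k *: x + x'))
        (Add (Mul (@Cst C _ k) (Gen _ x)) (Gen _ x'))
  | poly_comm x x' :
      poly_rel (Mul (Gen _ x) (Gen _ x')) (Mul (Gen _ x') (Gen _ x)).

Definition coord_ring : pzRingType := palg poly_rel.

Definition coordf (x : 'Hom(h, C^o)) : coord_ring := pgen poly_rel x.

Inductive cher_gen := GW of W | GX of 'Hom(h, C^o) | GY of h.

Local Notation tw w := (Gen C (GW w)).
Local Notation tx x := (Gen C (GX x)).
Local Notation ty y := (Gen C (GY y)).
Local Notation tc a := (@Cst C cher_gen a).

Inductive cher_rel : aterm C cher_gen -> aterm C cher_gen -> Prop :=
  | cher_w1 : cher_rel (tw 1%g) (tc 1)
  | cher_wM u w : cher_rel (tw (u * w)%g) (Mul (tw u) (tw w))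
  | cher_xlin k x x' :
      cher_rel (tx (k *: x + x')) (Add (Mul (tc k) (tx x)) (tx x'))
  | cher_ylin k y y' :
      cher_rel (ty (k *: y + y')) (Add (Mul (tc k) (ty y)) (ty y'))
  | cher_wx w x : cher_rel (Mul (tw w) (tx x)) (Mul (tx (dact w x)) (tw w))
  | cher_wy w y : cher_rel (Mul (tw w) (ty y)) (Mul (ty (rho D w y)) (tw w))
  | cher_xx x x' : cher_rel (acomm (tx x) (tx x')) (tc 0)
  | cher_yy y y' : cher_rel (acomm (ty y) (ty y')) (tc 0)
  | cher_yx y x : cher_rel (acomm (ty y) (tx x))
      (asub (tc (x y))
         (\big[@Add C cher_gen/tc 0]_(s in reflections)
            Mul (tc (cpar D s * alpha D s y * x (alphav D s))) (tw s))).

Definition cherednik : pzRingType := palg cher_rel.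

Definition Hw (w : W) : cherednik := pgen cher_rel (GW w).
Definition Hx (x : 'Hom(h, C^o)) : cherednik := pgen cher_rel (GX x).
Definition Hy (y : h) : cherednik := pgen cher_rel (GY y).
Definition Hc (a : C) : cherednik := pcst cher_rel a.

Local Notation ev := (aeval (pcst cher_rel : {rmorphism C -> cherednik})
  (pgen cher_rel)).

Lemma ev_class t : ev t = pclass cher_rel t.
Proof. by elim: t => //= [s -> t ->|s -> t ->]; rewrite ?palgD ?palgM. Qed.

Lemma cher_relE s t : cher_rel s t -> ev s = ev t.
Proof. by move=> st; rewrite !ev_class; exact/aeqP/aeq_rel. Qed.

Lemma Hw1 : Hw 1%g = 1.
Proof. by rewrite [LHS](cher_relE cher_w1) /= rmorph1. Qed.
Lemma HwM u w : Hw (u * w)%g = Hw u * Hw w.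
Proof. exact: (cher_relE (cher_wM u w)). Qed.
Lemma Hx_lin k x x' : Hx (k *: x + x') = Hc k * Hx x + Hx x'.
Proof. exact: (cher_relE (cher_xlin k x x')). Qed.
Lemma Hy_lin k y y' : Hy (k *: y + y') = Hc k * Hy y + Hy y'.
Proof. exact: (cher_relE (cher_ylin k y y')). Qed.
Lemma Hwx w x : Hw w * Hx x = Hx (dact w x) * Hw w.
Proof. exact: (cher_relE (cher_wx w x)). Qed.
Lemma Hwy w y : Hw w * Hy y = Hy (rho D w y) * Hw w.
Proof. exact: (cher_relE (cher_wy w y)). Qed.
Lemma Hxx x x' : Hx x * Hx x' = Hx x' * Hx x.
Proof.
have := cher_relE (cher_xx x x').
by rewrite aeval_comm /= rmorph0 => /subr0_eq.
Qed.
Lemma Hyy y y' : Hy y * Hy y' = Hy y' * Hy y.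
Proof.
have := cher_relE (cher_yy y y').
by rewrite aeval_comm /= rmorph0 => /subr0_eq.
Qed.
Lemma Hyx y x : Hy y * Hx x - Hx x * Hy y =
  Hc (x y) - \sum_(s in reflections)
    Hc (cpar D s * alpha D s y * x (alphav D s)) * Hw s.
Proof.
by have := cher_relE (cher_yx y x); rewrite aeval_comm aeval_sub aeval_sum.
Qed.

Lemma cher_lift_rel (R : pzRingType) (k : {rmorphism C -> R})
    (fw : W -> R) (fx : 'Hom(h, C^o) -> R) (fy : h -> R) :
  fw 1%g = 1 -> (forall u w, fw (u * w)%g = fw u * fw w) ->
  (forall a x x', fx (a *: x + x') = k a * fx x + fx x') ->
  (forall a y y', fy (a *: y + y') = k a * fy y + fy y') ->
  (forall w x, fw w * fx x = fx (dact w x) * fw w) ->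
  (forall w y, fw w * fy y = fy (rho D w y) * fw w) ->
  (forall x x', fx x * fx x' = fx x' * fx x) ->
  (forall y y', fy y * fy y' = fy y' * fy y) ->
  (forall y x, fy y * fx x - fx x * fy y =
     k (x y) - \sum_(s in reflections)
       k (cpar D s * alpha D s y * x (alphav D s)) * fw s) ->
  respects_rel cher_rel k
    (fun g => match g with GW w => fw w | GX x => fx x | GY y => fy y end).
Proof.
move=> w1 wM xl yl wx wy xx yy yx s t; case=> {s t}.
- by rewrite /= rmorph1.
- by move=> u w; exact: wM.
- by move=> *; exact: xl.
- by move=> *; exact: yl.
- by move=> *; exact: wx.
- by move=> *; exact: wy.
- by move=> x x'; rewrite aeval_comm /= xx subrr rmorph0.
- by move=> y y'; rewrite aeval_comm /= yy subrr rmorph0.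
- by move=> y x; rewrite aeval_comm aeval_sub aeval_sum /= yx.
Qed.

Section CoordinateRing.

Let poly_central : central_scalars (pcst poly_rel).
Proof. exact: pcstC. Qed.
Let cher_central : central_scalars (pcst cher_rel).
Proof. exact: pcstC. Qed.

Local Notation pev := (aeval (pcst poly_rel : {rmorphism C -> coord_ring})
  (pgen poly_rel)).

Lemma pev_class t : pev t = pclass poly_rel t.
Proof. by elim: t => //= [s -> t ->|s -> t ->]; rewrite ?palgD ?palgM. Qed.

Lemma poly_relE s t : poly_rel s t -> pev s = pev t.
Proof. by move=> st; rewrite !pev_class; exact/aeqP/aeq_rel. Qed.

Let act_rel w : respects_rel poly_rel
  (pcst poly_rel : {rmorphism C -> coord_ring})
  (fun x => coordf (dact w x)).
Proof.
move=> s t; case=> {s t} [k x x'|x x'] /=.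
- have -> : dact w (k *: x + x') = k *: dact w x + dact w x'.
    by rewrite /dact comp_lfunDl comp_lfunZl.
  exact: (poly_relE (poly_lin k (dact w x) (dact w x'))).
- exact: (poly_relE (poly_comm (dact w x) (dact w x'))).
Qed.

Definition poly_act (w : W) : {rmorphism coord_ring -> coord_ring} :=
  plift poly_central (act_rel w).

Let eval_central : central_scalars (idfun : {rmorphism C -> C}).
Proof. by move=> a x; rewrite mulrC. Qed.

Let eval_rel (b : h) :
  respects_rel poly_rel (idfun : {rmorphism C -> C}) (fun x => x b).
Proof.
move=> s t; case=> {s t} [k x x'|x x'] /=; last by rewrite mulrC.
by rewrite add_lfunE scale_lfunE.
Qed.

Definition poly_eval (b : h) : {rmorphism coord_ring -> C} :=
  plift eval_central (eval_rel b).

Let toH_rel : respects_rel poly_rel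
  (pcst cher_rel : {rmorphism C -> cherednik}) Hx.
Proof.
move=> s t; case=> {s t} [k x x'|x x'] /=; first exact: Hx_lin.
exact: Hxx.
Qed.

Definition poly_toH : {rmorphism coord_ring -> cherednik} :=
  plift cher_central toH_rel.

End CoordinateRing.

Definition is_invariant (p : coord_ring) : bool :=
  `[< forall w, poly_act w p = p >].

Record invariant := Invariant {
  inv_val : coord_ring; inv_valP : is_invariant inv_val
}.

HB.instance Definition _ := [isSub for inv_val].
HB.instance Definition _ := [Choice of invariant by <:].

Let invariant_subring : subring_closed is_invariant.
Proof.
split=> [|p q /asboolP pI /asboolP qI|p q /asboolP pI /asboolP qI];
  apply/asboolP=> w.
- by rewrite rmorph1.
- by rewrite rmorphB pI qI.
- by rewrite rmorphM pI qI.
Qed.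

HB.instance Definition _ :=
  GRing.SubChoice_isSubPzRing.Build _ _ invariant invariant_subring.

Definition inv_incl : {rmorphism invariant -> coord_ring} :=
  (\val : invariant -> coord_ring).

Definition inv_toH : {rmorphism invariant -> cherednik} := poly_toH \o inv_incl.

(* The maximal ideal of C[h]^W at the image of b in h/W. *)
Definition max_ideal (b : h) : ideal invariant.
Proof.
exists (fun p : invariant => poly_eval b (inv_incl p) = 0).
- by rewrite !rmorph0.
- by move=> p q p0 q0; rewrite !rmorphD p0 q0 addr0.
- by move=> p q q0; rewrite !rmorphM q0 mulr0.
- by move=> p q q0; rewrite !rmorphM q0 mul0r.
Defined.

Definition inv_completion (b : h) : pzRingType := adic_completion (max_ideal b).

Definition inv_to_completion (b : h) :
    {rmorphism invariant -> inv_completion b} :=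
  @to_completion invariant (max_ideal b).

(* The completed algebra at b: a ring structure on                          *)
(*   (C[h]^W)^ (x)_{C[h]^W} H_c                                             *)
(* extending those of both factors. By PBW and by continuity of the         *)
(* commutators such a structure is unique up to a unique isomorphism.       *)
Definition completed_tensor (b : h) : lmodType (inv_completion b) :=
  tensor (ext_bimodule (inv_to_completion b)) (restr inv_toH cherednik^o).

Record completed_cherednik (b : h) := CompletedCherednik {
  cc_ring :> pzRingType;
  cc_H : {rmorphism cherednik -> cc_ring};
  cc_fun : {rmorphism inv_completion b -> cc_ring};
  cc_compat : forall p : invariant,
    cc_fun (inv_to_completion b p) = cc_H (inv_toH p);
  cc_mul : {additive completed_tensor b -> cc_ring};
  cc_mulE : forall (f : inv_completion b) (u : cherednik),
    cc_mul (pure (f : ext_bimodule (inv_to_completion b))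
                 (u : restr inv_toH cherednik^o)) = cc_fun f * cc_H u;
  cc_mul_bij : bijective cc_mul
}.

Definition fg_over_poly (M : lmodType cherednik) : Prop :=
  exists (n : nat) (g : 'I_n -> M), forall v, exists p : 'I_n -> coord_ring,
    v = \sum_i poly_toH (p i) *: g i.

Definition nilpotent_vector (M : lmodType cherednik) (v : M) : Prop :=
  exists k : nat, forall ys : k.-tuple h, foldr (fun y u => Hy y *: u) v ys = 0.

Definition is_O (M : lmodType cherednik) : Prop :=
  fg_over_poly M /\ forall v : M, nilpotent_vector v.

Definition category_O : category := full_sub (C := Mod cherednik) is_O.

Section NilpotentPart.
Variable M : lmodType cherednik.

Fixpoint nil_le (k : nat) (v : M) : Prop :=
  if k is k'.+1 then forall y, nil_le k' (Hy y *: v) else v = 0.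

Lemma nil_leP k v : nil_le k v <->
  forall ys : k.-tuple h, foldr (fun y u => Hy y *: u) v ys = 0.
Proof.
elim: k v => [|k IHk] v /=.
  by split=> [-> ys|/(_ [tuple])//]; rewrite [ys]tuple0.
split=> [nv [ys]|nv y].
  case/lastP: ys => [|ys y] //=; rewrite size_rcons eqSS => ysk.
  rewrite foldr_rcons; have /IHk nvy := nv y.
  exact: (nvy (Tuple ysk)).
apply/IHk=> ys; have := nv [tuple of rcons ys y].
by rewrite /= foldr_rcons.
Qed.

Lemma nil_le0 k : nil_le k 0.
Proof. by elim: k => //= k IHk y; rewrite scaler0. Qed.

Lemma nil_leD k u v : nil_le k u -> nil_le k v -> nil_le k (u + v).
Proof.
elim: k u v => /= [u v -> ->|k IHk u v uN vN y]; first by rewrite addr0.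
by rewrite scalerDr; exact: IHk.
Qed.

Lemma nil_leS k v : nil_le k v -> nil_le k.+1 v.
Proof.
elim: k v => [v /= -> y|k IHk v vN y]; first by rewrite scaler0.
exact/IHk/vN.
Qed.

Lemma nil_leW k l v : (k <= l)%N -> nil_le k v -> nil_le l v.
Proof.
move=> /subnK <-; elim: (l - k)%N => // n IHn vN.
by rewrite addSn; exact/nil_leS/IHn.
Qed.

Lemma nil_leC k a v : nil_le k v -> nil_le k (Hc a *: v).
Proof.
elim: k v => /= [v ->|k IHk v vN y]; first by rewrite scaler0.
by rewrite scalerA -pcstC -scalerA; exact: IHk.
Qed.

Lemma nil_leN k v : nil_le k v -> nil_le k (- v).
Proof. by move/(nil_leC (-1)); rewrite /Hc rmorphN1 scaleN1r. Qed.

Hypothesis DP : is_cherednik_data.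

Lemma nil_lew k w v : nil_le k v -> nil_le k (Hw w *: v).
Proof.
elim: k v => /= [v ->|k IHk v vN y]; first by rewrite scaler0.
have -> : Hy y *: (Hw w *: v) = Hw w *: (Hy (rho D w^-1%g y) *: v).
  by rewrite !scalerA Hwy -comp_lfunE -(rhoM DP) mulgV (rho1 DP) id_lfunE.
exact: IHk.
Qed.

Lemma nil_lex k x v : nil_le k v -> nil_le k.+1 (Hx x *: v).
Proof.
elim: k v => [v -> y|k IHk v vN y]; first by rewrite !scaler0.
have -> : Hy y *: (Hx x *: v) = Hx x *: (Hy y *: v) +
    (Hc (x y) *: v - \sum_(s in reflections)
       Hc (cpar D s * alpha D s y * x (alphav D s)) *: (Hw s *: v)).
  rewrite !scalerA -[Hy y * Hx x](subrK (Hx x * Hy y)) Hyx scalerDl addrC.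
  congr (_ + _); rewrite scalerBl scaler_suml; congr (_ - _).
  by apply: eq_bigr => s _; rewrite scalerA.
apply: (@nil_leD k.+1); first exact/IHk/vN.
apply: (@nil_leD k.+1); first exact: (@nil_leC k.+1).
apply: (@nil_leN k.+1); elim/big_ind: _ => [|u u'|s _];
  [exact: (nil_le0 k.+1)|exact: (@nil_leD k.+1)|].
by apply: (@nil_leC k.+1); exact: (@nil_lew k.+1).
Qed.

Definition nilpotent_sub : submodule M.
Proof.
exists (@nilpotent_vector M).
- by exists 0%N => ys; rewrite tuple0.
- move=> u v [k /nil_leP uN] [l /nil_leP vN]; exists (maxn k l); apply/nil_leP.
  by apply: nil_leD; [apply: nil_leW uN; exact: leq_maxl
                     |apply: nil_leW vN; exact: leq_maxr].
- move=> a u [k /nil_leP uN].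
  suff: exists k, nil_le k (a *: u) by case=> l /nil_leP; exists l.
  elim/palg_ind: a k u uN => [a|[w|x|y]|p q IHp IHq|p q IHp IHq] k u uN.
  + by exists k; exact: nil_leC.
  + by exists k; exact: nil_lew.
  + by exists k.+1; exact: nil_lex.
  + by case: k uN => [/= ->|k uN];
      [exists 0%N; rewrite scaler0|exists k; exact: uN].
  + have [[i pN] [j qN]] := (IHp _ _ uN, IHq _ _ uN); exists (maxn i j).
    by rewrite scalerDl; apply: nil_leD;
      [apply: nil_leW pN; exact: leq_maxl|apply: nil_leW qN; exact: leq_maxr].
  + by have [i qN] := IHq _ _ uN; rewrite -scalerA; exact: IHp qN.
Defined.

End NilpotentPart.

Lemma nilpotent_map (DP : is_cherednik_data) (M N : lmodType cherednik)
    (f : {linear M -> N}) (v : M) :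
  nilpotent_sub M DP v -> nilpotent_sub N DP (f v).
Proof.
move=> [k vN]; exists k => ys; rewrite -[RHS](linear0 f) -(vN ys).
by elim: (tval ys) => //= y s ->; rewrite linearZ.
Qed.

Definition nilpotent_functor (DP : is_cherednik_data) :
    functor (Mod cherednik) (Mod cherednik) :=
  sub_functor (@nilpotent_map DP).

Section CompletionFunctors.
Variables (b : h) (A : completed_cherednik b).

Definition completion_functor : functor (Mod cherednik) (Mod A) :=
  tensor_functor (ext_bimodule (cc_H A)).

(* E^b *)
Definition E_functor (DP : is_cherednik_data) :
    functor (Mod A) (Mod cherednik) :=
  nilpotent_functor DP \oF restr_functor (cc_H A).

End CompletionFunctors.

End Datum.

Section RestrictedData.
Variables (C : fieldType) (h : vectType C) (W : finGroupType).
Variable D : cherednik_data h W.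

Definition sub_data (K : {group W}) : cherednik_data h (subg_of K) :=
  CherednikData (fun w => rho D (sgval w)) (fun w => alpha D (sgval w))
    (fun w => alphav D (sgval w)) (fun w => lam D (sgval w))
    (fun w => cpar D (sgval w)).

Lemma refl_sub (K : {group W}) s :
  (s \in reflections (sub_data K)) = (sgval s \in reflections D).
Proof. by rewrite !inE. Qed.

Lemma sub_dataP (K : {group W}) :
  is_cherednik_data D -> is_cherednik_data (sub_data K).
Proof.
move=> DP; split.
- exact: (rho1 DP).
- by move=> u w; exact: (rhoM DP).
- by move=> u w /(rho_inj DP) /subg_inj.
- by move=> s; rewrite refl_sub => /(alphaP DP).
- by move=> s; rewrite refl_sub => /(alphavP DP).
- by move=> s; rewrite refl_sub => /(alpha_alphav DP).
- by move=> s; rewrite refl_sub => /(lamP DP).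
- by move=> s w; rewrite refl_sub => sR; exact: (cparJ DP (sgval w) sR).
Qed.

Variable U : {vspace h}.

(* The data induced on U, for U the W-stable complement of h^W.             *)
Definition ess_data : cherednik_data (subvs_of U) W :=
  CherednikData
    (fun w => linfun (vsproj U) \o rho D w \o linfun vsval)%VF
    (fun s => alpha D s \o linfun vsval)%VF
    (fun s => vsproj U (alphav D s)) (lam D) (cpar D).

Record is_stable_complement : Prop := IsStableComplement {
  compl_stable : forall w, (rho D w @: U <= U)%VS;
  compl_add : (U + fix_space D = fullv)%VS;
  compl_cap : (U :&: fix_space D = 0)%VS
}.

End RestrictedData.

Section Stabilizer.
Variables (C : fieldType) (h : vectType C) (W : finGroupType).
Variables (D : cherednik_data h W) (DP : is_cherednik_data D) (b : h).

Definition stab_set : {set W} := [set w | rho D w b == b].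

Lemma stab_group_set : group_set stab_set.
Proof.
apply/group_setP; split=> [|u w]; rewrite !inE.
  by rewrite (rho1 DP) id_lfunE.
by rewrite (rhoM DP) comp_lfunE => /eqP ub /eqP ->; exact/eqP.
Qed.

Definition stab : {group W} := Group stab_group_set.

End Stabilizer.

Section Zeta.
Variables (C : fieldType) (h : vectType C) (W : finGroupType).
Variables (D : cherednik_data h W) (DP : is_cherednik_data D).
Variables (U : {vspace h}) (UP : is_stable_complement D U).

Local Notation F := (fix_space D).
Local Notation D' := (ess_data D U).

Lemma capUF : (U :&: F)%VS = 0%VS. Proof. exact: compl_cap UP. Qed.

(* The projection of h onto U along h^W; it identifies h / h^W with U and    *)
(* the linear forms on U with the linear forms on h which vanish on h^W.    *)
Definition proj_ess : 'Hom(h, subvs_of U) :=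
  (linfun (vsproj U) \o daddv_pi U F)%VF.

Lemma fix_spaceP y : reflect (forall w, rho D w y = y) (y \in F).
Proof.
rewrite memvE; apply: (iffP subv_bigcapP) => [yF w|yF w _].
  by apply/fixedSpaceP; rewrite memvE; exact: yF.
by rewrite -memvE; exact/fixedSpaceP.
Qed.

Lemma decomp (y : h) : exists u f, [/\ u \in U, f \in F & y = u + f].
Proof.
have: y \in (U + F)%VS by rewrite (compl_add UP) memvf.
by case/memv_addP=> u uU [f fF ->]; exists u, f.
Qed.

Lemma daddF f : f \in F -> daddv_pi U F f = 0.
Proof.
move=> fF; have := daddv_pi_add capUF (subvP (addvSr U F) _ fF).
have FU : (F :&: U = 0)%VS by rewrite capvC capUF.
rewrite (daddv_pi_id FU fF) => /(canRL (addrK f)) ->; exact: subrr.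
Qed.

Lemma projU u : u \in U -> proj_ess u = vsproj U u.
Proof. by move=> uU; rewrite comp_lfunE lfunE /= (daddv_pi_id capUF). Qed.

Lemma projF f : f \in F -> proj_ess f = 0.
Proof. by move=> fF; rewrite comp_lfunE lfunE /= daddF // linear0. Qed.

Lemma actU w u : u \in U -> rho D w u \in U.
Proof. by move=> uU; apply: (subvP (compl_stable UP w)); exact: memv_img. Qed.

Lemma ess_actE w (u : subvs_of U) : vsval (rho D' w u) = rho D w (vsval u).
Proof. by rewrite /= !comp_lfunE !lfunE /= vsprojK // actU // subvsP. Qed.

Lemma proj_act w y : proj_ess (rho D w y) = rho D' w (proj_ess y).
Proof.
have [u [f [uU fF ->]]] := decomp y.
have /fix_spaceP fw := fF.
set a := rho D' w.
rewrite !linearD /= fw (projF fF) linear0 !addr0 !projU ?actU //.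
by apply: val_inj; rewrite -[RHS]/(vsval _) ess_actE /= !vsprojK ?actU.
Qed.

Lemma imgU s y : (rho D s - \1%VF) y \in U.
Proof.
have [u [f [uU /fix_spaceP fF ->]]] := decomp y.
rewrite linearD /= !(add_lfunE, opp_lfunE) !id_lfunE fF subrr addr0.
by rewrite memvB // actU.
Qed.

Lemma ess_subE s (u : subvs_of U) :
  vsval ((rho D' s - \1%VF) u) = (rho D s - \1%VF) (vsval u).
Proof.
rewrite !(add_lfunE, opp_lfunE, id_lfunE) -ess_actE.
exact: (linearB (vsval : {linear subvs_of U -> h})).
Qed.

Lemma refl_ess : reflections D' = reflections D.
Proof.
apply/setP => s; rewrite !inE; congr (_ == _).
have -> : limg (rho D s - \1%VF) =
    (linfun (vsval : subvs_of U -> h) @: limg (rho D' s - \1%VF))%VS.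
  apply/vspaceP => y; apply/memv_imgP/memv_imgP.
  - case=> z _ ->; have [u [f [uU /fix_spaceP fF ->]]] := decomp z.
    exists ((rho D' s - \1%VF) (vsproj U u)); first exact/memv_img/memvf.
    rewrite [RHS]lfunE -[RHS]/(vsval _) ess_subE vsprojK // linearD.
    rewrite [X in _ + X](_ : _ = 0) ?addr0 //.
    by rewrite /= !(add_lfunE, opp_lfunE, id_lfunE) fF subrr.
  - case=> z /memv_imgP[u _ ->] ->; exists (vsval u); first exact: memvf.
    by rewrite [LHS]lfunE -[LHS]/(vsval _) ess_subE.
rewrite [RHS]limg_dim_eq //; apply/eqP.
rewrite -subv0; apply/subvP => u.
rewrite memv_cap => /andP[_]; rewrite memv_ker lfunE /= => /eqP u0.
by rewrite memv0; apply/eqP/val_inj.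
Qed.

Lemma alphavU s : s \in reflections D -> alphav D s \in U.
Proof.
move=> sR; have: alphav D s \in limg (rho D s - \1%VF).
  by rewrite -(alphavP DP sR) memv_line.
by case/memv_imgP=> y _ ->; exact: imgU.
Qed.

Lemma alphaF s f : s \in reflections D -> f \in F -> alpha D s f = 0.
Proof.
move=> sR /fix_spaceP fF.
have [z ->] : exists z, alpha D s = dact D s z - z.
  by apply/(alphaP DP sR); exists 1; rewrite scale1r.
by rewrite add_lfunE opp_lfunE comp_lfunE fF subrr.
Qed.

Lemma proj_val (u : subvs_of U) : proj_ess (vsval u) = u.
Proof. by rewrite projU ?subvsP // vsvalK. Qed.

Lemma dact_proj w (x : 'Hom(subvs_of U, C^o)) :
  (dact D' w x \o proj_ess = dact D w (x \o proj_ess))%VF.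
Proof.
apply/lfunP => y; rewrite comp_lfunE [RHS]comp_lfunE [RHS]comp_lfunE proj_act.
exact: comp_lfunE.
Qed.

Let cher_central : central_scalars (pcst (cher_rel D)).
Proof. exact: pcstC. Qed.

Let ess_rel := @cher_lift_rel C (subvs_of U) W D' (cherednik D)
  (pcst (cher_rel D)) (Hw D) (fun x => Hx D (x \o proj_ess)%VF)
  (fun y => Hy D (vsval y)).

Let ess_respects : respects_rel (cher_rel D')
  (pcst (cher_rel D) : {rmorphism C -> cherednik D})
  (fun g => match g with
            | GW w => Hw D w
            | GX x => Hx D (x \o proj_ess)%VF
            | GY y => Hy D (vsval y)
            end).
Proof.
apply: ess_rel.
- exact: Hw1.
- exact: HwM.
- by move=> a x x'; rewrite comp_lfunDl -comp_lfunZl Hx_lin.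
- by move=> a y y'; rewrite linearP Hy_lin.
- by move=> w x; rewrite Hwx dact_proj.
- by move=> w y; rewrite Hwy ess_actE.
- by move=> *; rewrite Hxx.
- by move=> *; rewrite Hyy.
- move=> y x; rewrite Hyx comp_lfunE proj_val refl_ess; congr (_ - _).
  apply: eq_bigr => s sR; congr (pcst _ _ * _).
  rewrite [X in _ * X = _]comp_lfunE projU ?alphavU //; congr (_ * _ * _).
  by rewrite /= comp_lfunE lfunE.
Qed.

Definition ess_incl : {rmorphism cherednik D' -> cherednik D} :=
  plift cher_central ess_respects.

Definition fixed_killed (M : lmodType (cherednik D)) (v : M) : Prop :=
  forall y, y \in F -> Hy D y *: v = 0.

Section ZetaObject.
Variable M : lmodType (cherednik D).

Definition zeta_sub : submodule (restr ess_incl M).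
Proof.
exists (fun v : restr ess_incl M => fixed_killed (v : M)).
- by move=> y _; exact: scaler0.
- by move=> u v uK vK y yF; rewrite [LHS]scalerDr uK // vK // addr0.
- elim/palg_ind=> [a|[w|x|y']|p q IHp IHq|p q IHp IHq] u uK y yF;
    rewrite ?restrE.
  + by rewrite [ess_incl _]plift_cst scalerA -pcstC -scalerA uK ?scaler0.
  + rewrite [ess_incl _]plift_gen scalerA.
    have /fix_spaceP yw := yF.
    by rewrite -{1}(yw w) -Hwy -scalerA uK ?scaler0.
  + rewrite [ess_incl _]plift_gen scalerA.
    rewrite -[Hy D y * _](subrK (Hx D (x \o proj_ess)%VF * Hy D y)) Hyx.
    rewrite comp_lfunE projF // linear0 /Hc rmorph0 sub0r big1 ?oppr0 ?add0r.
      by rewrite -scalerA uK // scaler0.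
    by move=> s sR; rewrite (alphaF sR yF) mulr0 mul0r /Hc rmorph0 mul0r.
  + by rewrite [ess_incl _]plift_gen scalerA Hyy -scalerA uK ?scaler0.
  + by rewrite rmorphD [X in _ *: X]scalerDl scalerDr IHp // IHq // addr0.
  + rewrite rmorphM -scalerA; apply: (IHp (ess_incl q *: u : M)) => // z zF.
    exact: IHq.
Defined.

End ZetaObject.

Section ZetaMap.
Variables (M N : lmodType (cherednik D)) (f : {linear M -> N}).
Lemma zeta_mapP (v : submodT (zeta_sub M)) :
  sub_pred (zeta_sub N) (f (sub_val v)).
Proof.
case: v => v /= /asboolP vK; apply/asboolP => y yF /=.
by rewrite -linearZ vK //= linear0.
Qed.
Definition zeta_map (v : submodT (zeta_sub M)) : submodT (zeta_sub N) :=
  SubMod (zeta_mapP v).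
Let zeta_map_linear : linear zeta_map.
Proof. by move=> a u v; apply: val_inj; exact: (linearP f). Qed.
HB.instance Definition _ := GRing.isLinear.Build (cherednik D')
  (submodT (zeta_sub M)) (submodT (zeta_sub N)) _ zeta_map zeta_map_linear.
End ZetaMap.

Definition zeta : functor (Mod (cherednik D)) (Mod (cherednik D')).
Proof.
exists (fun M : lmodType (cherednik D) =>
          submodT (zeta_sub M) : lmodType (cherednik D'))
  (fun (M N : lmodType (cherednik D)) (f : {linear M -> N}) =>
     zeta_map f : {linear submodT (zeta_sub M) -> submodT (zeta_sub N)}).
- by move=> M; apply: linear_ext => v; exact: val_inj.
- by move=> M N P f g; apply: linear_ext => v; exact: val_inj.
Defined.

End Zeta.

Section Parabolic.
Variables (C : fieldType) (h : vectType C) (W : finGroupType).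
Variables (D : cherednik_data h W) (DP : is_cherednik_data D) (b : h).

Definition stab_data : cherednik_data h (subg_of (stab DP b)) :=
  sub_data D (stab DP b).

Definition stab_dataP : is_cherednik_data stab_data := sub_dataP (stab DP b) DP.

(* The two-sided inverse of r if there is one, and 0 otherwise.             *)
Definition ring_inv (R : pzRingType) (r : R) : R :=
  xget 0 [set r' | r * r' = 1 /\ r' * r = 1].

Variables (Hb : completed_cherednik D b) (H0 : completed_cherednik stab_data 0).

Definition stab_incl (w : subg_of (stab DP b)) : H0 := cc_H H0 (Hw stab_data w).

(* Z(W, W_b, H_c'(W_b, h)^_0) *)
Definition Zcent : pzRingType := centralizer stab_incl.

Local Notation sc a := (cc_H H0 (Hc stab_data a)).
Local Notation xb x := (cc_H H0 (Hx stab_data x)).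
Local Notation yb y := (cc_H H0 (Hy stab_data y)).

(* The formulas determine theta: they give its values on H_c, and it is     *)
(* automatically continuous on the completed invariants.                    *)
(* x + alpha(b) below is invertible since alpha_s(b) != 0 for s not in W_b. *)
Record theta_iso := ThetaIso {
  theta :> {rmorphism Hb -> Zcent};
  theta_inv : {rmorphism Zcent -> Hb};
  thetaK : cancel theta theta_inv;
  theta_invK : cancel theta_inv theta;
  theta_c : forall (a : C) (f : funH stab_incl) (w : W),
    (theta (cc_H Hb (Hc D a)) : centralizer _) f w = sc a * f w;
  theta_w : forall (u : W) (f : funH stab_incl) (w : W),
    (theta (cc_H Hb (Hw D u)) : centralizer _) f w = f (w * u)%g;
  theta_x : forall (x : 'Hom(h, C^o)) (f : funH stab_incl) (w : W),
    (theta (cc_H Hb (Hx D x)) : centralizer _) f w =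
      (xb (dact D w x) + sc (dact D w x b)) * f w;
  theta_y : forall (a : h) (f : funH stab_incl) (w : W),
    (theta (cc_H Hb (Hy D a)) : centralizer _) f w =
      yb (rho D w a) * f w
      + \sum_(s in reflections D | s \notin stab DP b)
          sc (2 * cpar D s / (1 - lam D s) * alpha D s (rho D w a))
          * ring_inv (xb (alpha D s) + sc (alpha D s b))
          * (f (s * w)%g - f w)
}.

Variables (U : {vspace h}) (UP : is_stable_complement stab_data U).
Variable th : theta_iso.
Variable Iinv : functor (Mod Zcent) (Mod H0).

(* Res_b = zeta o E o I^-1 o theta_* o (completion at b) *)
Definition Res :
    functor (Mod (cherednik D)) (Mod (cherednik (ess_data stab_data U))) :=
  zeta stab_dataP UP \oF E_functor H0 stab_dataP \oF Iinv
    \oF restr_functor (theta_inv th) \oF completion_functor Hb.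

(* zeta restricts to an equivalence between categories O, with              *)
(* quasi-inverse zinv.                                                      *)
Definition is_zeta_inverse
    (zinv : functor (category_O (ess_data stab_data U))
                    (category_O stab_data)) : Prop :=
  exists zeta_O : forall M : category_O stab_data,
      is_O ((zeta stab_dataP UP \oF full_incl _) M),
    quasi_inverse (corestrict zeta_O) zinv.

Variable zinv :
  functor (category_O (ess_data stab_data U)) (category_O stab_data).

(* Ind_b = E^b o theta_*^-1 o I o (completion at 0) o zeta^-1 *)
Definition Ind :
    functor (category_O (ess_data stab_data U)) (Mod (cherednik D)) :=
  E_functor Hb DP \oF restr_functor th \oF induce stab_incl
    \oF completion_functor H0 \oF full_incl _ \oF zinv.

End Parabolic.

(* Main.v *)
(** Let H = H_c(W,h), H' = H_c'(W_b,h), and for M in O_c(W,h)_0 let K(M) be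
    the completed H'-module I^-1 theta_* of the completion of M at b, so that
    Res_b M = zeta (E (K M)). For N in O_c'(W_b,h)_0 there are natural
    bijections
      Hom(E (K M), N) = Hom(K M, N^)
                      = Hom(M^_b, theta_*^-1 (I N^))
                      = Hom(M, theta_*^-1 (I N^))
                      = Hom(M, E^b (theta_*^-1 (I N^))),
    N^ being the completion of N at 0: the second one is Morita theory, the
    third one is extension of scalars, and the last one holds because every
    vector of M is h-nilpotent.

    The first one is the analytic step. On a module K which is separated and
    complete for the filtration F_n = (h^* )^n K, with K/F_1 finite dimensional,
    the Euler element eu has finitely many eigenvalues on K/F_1 and shifts by
    one along the filtration. Hence the eu-finite vectors, which are the
    h-nilpotent ones, are dense and lie in O, a map E K -> N is continuous, and
    E (N^) = N. That K(M) has these properties follows from the compactness of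
    affine systems modulo subspaces of finite codimension, and from the
    finiteness of C[h] over C[h]^W, which makes the filtrations by powers of
    the maximal ideals of C[h]^W and of C[h] cofinal.

    Finite generation over C[h] is obtained from the same device: a nilpotent
    module V with subspaces G_n of finite codimension, such that y G_(n+1) lies
    in G_n for y in h and no singular vector lies in G_n for n large, is
    generated by finitely many of its vectors. *)
From HB Require Import structures.
From mathcomp Require Import all_boot all_order all_algebra all_fingroup.
From mathcomp Require Import boolp classical_sets functions.
From mathcomp Require Import reals complex.
Require Import Defs.

Set Implicit Arguments.
Unset Strict Implicit.
Unset Printing Implicit Defensive.

Import GRing.Theory Num.Theory.
Local Open Scope ring_scope.

(** * Subspaces of finite codimension *)

(* A C-algebra is a ring B with a ring morphism k : C -> B. *)
Section Subspaces.
Variables (C : fieldType) (B : pzRingType) (k : {rmorphism C -> B}).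

(** Eigenvalue arguments for eu are carried out with polynomials only. If p(eu) and q(eu) both send
    v into an eu-stable subspace and p, q are coprime, a Bezout identity puts v itself there.
    Multiplying by a linear form changes q(t) into q(t - 1), and applying a y does the opposite; in
    characteristic zero p(t) and q(t - j) are coprime for all large j, since only finitely many
    differences of their roots are natural numbers. Every threshold in the analytic step comes from
    this. Two polynomials start the process: [chi], which kills singular vectors because eu acts on
    them through the finite-dimensional group algebra, and a characteristic polynomial of eu on
    K/F_1.

    Two obstacles shape the rest. The completion of M is known only through generators and a
    universal property, and its separatedness is proved with the help of the noetherian property of
    the invariants. And I^-1 is an arbitrary quasi-inverse, so K(M) is reached only as the component
    at 1 of the completion at b, where C[h] acts through the translation by b. *)

Record subspace (M : lmodType B) := Subspace {
  in_space :> M -> Prop;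
  space0 : in_space 0;
  spaceD : forall u v, in_space u -> in_space v -> in_space (u + v);
  spaceZ : forall a u, in_space u -> in_space (k a *: u)
}.

Variables (M : lmodType B) (S : subspace M).

Lemma spaceN v : S v -> S (- v).
Proof. by rewrite -scaleN1r -(rmorphN1 k); exact: spaceZ. Qed.

Lemma spaceB u v : S u -> S v -> S (u - v).
Proof. by move=> uS /spaceN; exact: spaceD. Qed.

Lemma space_sum (I : Type) (r : seq I) (P : pred I) (F : I -> M) :
  (forall i, P i -> S (F i)) -> S (\sum_(i <- r | P i) F i).
Proof. by move=> FS; elim/big_ind: _ => //; [exact: space0|exact: spaceD]. Qed.

Lemma space_trans u v : S (u - v) -> S v -> S u.
Proof. by move=> uv vS; rewrite -(subrK v u); exact: spaceD. Qed.

Lemma mod_refl u : S (u - u).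
Proof. by rewrite subrr; exact: space0. Qed.

Lemma mod_sym u v : S (u - v) -> S (v - u).
Proof. by move/spaceN; rewrite opprB. Qed.

Lemma mod_trans v u w : S (u - v) -> S (v - w) -> S (u - w).
Proof. by move=> uv vw; rewrite -(subrK v u) -addrA; exact: spaceD. Qed.

Lemma mod_add u v u' v' : S (u - v) -> S (u' - v') -> S (u + u' - (v + v')).
Proof. by move=> uv uv'; rewrite opprD addrACA; exact: spaceD. Qed.

Lemma mod_sub u v u' v' : S (u - v) -> S (u' - v') -> S (u - u' - (v - v')).
Proof.
by move=> uv uv'; apply: mod_add => //; rewrite -opprD; exact: spaceN.
Qed.

Definition sub_space (N : submodule M) : subspace M :=
  Subspace (in_sub0 N) (@in_subD _ _ N) (fun a => @in_subZ _ _ N (k a)).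

End Subspaces.

(** The matrix is taken of maximal rank among those whose row space lies in P: a vector of P outside
    it would raise the rank. *)
Lemma subspace_mx (C : fieldType) n (P : submodule ('rV[C]_n)) :
  exists X : 'M[C]_n, forall v, P v <-> (v <= X)%MS.
Proof.
pose Q r := `[< exists X : 'M[C]_n, \rank X = r /\ forall v, (v <= X)%MS -> P v >].
have exQ : exists r, Q r.
  exists 0%N; apply/asboolP; exists 0; split; first exact: mxrank0.
  by move=> v; rewrite submx0 => /eqP ->; exact: in_sub0.
have bQ r : Q r -> (r <= n)%N by move=> /asboolP[X [<- _]]; exact: rank_leq_row.
case: (ex_maxnP exQ bQ) => r /asboolP[X [rX XP]] rmax.
exists X => v; split=> [Pv|]; last exact: XP.
have /rmax : Q (\rank (X + v)%MS).
  apply/asboolP; exists (X + v)%MS; split=> // u /sub_addsmxP[[a c] ->].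
  by apply: in_subD; [apply: XP; exact: submxMl|rewrite /= [c]mx11_scalar mul_scalar_mx;
    exact: in_subZ].
rewrite -rX => le_r.
have := mxrank_leqif_eq (addsmxSl X v).
rewrite /leqif => -[leX]; rewrite eqn_leq leX le_r /= => /esym/eqmxP eqX.
by rewrite eqX addsmxSr.
Qed.

Section Cofinite.
Variables (C : fieldType) (B : pzRingType) (k : {rmorphism C -> B}).
Variable V : lmodType B.

Definition lcomb n (l : 'I_n -> V) (c : 'rV[C]_n) : V := \sum_i k (c 0 i) *: l i.

Lemma lcombP n (l : 'I_n -> V) a c d :
  lcomb l (a *: c + d) = k a *: lcomb l c + lcomb l d.
Proof.
rewrite /lcomb scaler_sumr -big_split /=; apply: eq_bigr => i _.
by rewrite !mxE rmorphD rmorphM scalerDl scalerA.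
Qed.

Lemma lcomb0 n (l : 'I_n -> V) : lcomb l 0 = 0.
Proof. by rewrite /lcomb big1 // => i _; rewrite mxE rmorph0 scale0r. Qed.

Lemma lcombB n (l : 'I_n -> V) c d : lcomb l (c - d) = lcomb l c - lcomb l d.
Proof. by rewrite [c - d]addrC -(scaleN1r d) lcombP rmorphN1 scaleN1r addrC. Qed.

Definition spans n (l : 'I_n -> V) (G : V -> Prop) : Prop :=
  forall v, exists c, G (v - lcomb l c).

Definition cofinite (G : V -> Prop) : Prop :=
  exists n (l : 'I_n -> V), spans l G.

Lemma cofinite_fin (I : finType) (l : I -> V) (G : V -> Prop) :
  (forall v, exists c : I -> C, G (v - \sum_i k (c i) *: l i)) -> cofinite G.
Proof.
move=> lG; exists #|I|, (fun j => l (enum_val j)) => v; have [c cG] := lG v.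
exists (\row_j c (enum_val j)); rewrite /lcomb.
under eq_bigr => j _ do rewrite mxE.
by rewrite -(big_enum_val (A := I) (fun i => k (c i) *: l i)).
Qed.

Variable G : subspace k V.

(** The image of T in V/G, read through the spanning family l. As l may be dependent modulo G, every
    coordinate row of a vector is included; T = G gives the relations between the l. *)
Definition coordinates (T : subspace k V) n (l : 'I_n -> V) :
  submodule ('rV[C]_n).
Proof.
exists (fun c => exists2 v, T v & G (v - lcomb l c)).
- by exists 0; [exact: space0|rewrite lcomb0 subr0; exact: space0].
- move=> c d [u uT uG] [v vT vG]; exists (u + v); first exact: spaceD.
  by rewrite -[c]scale1r lcombP rmorph1 !scale1r opprD addrACA; exact: spaceD.
- move=> a c [v vT vG]; exists (k a *: v); first exact: spaceZ.
  rewrite -[_ *: c]addr0 lcombP lcomb0 addr0 -scalerBr; exact: spaceZ.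
Defined.

(** The spanning vectors are lifts to P of the rows of a matrix that describes the image of P in
    V/G. *)
Lemma relative_span (P : subspace k V) : cofinite G ->
  exists n (g : 'I_n -> V), (forall i, P (g i)) /\
    forall v, P v -> exists c, G (v - lcomb g c).
Proof.
move=> [n [l lG]]; have [X XP] := subspace_mx (coordinates P l).
have gP i : exists v, P v /\ G (v - lcomb l (row i X)).
  by have /XP[v] := row_sub i X; exists v.
have [g gPG] := choice gP; exists n, g; split=> [i|v vP]; first by have [] := gPG i.
have [c cG] := lG v; have /XP/submxP[d cE] : coordinates P l c by exists v.
exists d; rewrite -(subrK (lcomb l c) v) -addrA; apply: (spaceD cG).
rewrite cE mulmx_sum_row -opprB; apply: spaceN.
have -> : lcomb l (\sum_i d 0 i *: row i X) = \sum_i k (d 0 i) *: lcomb l (row i X).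
  elim/big_rec2: _ => [|i u v' _ <-]; first exact: lcomb0.
  exact: lcombP.
rewrite /lcomb -sumrB; apply: space_sum => i _; rewrite -scalerBr.
by apply: spaceZ; have [] := gPG i.
Qed.

Lemma fin_span (P : subspace k V) : cofinite G -> (forall v, P v -> G v -> v = 0) ->
  exists n (g : 'I_n -> V), (forall i, P (g i)) /\
    forall v, P v -> exists c, v = lcomb g c.
Proof.
move=> /(relative_span P)[n [g [gP gG]]] PG; exists n, g; split=> // v vP.
have [c vc] := gG v vP; exists c; apply/eqP; rewrite -subr_eq0; apply/eqP/PG => //.
apply: (spaceB vP); rewrite /lcomb; apply: space_sum => i _.
exact: spaceZ.
Qed.

(** The row c v is only a choice, unique up to the relations between the l. The cokernel matrix of
    the relation space removes this ambiguity, which makes phi additive. *)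
Lemma exact_coords : cofinite G -> exists n (phi : V -> 'rV[C]_n),
  (forall u v, phi (u - v) = phi u - phi v) /\ forall v, phi v = 0 <-> G v.
Proof.
move=> [n [l lG]]; have [c cP] := choice lG.
have [X XP] := subspace_mx (coordinates G l).
have XG d : (d <= X)%MS <-> G (lcomb l d).
  split=> [/XP[v vG vd]|dG]; last by apply/XP; exists (lcomb l d); rewrite ?subrr //; exact: space0.
  by rewrite -[lcomb l d](subKr v); exact: spaceB.
exists n, (fun v => c v *m cokermx X); split=> [u v|v].
  rewrite -mulmxBl; apply/eqP; rewrite -subr_eq0 -mulmxBl -/(_ <= _)%MS.
  rewrite -submxE; apply/XG; rewrite !lcombB.
  apply: (mod_trans (mod_sym (cP (u - v)))).
  by apply: mod_sub; exact: cP.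
split=> [/eqP|vG].
  by rewrite -submxE => /XG; exact: space_trans.
apply/eqP; rewrite -submxE; apply/XG.
by rewrite -[lcomb _ _](subKr v); apply: spaceB.
Qed.

(** A Mittag-Leffler property: the images of the T l in the finite-dimensional V/G decrease, hence
    are constant from the first l0 where their rank is minimal. *)
Lemma chain_stab (T : nat -> subspace k V) : cofinite G ->
  (forall l v, T l.+1 v -> T l v) ->
  exists l0, forall l, (l0 <= l)%N -> forall v, T l0 v -> exists2 u, T l u & G (v - u).
Proof.
move=> [n [g gG]] Tdec.
have TdecW l l' : (l <= l')%N -> forall v, T l' v -> T l v.
  by move/subnK <-; elim: (l' - l)%N => // j IHj v /Tdec/IHj.
have [X XP] := choice (fun l => subspace_mx (coordinates (T l) g)).
have Xdec l l' : (l <= l')%N -> (X l' <= X l)%MS.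
  move=> ll'; apply/rV_subP => c /(XP l')[v vT vG]; apply/(XP l).
  by exists v => //; exact: TdecW vT.
pose Q r := `[< exists l, \rank (X l) = r >].
have exQ : exists r, Q r by exists (\rank (X 0)); apply/asboolP; exists 0%N.
case: (ex_minnP exQ) => r /asboolP[l0 l0r] rmin; exists l0 => l ll v vT.
have [c cG] := gG v; have : (c <= X l0)%MS by apply/XP; exists v.
have := mxrank_leqif_eq (Xdec _ _ ll); rewrite /leqif => -[leX].
rewrite eqn_leq leX l0r rmin /=; last by apply/asboolP; exists l.
move=> /esym/eqmxP <- /XP[u uT uG]; exists u => //.
by rewrite -(subrK (lcomb g c) v) -addrA; apply: spaceD => //; rewrite -opprB; exact: spaceN.
Qed.

End Cofinite.

(** * Polynomials acting on a module *)

(** q1 collects the factors of q that share roots with p, by repeated division by the gcd. The last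
    clause says without roots that each root of q1 is a root of p. *)
Lemma split_coprime (C : fieldType) (p q : {poly C}) : p != 0 -> q != 0 ->
  exists q1 q2, [/\ q = q1 * q2, coprimep p q2
    & forall r, coprimep p r -> coprimep q1 r].
Proof.
move=> p0; have [n] := ubnP (size q); elim: n q => // n IHn q /ltnSE sq q0.
have [pq|pq] := boolP (coprimep p q).
  by exists 1, q; split; rewrite ?mul1r // => r _; exact: coprime1p.
have := dvdp_gcdr p q; rewrite dvdp_eq; set d := gcdp p q; set q' := q %/ d.
move=> /eqP qE; have d0 : d != 0 by rewrite gcdp_eq0 negb_and p0.
have q'0 : q' != 0 by apply: contraNneq q0 => q'0; rewrite qE q'0 mul0r.
have sd : (1 < size d)%N.
  by rewrite ltn_neqAle eq_sym size_poly_gt0 d0 andbT.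
have : (size q' < n)%N.
  apply: leq_trans sq; rewrite qE size_mul // -subn1 -addnBA; last exact: ltnW.
  by rewrite -[X in (X < _)%N]addn0 ltn_add2l subn_gt0.
move/IHn => /(_ q'0)[q1 [q2 [q'E cp2 cp1]]]; exists (d * q1), q2.
split=> // [|r pr]; first by rewrite {1}qE q'E mulrC mulrA.
rewrite coprimepMl cp1 // andbT; apply: coprimep_dvdr pr; exact: dvdp_gcdl.
Qed.

Section Shift.
Variable C : numClosedFieldType.

(** The roots move by + j, like the eigenvalues of eu under multiplication by j linear forms. *)
Definition pshift (j : nat) (p : {poly C}) : {poly C} := p \Po ('X - j%:R%:P).

Lemma pshift0 p : pshift 0 p = p.
Proof. by rewrite /pshift subr0 comp_polyXr. Qed.

Lemma pshift_root j p z : root (pshift j p) z = root p (z - j%:R).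
Proof. by rewrite /root horner_comp !hornerE. Qed.

Lemma pshift_eq0 j p : (pshift j p == 0) = (p == 0).
Proof.
apply/eqP/eqP => [|->]; last by rewrite /pshift comp_poly0.
by apply: contra_eq => p0; rewrite comp_poly_eq0 // size_XsubC.
Qed.

Lemma coprimep_roots (p q : {poly C}) : p != 0 ->
  (forall z, root p z -> ~~ root q z) -> coprimep p q.
Proof.
move=> p0 pq; rewrite coprimep_def.
apply/negPn/negP => /closed_rootP[z].
by rewrite root_gcd => /andP[/pq/negP].
Qed.

Lemma natr_bounded (s : seq C) : exists n, forall j, j%:R \in s -> (j < n)%N.
Proof.
elim: s => [|d s [n IHn]]; first by exists 0%N.
have [[i di]|nd] := pselect (exists i : nat, d = i%:R).
  exists (maxn i.+1 n) => j; rewrite inE di eqr_nat => /orP[/eqP ->|/IHn jn].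
    by rewrite leq_max leqnn.
  by rewrite leq_max jn orbT.
exists n => j; rewrite inE => /orP[/eqP jd|/IHn //].
by case: nd; exists j.
Qed.

(** A common root z of p(t) and q(t - j) makes j the difference of a root of p and a root of q. *)
Lemma coprime_shift (p q : {poly C}) : p != 0 -> q != 0 ->
  exists n, forall j, (n <= j)%N -> coprimep p (pshift j q).
Proof.
move=> p0 q0; have [rp pE] := closed_field_poly_normal p.
have [rq qE] := closed_field_poly_normal q.
have rootE (p' : {poly C}) r z : p' != 0 ->
    p' = lead_coef p' *: \prod_(z <- r) ('X - z%:P) -> root p' z = (z \in r).
  by move=> p'0 ->; rewrite rootZ ?lead_coef_eq0 // root_prod_XsubC.
have [n nP] := natr_bounded [seq z - z' | z <- rp, z' <- rq].
exists n => j nj; apply: coprimep_roots => // z.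
rewrite pshift_root (rootE _ _ _ p0 pE) (rootE _ _ _ q0 qE) => zp.
apply/negP => zq; have /nP : j%:R \in [seq z - z' | z <- rp, z' <- rq].
  by apply/allpairsP; exists (z, z - j%:R); split=> //=; rewrite subKr.
by rewrite ltnNge nj.
Qed.

End Shift.

(** * Evaluation of polynomials in a noncommutative algebra *)

Section Evaluation.
Variables (C : fieldType) (B : pzRingType) (k : {rmorphism C -> B}).
Hypothesis kC : central_scalars k.
Implicit Types (u z : B) (p q : {poly C}).

Definition peval (u : B) (p : {poly C}) : B := \sum_(i < size p) k p`_i * u ^+ i.

Lemma pevalE n u p : (size p <= n)%N -> peval u p = \sum_(i < n) k p`_i * u ^+ i.
Proof.
move=> pn; rewrite /peval (big_ord_widen n (fun i => k p`_i * u ^+ i)) //.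
rewrite big_mkcond; apply: eq_bigr => i _; case: ltnP => // pi.
by rewrite nth_default // rmorph0 mul0r.
Qed.

Lemma peval0 u : peval u 0 = 0.
Proof. by rewrite /peval size_poly0 big_ord0. Qed.

Lemma pevalD u p q : peval u (p + q) = peval u p + peval u q.
Proof.
set n := maxn (size p) (size q).
rewrite !(@pevalE n) ?size_polyD ?leq_maxl ?leq_maxr // -big_split.
by apply: eq_bigr => i _; rewrite coefD rmorphD mulrDl.
Qed.

Lemma pevalC u c : peval u c%:P = k c.
Proof.
by rewrite (@pevalE 1) ?size_polyC ?leq_b1 // big_ord1 coefC mulr1.
Qed.

Lemma pevalMX u p : peval u (p * 'X) = peval u p * u.
Proof.
rewrite (@pevalE (size p).+1); last by rewrite (leq_trans (size_polyMleq _ _)) // size_polyX addn2.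
rewrite big_ord_recl coefMX rmorph0 mul0r add0r /peval mulr_suml.
by apply: eq_bigr => i _; rewrite coefMX /= exprSr mulrA.
Qed.

Lemma peval_comm u p : u * peval u p = peval u p * u.
Proof.
rewrite /peval mulr_sumr mulr_suml; apply: eq_bigr => i _.
by rewrite mulrA -kC -!mulrA -exprS -exprSr.
Qed.

Lemma pevalZ u c p : peval u (c *: p) = k c * peval u p.
Proof.
rewrite (@pevalE (size p)) ?size_scale_leq // /peval mulr_sumr.
by apply: eq_bigr => i _; rewrite coefZ rmorphM mulrA.
Qed.

Lemma pevalM u p q : peval u (p * q) = peval u p * peval u q.
Proof.
elim/poly_ind: p => [|p c IHp]; first by rewrite mul0r peval0 mul0r.
rewrite mulrDl mulrAC !pevalD !pevalMX pevalC mulrDl IHp -!mulrA peval_comm.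
by rewrite mul_polyC pevalZ.
Qed.

Lemma peval1 u : peval u 1 = 1.
Proof. by rewrite -polyC1 pevalC rmorph1. Qed.

Lemma pevalXsubC u c : peval u ('X - c%:P) = u - k c.
Proof.
by rewrite -polyCN pevalD pevalC rmorphN -['X]mul1r pevalMX peval1 mul1r.
Qed.

Lemma peval_intertwine u u' z p : u * z = z * u' -> peval u p * z = z * peval u' p.
Proof.
move=> uz; elim/poly_ind: p => [|p c IHp]; first by rewrite !peval0 mul0r mulr0.
by rewrite !pevalD !pevalMX !pevalC mulrDl mulrDr -mulrA uz !mulrA IHp kC.
Qed.

Lemma peval_comp u p q : peval u (p \Po q) = peval (peval u q) p.
Proof.
elim/poly_ind: p => [|p c IHp]; first by rewrite comp_poly0 !peval0.
by rewrite comp_poly_MXaddC [LHS]pevalD [LHS]/= pevalM IHp !pevalD pevalMX !pevalC.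
Qed.

End Evaluation.

Section Annihilator.
Variables (C : fieldType) (B : pzRingType) (k : {rmorphism C -> B}).
Hypothesis kC : central_scalars k.
Variables (M : lmodType B) (u : B) (G : subspace k M).
Hypothesis uG : forall v : M, G v -> G (u *: v).

Lemma peval_sub p (v : M) : G v -> G (peval k u p *: v).
Proof.
move=> vG; elim/poly_ind: p => [|p c IHp].
  by rewrite peval0 scale0r; exact: space0.
rewrite pevalD pevalMX pevalC -peval_comm // scalerDl -scalerA.
by apply: spaceD; [exact: uG|exact: spaceZ].
Qed.

(* Cayley-Hamilton for u acting on the span of l modulo G. *)
Lemma char_poly_kills n (l : 'I_n -> M) (a : 'M[C]_n) :
  (forall i, G (u *: l i - \sum_j k (a i j) *: l j)) ->
  forall i, G (peval k u (char_poly a) *: l i).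
Proof.
case: n l a => [|n] l a la; first by case.
have kills p i : G (peval k u p *: l i - \sum_j k (horner_mx a p i j) *: l j).
  elim/poly_ind: p i => [|p c IHp] i.
    rewrite peval0 scale0r rmorph0 big1 ?subr0; first exact: space0.
    by move=> j _; rewrite mxE rmorph0 scale0r.
  rewrite rmorphD rmorphM /= horner_mx_X horner_mx_C.
  rewrite pevalD pevalMX pevalC scalerDl.
  have -> : \sum_j k ((horner_mx a p * a + c%:M) i j) *: l j =
      (\sum_j \sum_m k (horner_mx a p i m * a m j) *: l j) + k c *: l i.
    under eq_bigr => j _ do rewrite mxE [(_ * a) i j]mxE rmorphD scalerDl rmorph_sum scaler_suml.
    rewrite big_split /=; congr (_ + _).
    rewrite (bigD1 i) //= mxE eqxx mulr1n big1 ?addr0 // => j ji.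
    by rewrite mxE eq_sym (negPf ji) mulr0n rmorph0 scale0r.
  apply: mod_add; last exact: mod_refl.
  rewrite -peval_comm // -scalerA.
   apply: (mod_trans (v := u *: (\sum_j k (horner_mx a p i j) *: l j))).
    by rewrite -scalerBr; apply: uG; exact: IHp.
  rewrite exchange_big scaler_sumr -sumrB; apply: space_sum => m _.
  rewrite scalerA -kC -scalerA.
  have -> : \sum_j k (horner_mx a p i m * a m j) *: l j =
      k (horner_mx a p i m) *: (\sum_j k (a m j) *: l j).
    by rewrite scaler_sumr; apply: eq_bigr => j _; rewrite rmorphM scalerA.
  by rewrite -scalerBr; exact: spaceZ.
move=> i; have := kills (char_poly a) i.
rewrite Cayley_Hamilton big1 ?subr0 // => j _.
by rewrite mxE rmorph0 scale0r.
Qed.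

End Annihilator.

(** * Adic filtrations and the Euler element *)

Section Adic.
Variables (B : pzRingType) (M : lmodType B) (J : B -> Prop).

(** This is J^n M, with J any subset of B: the linear forms can serve as J although they generate no
    useful ideal of the noncommutative algebra. *)
Inductive adic : nat -> M -> Prop :=
  | adic_all v : adic 0 v
  | adic0 n : adic n 0
  | adicD n u v : adic n u -> adic n v -> adic n (u + v)
  | adicM n a v : J a -> adic n v -> adic n.+1 (a *: v).

Lemma adic_sum n (I : Type) (r : seq I) (P : pred I) (F : I -> M) :
  (forall i, P i -> adic n (F i)) -> adic n (\sum_(i <- r | P i) F i).
Proof. by move=> FS; elim/big_ind: _ => //; [exact: adic0|exact: adicD]. Qed.

Lemma adicS n v : adic n.+1 v -> adic n v.
Proof.
elim: n v => [|n IHn] v; first by move=> _; exact: adic_all.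
move En : n.+2 => n2 vJ; elim: vJ En => {n2 v} [v //|m _|m u v _ IHu _ IHv mn|].
- exact: adic0.
- by apply: adicD; [exact: IHu|exact: IHv].
- by move=> m a v Ja vm _ [mn]; apply: adicM => //; apply: IHn; rewrite mn.
Qed.

Lemma adicW m n v : (m <= n)%N -> adic n v -> adic m v.
Proof. by move/subnK <-; elim: (n - m)%N => // j IHj /adicS. Qed.

End Adic.

(** T need only be semilinear, with a' depending on a and v. This covers the action of W, where a'
    is the transform of a, and changes of rings. *)
Lemma adic_map (B B' : pzRingType) (M : lmodType B) (N : lmodType B')
    (J : B -> Prop) (J' : B' -> Prop) (T : M -> N) :
  {morph T : u v / u + v} ->
  (forall a v, J a -> exists2 a', J' a' & T (a *: v) = a' *: T v) ->
  forall n v, adic J n v -> adic J' n (T v).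
Proof.
move=> TD TJ n v; elim=> {n v} [v|n|n u v _ uJ _ vJ|n a v Ja _ vJ].
- exact: adic_all.
- by rewrite (_ : T 0 = 0); [exact: adic0|apply: (addIr (T 0)); rewrite -TD !add0r].
- by rewrite TD; exact: adicD.
- by have [a' Ja' ->] := TJ a v Ja; exact: adicM.
Qed.

(** T behaves like a derivation: moving it past a product of factors in J leaves terms in which one
    factor is lost. *)
Lemma adic_der (B : pzRingType) (M : lmodType B) (J : B -> Prop) (T : M -> M) :
  {morph T : u v / u + v} ->
  (forall n a v, J a -> adic J n v -> adic J n (T (a *: v) - a *: T v)) ->
  forall n v, adic J n.+1 v -> adic J n (T v).
Proof.
move=> TD TJ n v; move En : n.+1 => n1 vJ.
have T0 : T 0 = 0 by apply: (addIr (T 0)); rewrite -TD !add0r.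
elim: vJ n En => {n1 v} [v n //|n1 n _|n1 u v _ IHu _ IHv n En|n1 a v Ja vJ IHv n [nn]].
- by rewrite T0; exact: adic0.
- by rewrite TD; apply: adicD; [exact: IHu|exact: IHv].
- rewrite -(subrK (a *: T v) (T _)); rewrite -nn in vJ IHv.
  apply: adicD; first exact: TJ.
  by case: n {vJ nn} IHv => [|n] IHv; [exact: adic_all|apply: adicM => //; exact: IHv].
Qed.

Section AdicSpace.
Variables (C : fieldType) (B : pzRingType) (k : {rmorphism C -> B}).
Hypothesis kC : central_scalars k.
Variables (M : lmodType B) (J : B -> Prop).

Lemma adicZ b n (v : M) :
  (forall a, J a -> b * a = a * b) -> adic J n v -> adic J n (b *: v).
Proof.
move=> bJ; apply: (adic_map (T := fun v => b *: v)); first by move=> u w; exact: scalerDr.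
by move=> a u Ja; exists a => //; rewrite !scalerA bJ.
Qed.

Definition adic_space (n : nat) : subspace k M.
Proof.
exists (@adic B M J n); [exact: adic0|by move=> u v; exact: adicD|].
by move=> a u; apply: adicZ => b _; exact: kC.
Defined.

Variables (r : nat) (g : 'I_r -> B).
Hypothesis Jg : forall i, J (g i).
Hypothesis gJ : forall a, J a -> exists2 b, a = \sum_i g i * b i &
  forall i n (v : M), adic J n v -> adic J n (b i *: v).

Lemma adic_gen n (v : M) : adic J n.+1 v ->
  exists2 u : 'I_r -> M, v = \sum_i g i *: u i & forall i, adic J n (u i).
Proof.
move En : n.+1 => n1 vJ; elim: vJ n En => {n1 v}
  [v n //|n1 n _|n1 u v _ IHu _ IHv n En|n1 a v Ja vJ _ n [nn]].
- exists (fun=> 0) => [|i]; last exact: adic0.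
  by rewrite big1 // => i _; rewrite scaler0.
- have [[u' -> uJ] [v' -> vJ]] := (IHu n En, IHv n En).
  exists (fun i => u' i + v' i) => [|i]; last exact: adicD.
  by rewrite -big_split; apply: eq_bigr => i _; rewrite scalerDr.
- have [b -> bJ] := gJ Ja; exists (fun i => b i *: v) => [|i].
    by rewrite scaler_suml; apply: eq_bigr => i _; rewrite scalerA.
  by apply: bJ; rewrite nn.
Qed.

(** M is spanned by l1 modulo J M; an element of J M is a sum of g_i u_i, and the u_i are known
    modulo J^n M by induction. *)
Lemma adic_cofinite : cofinite k (@adic B M J 1) -> forall n, cofinite k (@adic B M J n).
Proof.
move=> [n1 [l1 l1P]]; elim=> [|n [nl [l lP]]].
  by exists 0%N, (fun=> 0) => v; exists 0; exact: adic_all.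
pose l' (i : 'I_n1 + 'I_r * 'I_nl) : M :=
  match i with inl i => l1 i | inr j => g j.1 *: l j.2 end.
apply: (@cofinite_fin _ _ k M _ l') => v.
have [c1 c1P] := l1P v; have [u uE _] := adic_gen c1P.
have [c cP] := choice (fun i => lP (u i)).
exists (fun i => match i with inl i => c1 0 i | inr j => c j.1 0 j.2 end).
rewrite big_sumType /= opprD addrA -/(lcomb k l1 c1) uE.
rewrite -(pair_bigA _ (fun i j => k (c i 0 j) *: (g i *: l j))) -sumrB.
apply: (adic_sum (n := n.+1)) => i _.
under eq_bigr => j _ do rewrite scalerA kC -scalerA.
by rewrite -scaler_sumr -scalerBr; apply: adicM; [exact: Jg|exact: cP].
Qed.

End AdicSpace.

Lemma commB (R : pzRingType) (a b x : R) :
  (a - b) * x - x * (a - b) = (a * x - x * a) - (b * x - x * b).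
Proof. by rewrite mulrBl mulrBr opprD addrACA -opprD. Qed.

(** * The Euler element of a Cherednik algebra *)

Section Euler.
Variables (C : numClosedFieldType) (h : vectType C) (W : finGroupType).
Variables (D : cherednik_data h W) (DP : is_cherednik_data D).

Local Notation H := (cherednik D).
Local Notation k := (pcst (cher_rel D) : {rmorphism C -> H}).
Local Notation dim := (\dim (fullv : {vspace h})).

Lemma HcC : central_scalars k. Proof. exact: pcstC. Qed.

Lemma Hx0 : Hx D 0 = 0.
Proof.
have := Hx_lin D 1 0 0; rewrite scaler0 addr0 /Hc rmorph1 mul1r => /eqP.
by rewrite eq_sym -subr_eq0 addrK => /eqP.
Qed.
Lemma HxD x x' : Hx D (x + x') = Hx D x + Hx D x'.
Proof. by rewrite -{1}[x]scale1r Hx_lin /Hc rmorph1 mul1r. Qed.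
Lemma HxZ a x : Hx D (a *: x) = Hc D a * Hx D x.
Proof. by rewrite -[a *: x]addr0 Hx_lin Hx0 addr0. Qed.
Lemma HxN x : Hx D (- x) = - Hx D x.
Proof. by rewrite -scaleN1r HxZ /Hc rmorphN1 mulN1r. Qed.
Lemma Hx_sum (I : Type) (r : seq I) (P : pred I) (F : I -> 'Hom(h, C^o)) :
  Hx D (\sum_(i <- r | P i) F i) = \sum_(i <- r | P i) Hx D (F i).
Proof. exact: (big_morph _ HxD Hx0). Qed.

Lemma Hy0 : Hy D 0 = 0.
Proof.
have := Hy_lin D 1 0 0; rewrite scaler0 addr0 /Hc rmorph1 mul1r => /eqP.
by rewrite eq_sym -subr_eq0 addrK => /eqP.
Qed.
Lemma HyD y y' : Hy D (y + y') = Hy D y + Hy D y'.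
Proof. by rewrite -{1}[y]scale1r Hy_lin /Hc rmorph1 mul1r. Qed.
Lemma HyZ a y : Hy D (a *: y) = Hc D a * Hy D y.
Proof. by rewrite -[a *: y]addr0 Hy_lin Hy0 addr0. Qed.
Lemma Hy_sum (I : Type) (r : seq I) (P : pred I) (F : I -> h) :
  Hy D (\sum_(i <- r | P i) F i) = \sum_(i <- r | P i) Hy D (F i).
Proof. exact: (big_morph _ HyD Hy0). Qed.

Definition bas (i : 'I_dim) : h := (vbasis (fullv : {vspace h}))`_i.
Definition cobas (i : 'I_dim) : 'Hom(h, C^o) :=
  linfun (coord (vbasis (fullv : {vspace h})) i : {linear h -> C^o}).

Lemma cobasE (y : h) : y = \sum_i cobas i y *: bas i.
Proof.
rewrite {1}(coord_vbasis (memvf y)); apply: eq_bigr => i _.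
by rewrite /cobas lfunE.
Qed.

Lemma form_cobas (x : 'Hom(h, C^o)) : x = \sum_i x (bas i) *: cobas i.
Proof.
apply/lfunP => y; rewrite {1}(cobasE y) linear_sum sum_lfunE.
by apply: eq_bigr => i _; rewrite linearZ scale_lfunE; exact: mulrC.
Qed.

Lemma dactB s (z : 'Hom(h, C^o)) y :
  (dact D s z - z) y = z (rho D s^-1%g y - y).
Proof. by rewrite add_lfunE opp_lfunE comp_lfunE linearB. Qed.

(** The difference is a multiple of alpha_s^vee; evaluating alpha_s, an eigenvector of s, and using
    alpha_s(alpha_s^vee) = 2 gives the factor. *)
Lemma reflEv s y : s \in reflections D ->
  rho D s^-1%g y - y = (- ((1 - lam D s) / 2) * alpha D s y) *: alphav D s.
Proof.
move=> sR; have [lam1 [x0 x00 x0E]] := lamP DP sR.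
have [g gE] : exists g, rho D s^-1%g y - y = g *: alphav D s.
  have : rho D s^-1%g y - y \in limg (rho D s - \1%VF).
    rewrite -(memvN _ (_ - _)) opprB.
    apply/memv_imgP; exists (rho D s^-1%g y); first exact: memvf.
    rewrite add_lfunE opp_lfunE id_lfunE -comp_lfunE -(rhoM DP) mulgV (rho1 DP).
    by rewrite id_lfunE.
  by rewrite -(alphavP DP sR) => /vlineP.
(* The eigenvector x0 provided by [lamP] is a multiple of alpha_s, because (lam - 1) x0 lies in the
   image of s - 1. *)
have alphaE : dact D s (alpha D s) = lam D s *: alpha D s.
  have [a aE] : exists a, x0 = a *: alpha D s.
    have [a aE] : exists a, (lam D s - 1) *: x0 = a *: alpha D s.
      by apply/(alphaP DP sR); exists x0; rewrite x0E scalerBl scale1r.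
    exists ((lam D s - 1)^-1 * a); rewrite -scalerA -aE scalerA mulVf ?scale1r //.
    by rewrite subr_eq0.
  have a0 : a != 0 by apply: contraNneq x00 => a0; rewrite aE a0 scale0r.
  apply: (scalerI a0); rewrite scalerA mulrC -scalerA -aE -x0E aE.
  by rewrite /dact comp_lfunZl.
have : (dact D s (alpha D s) - alpha D s) y = g * 2.
  by rewrite dactB gE linearZ /= (alpha_alphav DP sR).
rewrite alphaE -{2}[alpha D s]scale1r -scalerBl scale_lfunE => gE2.
rewrite gE; congr (_ *: _).
apply: (mulIf (x := 2)); first by rewrite pnatr_eq0.
by rewrite -gE2 mulrAC -mulNr divfK ?pnatr_eq0 // opprB.
Qed.

Lemma reflE s x : s \in reflections D ->
  dact D s x - x = (- ((1 - lam D s) / 2) * x (alphav D s)) *: alpha D s.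
Proof.
move=> sR; apply/lfunP => y; rewrite dactB reflEv // linearZ scale_lfunE.
exact: mulrAC.
Qed.

(** The coefficients are chosen so that the factors (1 - lam_s)/2 of [reflE] turn them back into
    c_s. *)
Definition refl_part : H :=
  \sum_(s in reflections D) Hc D (2 * cpar D s / (1 - lam D s)) * Hw D s.

Definition eu_part : H := \sum_i Hx D (cobas i) * Hy D (bas i).
(** The usual Euler element up to the additive constant dim h / 2, which does not change
    commutators. *)
Definition eu : H := eu_part - refl_part.

Lemma kappaE s : s \in reflections D ->
  2 * cpar D s / (1 - lam D s) * ((1 - lam D s) / 2) = cpar D s.
Proof.
move=> sR; have [l1 _] := lamP DP sR.
rewrite mulrA divfK ?subr_eq0 1?eq_sym // mulrAC divff ?mul1r //.
by rewrite pnatr_eq0.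
Qed.

(** The reflection terms that [y, x] contributes to the commutator of [eu_part] cancel those that
    [refl_part] produces by [reflE]. The intertwining form lets polynomials in eu pass across x. *)
Lemma eu_x x : eu * Hx D x = Hx D x * (eu + 1).
Proof.
suff E : eu * Hx D x - Hx D x * eu = Hx D x.
  by rewrite mulrDr mulr1; apply/eqP; rewrite addrC -subr_eq E.
have ep : eu_part * Hx D x - Hx D x * eu_part = Hx D x -
    \sum_(s in reflections D) Hc D (cpar D s * x (alphav D s)) * Hx D (alpha D s) * Hw D s.
  rewrite /eu_part mulr_suml mulr_sumr -sumrB.
  under eq_bigr => i _ do
    rewrite [Hx D x * _]mulrA Hxx -!mulrA -mulrBr Hyx mulrBr mulr_sumr.
  rewrite sumrB; congr (_ - _).
    rewrite {2}(form_cobas x) Hx_sum; apply: eq_bigr => i _.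
    by rewrite HxZ /Hc HcC.
  rewrite exchange_big /=; apply: eq_bigr => s _.
  rewrite {2}(form_cobas (alpha D s)) Hx_sum mulr_sumr mulr_suml.
  apply: eq_bigr => i _; rewrite HxZ !mulrA /Hc -HcC -rmorphM.
  by rewrite mulrAC.
rewrite /eu commB ep.
have zp : refl_part * Hx D x - Hx D x * refl_part =
    - \sum_(s in reflections D) Hc D (cpar D s * x (alphav D s)) * Hx D (alpha D s) * Hw D s.
  rewrite /refl_part mulr_suml mulr_sumr -sumrB -sumrN; apply: eq_bigr => s sR.
  rewrite -[Hc D _ * Hw D s * _]mulrA Hwx [Hx D x * _]mulrA /Hc -[Hx D x * _]HcC.
  rewrite -!mulrA -mulrBr -mulrBl -HxN -HxD reflE // HxZ !mulrA.
  by rewrite /Hc -rmorphM mulrA mulrN kappaE // mulNr rmorphN !mulNr.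
by rewrite zp opprK subrK.
Qed.

Lemma HyN y : Hy D (- y) = - Hy D y.
Proof. by rewrite -scaleN1r HyZ /Hc rmorphN1 mulN1r. Qed.

Lemma eu_y y : eu * Hy D y = Hy D y * (eu - 1).
Proof.
suff E : eu * Hy D y - Hy D y * eu = - Hy D y.
  by rewrite mulrBr mulr1 -E addrC subrK.
have ep : eu_part * Hy D y - Hy D y * eu_part = - Hy D y +
    \sum_(s in reflections D) Hc D (cpar D s * alpha D s y) * Hw D s * Hy D (alphav D s).
  rewrite /eu_part mulr_suml mulr_sumr -sumrB.
  under eq_bigr => i _ do
    rewrite -[_ * Hy D y]mulrA Hyy !mulrA -mulrBl -opprB Hyx opprB mulrBl mulr_suml.
  rewrite sumrB addrC; congr (_ + _).
    by rewrite {2}(cobasE y) Hy_sum; congr (- _); apply: eq_bigr => i _; rewrite HyZ.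
  rewrite exchange_big /=; apply: eq_bigr => s _.
  rewrite {2}(cobasE (alphav D s)) Hy_sum mulr_sumr.
  apply: eq_bigr => i _; rewrite HyZ !mulrA /Hc -[_ * pcst _ _]HcC mulrA -rmorphM.
  by rewrite [_ * (cpar _ _ * _)]mulrC.
have zp : refl_part * Hy D y - Hy D y * refl_part =
    \sum_(s in reflections D) Hc D (cpar D s * alpha D s y) * Hw D s * Hy D (alphav D s).
  rewrite /refl_part mulr_suml mulr_sumr -sumrB; apply: eq_bigr => s sR.
  have yw : Hy D y * Hw D s = Hw D s * Hy D (rho D s^-1%g y).
    by rewrite Hwy -comp_lfunE -(rhoM DP) mulgV (rho1 DP) id_lfunE.
  rewrite [Hy D y * _]mulrA /Hc -[Hy D y * _]HcC -!mulrA yw -mulrBr -mulrBr -HyN -HyD.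
  rewrite -(opprB _ y) reflEv // -scaleNr HyZ /Hc mulNr opprK [Hw D s * _]mulrA -HcC !mulrA.
  by rewrite -rmorphM mulrA kappaE.
by rewrite /eu commB ep zp addrK.
Qed.

Lemma peval_x p x n :
  peval k (eu - n.+1%:R) p * Hx D x = Hx D x * peval k (eu - n%:R) p.
Proof.
apply: peval_intertwine; first exact: HcC.
rewrite mulrBl eu_x -natr1 mulrDr mulrBr mulr1 mulrDl mul1r opprD addrACA subrr addr0.
by rewrite mulr_natr mulr_natl.
Qed.

Lemma peval_shift j p : peval k eu (pshift j p) = peval k (eu - j%:R) p.
Proof. by rewrite peval_comp ?pevalXsubC ?rmorph_nat //; exact: HcC. Qed.

Lemma peval_y p y : peval k eu p * Hy D y = Hy D y * peval k (eu - 1) p.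
Proof. by apply: peval_intertwine; [exact: HcC|exact: eu_y]. Qed.

Lemma peval_y_shift p y : peval k eu p * Hy D y = Hy D y * peval k eu (pshift 1 p).
Proof. by rewrite peval_y peval_shift. Qed.

Lemma peval_x_shift p x n :
  peval k eu (pshift n.+1 p) * Hx D x = Hx D x * peval k eu (pshift n p).
Proof. by rewrite !peval_shift peval_x. Qed.

(* The matrix of left multiplication by - refl_part on the group algebra.   *)
Definition refl_mx : 'M[C]_#|W| := \matrix_(i, j)
  \sum_(s in reflections D | (s * enum_val i == enum_val j)%g)
     - (2 * cpar D s / (1 - lam D s)).

(** Its roots contain all eigenvalues of eu on singular vectors, where eu acts as [- refl_part]. *)
Definition chi : {poly C} := char_poly refl_mx.

Lemma chi_neq0 : chi != 0.
Proof. exact/monic_neq0/char_poly_monic. Qed.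

(** Modulo G, eu acts on the vectors w u as [- refl_part], that is by the matrix [refl_mx].
    Cayley-Hamilton for this family, read at w = 1, gives the claim. *)
Lemma chi_kills (M : lmodType H) (G : subspace k M) (u : M) :
  (forall v : M, G v -> G (eu *: v)) ->
  (forall w, G (eu_part *: (Hw D w *: u))) ->
  G (peval k eu chi *: u).
Proof.
move=> euG uG; have := @char_poly_kills _ _ k HcC M eu G euG _
  (fun i : 'I_#|W| => Hw D (enum_val i) *: u) refl_mx.
move/(_ _ (enum_rank 1%g)); rewrite enum_rankK Hw1 scale1r; apply=> i.
rewrite scalerBl -addrA; apply: spaceD; first exact: uG.
rewrite [X in G X](_ : _ = 0); first exact: space0.
rewrite -opprD; apply/eqP; rewrite oppr_eq0 addr_eq0; apply/eqP.
rewrite scalerA /refl_part mulr_suml scaler_suml -sumrN.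
rewrite (eq_bigr (fun j => \sum_(s in reflections D | (s * enum_val i == enum_val j)%g)
    Hc D (2 * cpar D s / (1 - lam D s)) *: (Hw D (s * enum_val i)%g *: u))).
  rewrite (exchange_big_dep (mem (reflections D))) /=; last by move=> j s _ /andP[].
  apply: eq_bigr => s sR; rewrite sR /=.
  rewrite (big_pred1 (enum_rank (s * enum_val i)%g)).
    by rewrite HwM !scalerA mulrA.
  by move=> j /=; apply/eqP/eqP => ->; rewrite ?enum_valK ?enum_rankK.
move=> j _; rewrite mxE sumrN rmorphN scaleNr opprK rmorph_sum scaler_suml.
by apply: eq_bigr => s /andP[_ /eqP ->].
Qed.

Definition is_x (a : H) : Prop := exists x, a = Hx D x.

Section Filtration.
Variable M : lmodType H.
Implicit Types (u v : M) (n : nat).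

Local Notation F := (@adic H M is_x).

Lemma F_x n x v : F n v -> F n.+1 (Hx D x *: v).
Proof. by apply: adicM; exists x. Qed.

Lemma F_xx n x v : F n v -> F n (Hx D x *: v).
Proof. by move=> /F_x/adicS; exact. Qed.

Lemma F_c n c v : F n v -> F n (Hc D c *: v).
Proof. by apply: adicZ => a _; exact: HcC. Qed.

Lemma F_w n w v : F n v -> F n (Hw D w *: v).
Proof.
apply: (adic_map (T := fun v => Hw D w *: v)); first by move=> u u'; exact: scalerDr.
move=> _ u [x ->]; exists (Hx D (dact D w x)); first by exists (dact D w x).
by rewrite !scalerA Hwx.
Qed.

(** The commutator [y, x] lies in the group algebra, which preserves every F n, so the derivation
    rule applies. *)
Lemma F_y n y v : F n.+1 v -> F n (Hy D y *: v).
Proof.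
apply: (adic_der (T := fun v => Hy D y *: v)); first by move=> u u'; exact: scalerDr.
move=> m _ u [x ->] um; rewrite !scalerA -scalerBl Hyx scalerBl scaler_suml.
apply: (spaceB (S := adic_space HcC M is_x m)); first exact: F_c.
apply: adic_sum => s _.
by rewrite -scalerA; apply: F_c; exact: F_w.
Qed.

Lemma F_eu_part n v : F n v -> F n (eu_part *: v).
Proof.
rewrite /eu_part scaler_suml; case: n => [|n] vF; first exact: adic_all.
by apply: adic_sum => i _; rewrite -scalerA; apply: F_x; exact: F_y.
Qed.

Lemma F_eu n v : F n v -> F n (eu *: v).
Proof.
move=> vF; rewrite scalerBl; apply: (spaceB (S := adic_space HcC M is_x n)).
  exact: F_eu_part.
rewrite /= /refl_part scaler_suml; apply: adic_sum => s _.
by rewrite -scalerA; apply: F_c; exact: F_w.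
Qed.

Lemma F_peval n p v : F n v -> F n (peval k eu p *: v).
Proof.
move=> vF; apply: (peval_sub HcC (G := adic_space HcC M is_x n)) => // u.
exact: F_eu.
Qed.

(** Continuity of the action: d is an upper bound for the number of factors y in the terms of an
    expression for a. *)
Lemma F_act (a : H) : exists d, forall n v, F (n + d) v -> F n (a *: v).
Proof.
elim/palg_ind: a => [c|[w|x|y]|p q [d dP] [e eP]|p q [d dP] [e eP]].
- by exists 0%N => n v; rewrite addn0; exact: F_c.
- by exists 0%N => n v; rewrite addn0; exact: F_w.
- by exists 0%N => n v; rewrite addn0; exact: F_xx.
- by exists 1%N => n v; rewrite addn1; exact: F_y.
- exists (maxn d e) => n v vF; rewrite scalerDl; apply: adicD.
    by apply: dP; apply: adicW vF; rewrite leq_add2l leq_maxl.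
  by apply: eP; apply: adicW vF; rewrite leq_add2l leq_maxr.
- exists (d + e)%N => n v vF; rewrite -scalerA.
  by apply/dP/eP; rewrite -addnA.
Qed.

(** F n is spanned by products of n linear forms with vectors of M, and each form raises the
    eigenvalues of eu by one. *)
Lemma F_shift Q : (forall v, F 1 (peval k eu Q *: v)) ->
  forall n v, F n v -> F n.+1 (peval k eu (pshift n Q) *: v).
Proof.
move=> QF n v; elim=> {n v} [v|n|n u v _ uF _ vF|n _ v [x ->] _ vF].
- by rewrite pshift0; exact: QF.
- by rewrite scaler0; exact: adic0.
- by rewrite scalerDr; exact: adicD.
- by rewrite scalerA peval_x_shift -scalerA; exact: F_x.
Qed.

Lemma F_cofinite : cofinite k (F 1) -> forall n, cofinite k (F n).
Proof.
apply: (adic_cofinite HcC (g := fun i => Hx D (cobas i))).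
  by move=> i; exists (cobas i).
move=> _ [x ->]; exists (fun i => Hc D (x (bas i))).
  by rewrite {1}(form_cobas x) Hx_sum; apply: eq_bigr => i _; rewrite HxZ /Hc HcC.
by move=> i n v; exact: F_c.
Qed.

Lemma F_annihilator : cofinite k (F 1) ->
  exists2 Q, Q != 0 & forall v, F 1 (peval k eu Q *: v).
Proof.
move=> [n [l lP]].
have [a aP] := choice (fun i => lP (eu *: l i)).
have := @char_poly_kills _ _ k HcC M eu (adic_space HcC M is_x 1) (@F_eu 1) _ l
  (\matrix_(i, j) a i 0 j).
set Q := char_poly _ => QP; exists Q; first exact/monic_neq0/char_poly_monic.
move=> v; have [c cP] := lP v; rewrite -(subrK (lcomb k l c) v) scalerDr.
apply: adicD; first exact: F_peval.
rewrite scaler_sumr; apply: adic_sum => i _.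
rewrite scalerA -HcC -scalerA; apply: F_c; apply: QP => {}i.
by under eq_bigr => j _ do rewrite mxE; exact: aP.
Qed.

End Filtration.
End Euler.

(** * Category O *)

Section CategoryO.
Variables (C : numClosedFieldType) (h : vectType C) (W : finGroupType).
Variables (D : cherednik_data h W) (DP : is_cherednik_data D).

Local Notation H := (cherednik D).
Local Notation k := (pcst (cher_rel D) : {rmorphism C -> H}).
Local Notation "p @@ v" := (peval k (eu D) p *: v) (at level 40).
Local Notation chi := (chi D).
Local Notation kC := (@HcC C h W D).
Implicit Types (p q r : {poly C}) (n m j : nat).

Definition unshift p : {poly C} := p \Po ('X + 1%:P).

Lemma coprime_unshift p q j :
  coprimep p (pshift j.+1 q) -> coprimep (unshift p) (pshift j q).
Proof.
move/(coprimep_comp_poly ('X + 1%:P)); rewrite -/(unshift p).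
congr coprimep; rewrite /pshift -comp_polyA comp_polyB comp_polyX comp_polyC.
by rewrite -natr1 polyCD opprD addrACA subrr addr0.
Qed.

Lemma coprime_unshift1 p q : coprimep (unshift p) q -> coprimep p (pshift 1 q).
Proof.
move/(coprimep_comp_poly ('X - 1%:P)); rewrite -/(pshift 1 q).
congr coprimep; rewrite /unshift -comp_polyA comp_polyD comp_polyX comp_polyC subrK.
exact: comp_polyXr.
Qed.

Lemma unshiftK p : pshift 1 (unshift p) = p.
Proof.
by rewrite /pshift /unshift -comp_polyA comp_polyD comp_polyX comp_polyC subrK comp_polyXr.
Qed.

Section Module.
Variable M : lmodType H.
Implicit Types (u v : M).

Local Notation F := (@adic H M (@is_x _ _ _ D)).

Lemma eu_actM p q v : (p * q) @@ v = p @@ (q @@ v).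
Proof. by rewrite pevalM ?scalerA //; exact: kC. Qed.

Lemma eu_actD p q v : (p + q) @@ v = p @@ v + q @@ v.
Proof. by rewrite pevalD scalerDl. Qed.

Lemma eu_act1 v : 1 @@ v = v.
Proof. by rewrite peval1 scale1r. Qed.

Lemma eu_actC p q v : p @@ (q @@ v) = q @@ (p @@ v).
Proof. by rewrite -!eu_actM mulrC. Qed.

Lemma coprime_in (G : subspace k M) p q v :
  (forall u, G u -> G (eu D *: u)) ->
  coprimep p q -> G (p @@ v) -> G (q @@ v) -> G v.
Proof.
move=> euG /Bezout_eq1_coprimepP[[a b] /= ab] pG qG.
rewrite -(eu_act1 v) -ab eu_actD !eu_actM.
by apply: spaceD; apply: (peval_sub kC).
Qed.

Definition zero_sub : submodule M.
Proof.
exists (fun v => v = 0) => // [u v -> ->|a u ->]; first exact: addr0.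
exact: scaler0.
Defined.

Lemma coprime_zero p q v : coprimep p q -> p @@ v = 0 -> q @@ v = 0 -> v = 0.
Proof.
apply: (coprime_in (G := sub_space k zero_sub)) => u ->.
exact: scaler0.
Qed.

(** Being singular modulo X is W-stable, since y w = w (w^-1 y), so [eu_part] sends all w v into X
    and [chi_kills] applies. *)
Lemma singular_kills (X : submodule M) v :
  (forall y, X (Hy D y *: v)) -> X (chi @@ v).
Proof.
move=> vX; apply: (chi_kills (G := sub_space k X)) => [u uX|w].
  exact: in_subZ.
rewrite /eu_part scaler_suml; apply: space_sum => i _ /=; rewrite -scalerA.
apply: in_subZ; rewrite scalerA.
have -> : Hy D (bas i) * Hw D w = Hw D w * Hy D (rho D w^-1%g (bas i)).
  by rewrite Hwy -comp_lfunE -(rhoM DP) mulgV (rho1 DP) id_lfunE.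
by rewrite -scalerA; exact: in_subZ.
Qed.

Lemma nil_le_y n y v : nil_le n v -> nil_le n (Hy D y *: v).
Proof. by move/nil_leS; exact. Qed.

Definition nil_space n : subspace k M :=
  Subspace (@nil_le0 _ _ _ _ M n) (@nil_leD _ _ _ _ M n)
    (fun a => @nil_leC _ _ _ _ M n a).

(** The product of the chi(t - j) for j < n. A y lowers eigenvalues of eu by one, so an eigenvalue
    on a vector killed by n of them is a root of chi plus some j < n. *)
Fixpoint chis n : {poly C} := if n is n'.+1 then chi * pshift 1 (chis n') else 1.

Lemma chis_neq0 n : chis n != 0.
Proof.
by elim: n => [|n IHn] /=; rewrite ?oner_eq0 // mulf_neq0 ?pshift_eq0 // chi_neq0.
Qed.

Lemma coprime_chis n r : (forall j, coprimep r (pshift j chi)) -> coprimep r (chis n).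
Proof.
elim: n r => [|n IHn] r rP /=; first exact: coprimep1.
rewrite coprimepMr -{1}[chi]pshift0 rP; apply: coprime_unshift1; apply: IHn => j.
exact/coprime_unshift/rP.
Qed.

Lemma nil_kills n v : nil_le n v -> chis n @@ v = 0.
Proof.
elim: n v => [|n IHn] v /= vN; first by rewrite vN scaler0.
rewrite eu_actM; apply: (@singular_kills zero_sub) => y /=.
by rewrite scalerA -(peval_y_shift DP) -scalerA IHn.
Qed.

(** Each y replaces p(t) by p(t + 1). After m of them the polynomial is coprime to every Q(t - j),
    and the hypothesis on Q forces the vector to vanish. *)
Lemma nil_lower Q :
  (forall p u, p @@ u = 0 -> (forall j, coprimep p (pshift j Q)) -> u = 0) ->
  forall m p u, p @@ u = 0 -> (forall j, (m <= j)%N -> coprimep p (pshift j Q)) ->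
  nil_le m u.
Proof.
move=> Qu; elim=> [|m IHm] p u pu pQ /=; first by apply: Qu pu _ => j; exact: pQ.
move=> y; apply: (IHm (unshift p)) => [|j mj]; last exact/coprime_unshift/pQ.
by rewrite scalerA (peval_y_shift DP) unshiftK -scalerA pu scaler0.
Qed.

Inductive xspan (P : M -> Prop) : M -> Prop :=
  | xspan_in v : P v -> xspan P v
  | xspan0 : xspan P 0
  | xspanD u v : xspan P u -> xspan P v -> xspan P (u + v)
  | xspan_x x v : xspan P v -> xspan P (Hx D x *: v).

(** The C[h]-span of the vectors of nilpotency at most n. It is stable under y because moving y past
    x leaves only an element of the group algebra, which preserves nilpotency. *)
Definition xspan_nil n : submodule M.
Proof.
exists (xspan (nil_le n)); [exact: xspan0|exact: xspanD|].
have Xc c u : xspan (nil_le n) u -> xspan (nil_le n) (Hc D c *: u).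
  elim=> {u} [v vN||u v _ uX _ vX|x v _ vX].
  - by apply: xspan_in; exact: nil_leC.
  - by rewrite scaler0; exact: xspan0.
  - by rewrite scalerDr; exact: xspanD.
  - by rewrite scalerA /Hc HcC -scalerA; exact: xspan_x.
have Xw w u : xspan (nil_le n) u -> xspan (nil_le n) (Hw D w *: u).
  elim=> {u} [v vN||u v _ uX _ vX|x v _ vX].
  - by apply: xspan_in; exact: nil_lew.
  - by rewrite scaler0; exact: xspan0.
  - by rewrite scalerDr; exact: xspanD.
  - by rewrite scalerA Hwx -scalerA; exact: xspan_x.
have Xy y u : xspan (nil_le n) u -> xspan (nil_le n) (Hy D y *: u).
  elim=> {u} [v vN||u v _ uX _ vX|x v vX vyX].
  - by apply: xspan_in; exact: nil_le_y.
  - by rewrite scaler0; exact: xspan0.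
  - by rewrite scalerDr; exact: xspanD.
  - rewrite scalerA -(subrK (Hx D x * Hy D y) (_ * _)) Hyx scalerDl scalerBl -scalerA.
    apply: xspanD; last exact: xspan_x.
    apply: xspanD; first exact: Xc.
    rewrite -scaleNr -sumrN scaler_suml; elim/big_ind: _ => [|u u'|s _].
    + exact: xspan0.
    + exact: xspanD.
    + by rewrite -mulNr -rmorphN -scalerA; apply: Xc; exact: Xw.
elim/palg_ind=> [c|[w|x|y]|p q IHp IHq|p q IHp IHq] u uX.
- exact: Xc.
- exact: Xw.
- exact: xspan_x.
- exact: Xy.
- by rewrite scalerDl; apply: xspanD; [exact: IHp|exact: IHq].
- by rewrite -scalerA; apply: IHp; exact: IHq.
Defined.

Lemma poly_toH_gen x : poly_toH D (coordf x) = Hx D x.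
Proof. exact: plift_gen. Qed.
Lemma poly_toH_cst c : poly_toH D (pcst _ c) = Hc D c.
Proof. exact: plift_cst. Qed.

(** The generators are a finite spanning set of the vectors killed by n0 successive y, where n0 is
    such that chi(t) and chi(t - j) are coprime for all j >= n0. *)
Lemma fin_generated (G : nat -> subspace k M) m0 :
  (forall v, exists n, nil_le n v) -> (forall n, cofinite k (G n)) ->
  (forall n y v, G n.+1 v -> G n (Hy D y *: v)) ->
  (forall n v, (m0 <= n)%N -> G n v -> (forall y, Hy D y *: v = 0) -> v = 0) ->
  fg_over_poly M.
Proof.
move=> Mnil Gfin Gy Gsing.
have [n0 n0P] := coprime_shift (chi_neq0 D) (chi_neq0 D).
(* Each y costs one step of nilpotency and one step of G, so the vector reaches the range where
   singular vectors vanish. *)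
have nilG n v : nil_le n v -> G (m0 + n)%N v -> v = 0.
  elim: n v => [|n IHn] v vN vG; first exact: vN.
  apply: (Gsing _ v _ vG) => [|y]; first exact: leq_addr.
  by apply: IHn; [exact: vN|apply: Gy; rewrite -addnS].
have [r [g [gN gP]]] := fin_span (P := nil_space n0) (Gfin _) (@nilG n0).
exists r, g => v.
suff: xspan (nil_le n0) v.
  elim=> {v} [v vN||u v _ [p ->] _ [q ->]|x v _ [p ->]].
  - have [c ->] := gP v vN; exists (fun i => pcst _ (c 0 i)).
    by apply: eq_bigr => i _; rewrite poly_toH_cst.
  - by exists (fun=> 0); rewrite big1 // => i _; rewrite rmorph0 scale0r.
  - exists (fun i => p i + q i); rewrite -big_split; apply: eq_bigr => i _.
    by rewrite rmorphD scalerDl.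
  - exists (fun i => coordf x * p i); rewrite scaler_sumr; apply: eq_bigr => i _.
    by rewrite rmorphM poly_toH_gen scalerA.
have [n vN] := Mnil v; elim: n v vN => [|n IHn] v vN.
  by apply: xspan_in; apply: nil_leW vN.
(* By induction every y sends v into the submodule generated so far: v is singular modulo it. *)
have chiv : xspan_nil n0 (chi @@ v).
  by apply: singular_kills => y; apply: IHn; exact: vN.
(* q2(eu) v is killed by q1, whose roots are roots of chi, so n0 of the y annihilate it. Both
   chi(eu) v and q2(eu) v are then in the submodule, and q2 is coprime to chi. *)
have [q1 [q2 [qE cq2 cq1]]] := split_coprime (chi_neq0 D) (chis_neq0 n.+1).
apply: (coprime_in (G := sub_space k (xspan_nil n0)) _ cq2 chiv).
  by move=> u; exact: in_subZ.
apply: xspan_in; apply: (nil_lower (Q := chi) _ (p := q1)) => [p u pu pc||j /n0P/cq1 //].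
  by have [l /nil_kills] := Mnil u; apply: coprime_zero pu; exact: coprime_chis.
by rewrite -eu_actM -qE nil_kills.
Qed.

(** A vector of F n is killed by a polynomial whose roots are among those of the chi(t - j) with j
    >= n, while v is killed by a fixed [chis l]; for n large the two are coprime. *)
Lemma O_separated v : (forall u, exists n, nil_le n u) -> (forall n, F n v) -> v = 0.
Proof.
move=> Mnil vF.
have kills n u : F n u -> exists2 q, q @@ u = 0 &
    forall r, (forall j, (n <= j)%N -> coprimep r (pshift j chi)) -> coprimep r q.
  elim=> {n u} [u|n|n u u' _ [q qu qP] _ [q' qu' qP']|n _ u [x ->] _ [q qu qP]].
  - have [n un] := Mnil u; exists (chis n); first exact: nil_kills.
    by move=> r rP; apply: coprime_chis => j; exact: rP.
  - by exists 1; [rewrite scaler0|move=> r _; exact: coprimep1].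
  - exists (q * q') => [|r rP]; last by rewrite coprimepMr qP // qP'.
    by rewrite scalerDr eu_actM eu_actC qu scaler0 eu_actM qu' scaler0 addr0.
  - exists (pshift 1 q) => [|r rP].
      by rewrite scalerA (peval_x_shift DP) pshift0 -scalerA qu scaler0.
    by apply: coprime_unshift1; apply: qP => j nj; apply: coprime_unshift; exact: rP.
have [l vl] := Mnil v; have [n nP] := coprime_shift (chis_neq0 l) (chi_neq0 D).
have [q qv qP] := kills n v (vF n).
exact: (coprime_zero (qP _ nP) (nil_kills vl) qv).
Qed.

End Module.
End CategoryO.

(** * Adically complete modules and their nilpotent parts *)

Section SubmoduleValue.
Variables (B : pzRingType) (M : lmodType B) (S : submodule M).
Implicit Types u v : submodT S.

Lemma sub_valB u v : sub_val (u - v) = sub_val u - sub_val v.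
Proof. exact: (raddfB (val : submodT S -> M)). Qed.

Lemma sub_val_lcomb (C : fieldType) (k : {rmorphism C -> B}) n
    (l : 'I_n -> submodT S) c :
  sub_val (lcomb k l c) = lcomb k (fun i => sub_val (l i)) c.
Proof.
rewrite /lcomb [LHS](raddf_sum (val : submodT S -> M)).
exact: eq_bigr.
Qed.

Lemma sub_valZ a u : sub_val (a *: u) = a *: sub_val u.
Proof. by []. Qed.

Variables (C : fieldType) (k : {rmorphism C -> B}) (G : subspace k M).

Definition space_restrict : subspace k (submodT S).
Proof.
exists (fun v => G (sub_val v)).
- exact: space0.
- by move=> u v; exact: spaceD.
- by move=> a u; exact: spaceZ.
Defined.

Lemma space_restrictZ (a : B) v : G (a *: sub_val v) -> space_restrict (a *: v).
Proof. by []. Qed.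

Lemma space_restrictP v : space_restrict v -> G (sub_val v).
Proof. by []. Qed.

Lemma cofinite_restrict : cofinite k G -> cofinite k space_restrict.
Proof.
move=> Gfin; have [n [g [gS gG]]] := relative_span (sub_space k S) Gfin.
exists n, (fun i => SubMod (introT (asboolP _) (gS i))) => v.
have /asboolP/gG[c cG] := sub_valP v; exists c.
by rewrite /space_restrict /in_space sub_valB sub_val_lcomb.
Qed.

End SubmoduleValue.

Section AdicallyComplete.
Variables (C : numClosedFieldType) (h : vectType C) (W : finGroupType).
Variables (D : cherednik_data h W) (DP : is_cherednik_data D).

Local Notation H := (cherednik D).
Local Notation k := (pcst (cher_rel D) : {rmorphism C -> H}).
Local Notation "p @@ v" := (peval k (eu D) p *: v) (at level 40).
Local Notation chi := (chi D).
Local Notation kC := (@HcC C h W D).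
Local Notation J := (@is_x _ _ _ D).
Local Notation "'F[' M ]" := (@adic H M J).
Local Notation Fsp M n := (adic_space kC M J n).
Implicit Types (p q r : {poly C}) (n m j : nat).

Record adically_complete (K : lmodType H) : Prop := AdicallyComplete {
  ac_finite : cofinite k (F[K] 1);
  ac_separated : forall v, (forall n, F[K] n v) -> v = 0;
  ac_limit : forall u : nat -> K, (forall n, F[K] n (u n.+1 - u n)) ->
    exists v, forall n, F[K] n (v - u n)
}.

Local Notation E K := (submodT (nilpotent_sub K DP)).

Lemma nilpotentP (K : lmodType H) (v : K) :
  nilpotent_vector v <-> exists n, nil_le n v.
Proof. by split=> -[n vn]; exists n; apply/nil_leP. Qed.

Lemma nil_leE (K : lmodType H) n (v : E K) : nil_le n v <-> nil_le n (sub_val v).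
Proof.
elim: n v => [|n IHn] v /=; first by split=> [->//|v0]; exact: val_inj.
split=> vN y; first exact: (IHn (Hy D y *: v)).1 (vN y).
exact: (IHn (Hy D y *: v)).2 (vN y).
Qed.

Lemma E_nilpotent (K : lmodType H) (v : E K) : exists n, nil_le n v.
Proof.
have /asboolP/nilpotentP[n vn] := sub_valP v.
by exists n; apply/nil_leE.
Qed.

Lemma linear_poly (K L : lmodType H) (f : {linear K -> L}) p v : f (p @@ v) = p @@ f v.
Proof. exact: linearZ. Qed.

Section OneModule.
Variables (K : lmodType H) (KP : adically_complete K).
Implicit Types (u v : K).
Local Notation F := (F[K]).

Definition euler_bound Q := Q != 0 /\ forall v, F 1 (Q @@ v).

Lemma euler_boundP : exists Q, euler_bound Q.
Proof. by have [Q Q0 QP] := F_annihilator (ac_finite KP); exists Q. Qed.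

Section Bound.
Variables (Q : {poly C}) (QP : euler_bound Q).

(** Q(t - j) kills the layer F j / F (j+1). Coprimality with p, which kills v, pushes v from each
    layer to the next, hence to 0. *)
Lemma sep_coprime n p v : p @@ v = 0 -> F n v ->
  (forall j, (n <= j)%N -> coprimep p (pshift j Q)) -> v = 0.
Proof.
move=> pv vn pQ; apply: (ac_separated KP) => m.
have vF j : F (j + n)%N v.
  elim: j => // j IHj; apply: (coprime_in (G := Fsp K (j + n).+1) _ (pQ (j + n)%N _)).
  - by move=> u; exact: F_eu.
  - exact: leq_addl.
  - by rewrite /= pv; exact: adic0.
  - by apply: (F_shift DP) => // u; exact: QP.2.
by apply: adicW (vF m); exact: leq_addr.
Qed.

(** After enough y the roots of p lie below all eigenvalues of eu on the layers of K. *)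
Lemma finite_nil p v : p != 0 -> p @@ v = 0 -> nilpotent_vector v.
Proof.
move=> p0 pv; have [m mP] := coprime_shift p0 QP.1.
apply/nilpotentP; exists m; apply: (nil_lower DP (Q := Q) _ pv) => // q u qu qQ.
by apply: (sep_coprime qu (adic_all _ u)) => j _; exact: qQ.
Qed.

(** A vector killed by p modulo F n is corrected layer by layer into one that p kills exactly;
    completeness supplies the limit. *)
Lemma lift_kernel n p v : (forall j, (n <= j)%N -> coprimep p (pshift j Q)) ->
  F n (p @@ v) -> exists2 e, p @@ e = 0 & F n (v - e).
Proof.
move=> pQ pv.
have step (j : nat) u : exists u', (n <= j)%N -> F j (p @@ u) ->
    F j (u' - u) /\ F j.+1 (p @@ u').
  have [nj|nj] := leqP n j; last by exists u.
  have /Bezout_eq1_coprimepP[[a b] /= ab] := pQ _ nj.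
  (* With a p + b Q(t - j) = 1, applying p to the corrected vector leaves b Q(t - j) on p(eu) u,
     which lies one layer deeper. *)
  exists (u - a @@ (p @@ u)) => _ pu; rewrite addrAC subrr add0r.
  split; first by apply: (spaceN (S := Fsp K j)); exact: F_peval.
  rewrite scalerBr; move: (p @@ u) pu => w pu.
  have wE : w = a @@ (p @@ w) + b @@ (pshift j Q @@ w).
    by rewrite -!eu_actM -eu_actD ab eu_act1.
  rewrite [p @@ _]eu_actC {1}wE addrAC subrr add0r.
  by apply: F_peval; apply: (F_shift DP) => // w'; exact: QP.2.
have [s sP] := choice (fun ju : nat * K => step ju.1 ju.2).
pose U := fix U i := if i is i'.+1 then s ((n + i')%N, U i') else v.
have UP i : F (n + i)%N (p @@ U i).
  elim: i => [|i IHi] /=; first by rewrite addn0.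
  by rewrite addnS; apply: (sP (_, U i) _ IHi).2; exact: leq_addr.
have Ustep i : F (n + i)%N (U i.+1 - U i).
  by apply: (sP (_, U i) _ (UP i)).1; exact: leq_addr.
(* The truncated difference makes the sequence constant, equal to v, up to index n; from there on it
   follows the corrections. *)
have [e eP] : exists e, forall m, F m (e - U (m - n)%N).
  apply: (ac_limit KP) => m; have [nm|mn] := leqP n m.
    by rewrite subSn // -{1}(subnKC nm); exact: Ustep.
  have /eqP -> : (m.+1 - n == 0)%N by rewrite subn_eq0.
  have /eqP -> : (m - n == 0)%N by rewrite subn_eq0 ltnW.
  by rewrite subrr; exact: adic0.
exists e.
  apply: (ac_separated KP) => m; apply: (adicW (n := (n + m)%N)); first exact: leq_addl.
  rewrite -(subrK (U m) e) scalerDr; apply: adicD => //.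
  by apply: F_peval; have := eP (n + m)%N; rewrite addKn.
by have := spaceN (S := Fsp K n) (eP n); rewrite subnn opprB.
Qed.

(** The product of the Q(t - j) for j < n, one factor for each layer of K / F n. *)
Fixpoint bounds n : {poly C} :=
  if n is n'.+1 then pshift n' Q * bounds n' else 1.

Lemma bounds_neq0 n : bounds n != 0.
Proof.
by elim: n => [|n IHn] /=; rewrite ?oner_eq0 // mulf_neq0 ?pshift_eq0 // QP.1.
Qed.

Lemma bounds_kill n v : F n (bounds n @@ v).
Proof.
elim: n => [|n IHn]; first exact: adic_all.
by rewrite eu_actM; apply: (F_shift DP) => // w; exact: QP.2.
Qed.

Lemma dvd_bounds n : Q %| bounds n.+1.
Proof.
elim: n => [|n IHn] /=; first by rewrite pshift0 dvdp_mulr.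
by rewrite dvdp_mull.
Qed.

(** With [bounds n] = q1 q2 and a q1 + b q2 = 1, the vector (b q2)(eu) v is the part of v for the
    roots of Q; q1 kills it modulo F n, so it lifts to a nilpotent vector. The rest is in F 1 since
    Q divides q1. *)
Lemma dense1 v : exists2 e, nilpotent_vector e & F 1 (v - e).
Proof.
(* The successor makes n positive, so that Q divides [bounds n]. *)
have [n0 nP] := coprime_shift QP.1 QP.1; set n := n0.+1.
have [q1 [q2 [qE cq2 cq1]]] := split_coprime QP.1 (bounds_neq0 n).
have Qq1 : Q %| q1 by rewrite -(Gauss_dvdpl _ cq2) -qE dvd_bounds.
have q10 : q1 != 0.
  by apply: contraNneq (bounds_neq0 n) => q10; rewrite qE q10 mul0r.
have /Bezout_eq1_coprimepP[[a b] /= ab] := cq1 _ cq2.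
have [||e e0 ve] := lift_kernel (n := n) (p := q1) (v := (b * q2) @@ v).
- by move=> j nj; apply/cq1/nP/ltnW.
- rewrite -eu_actM mulrCA -qE eu_actM; apply: F_peval; exact: bounds_kill.
exists e; first exact: finite_nil e0.
rewrite -(subrK ((b * q2) @@ v) v) -addrA; apply: adicD; last exact: adicW ve.
rewrite -{1}[v]eu_act1 -ab eu_actD addrK eu_actM; apply: F_peval.
by move: Qq1 => /dvdpP[c ->]; rewrite eu_actM; apply: F_peval; exact: QP.2.
Qed.

End Bound.

Lemma nilpotentD u v : nilpotent_vector u -> nilpotent_vector v ->
  nilpotent_vector (u + v).
Proof. exact: (in_subD (s := nilpotent_sub K DP)). Qed.

Lemma dense n v : exists2 e, nilpotent_vector e & F n (v - e).
Proof.
have [Q QP] := euler_boundP.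
elim: n v => [|n IHn] v.
  exists 0; last exact: adic_all.
  exact: (in_sub0 (nilpotent_sub K DP)).
have step m u : F m u -> exists2 e, nilpotent_vector e & F m.+1 (u - e).
  elim=> {m u} [u|m|m u u' _ [e eN ue] _ [e' e'N ue']|m _ u [x ->] _ [e eN ue]].
  - exact: dense1 QP u.
  - exists 0; last by rewrite subrr; exact: adic0.
    exact: (in_sub0 (nilpotent_sub K DP)).
  - exists (e + e'); first exact: nilpotentD.
    by rewrite opprD addrACA; exact: adicD.
  - exists (Hx D x *: e); first exact: (in_subZ (s := nilpotent_sub K DP)).
    by rewrite -scalerBr; exact: F_x.
have [e eN /step[e' e'N ve]] := IHn v.
by exists (e + e'); [exact: nilpotentD|rewrite opprD addrA].
Qed.

Lemma denseE n v : exists e : E K, F n (v - sub_val e).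
Proof.
have [e /asboolP eN ve] := dense n v.
by exists (SubMod (S := nilpotent_sub K DP) eN).
Qed.

(** A singular vector is killed by chi, so deep in the filtration [sep_coprime] makes it vanish;
    this is the condition needed in [fin_generated]. *)
Lemma E_in_O : is_O (E K).
Proof.
split; last by move=> v; apply/nilpotentP; exact: E_nilpotent.
have [Q QP] := euler_boundP.
have [m0 m0P] := coprime_shift (chi_neq0 D) QP.1.
apply: (fin_generated DP (G := fun n => space_restrict _ (Fsp K n)) (m0 := m0)).
- exact: E_nilpotent.
- by move=> n; apply: cofinite_restrict; exact: F_cofinite (ac_finite KP) n.
- by move=> n y v; exact: F_y.
move=> n v mn vF vy; apply: val_inj => /=.
apply: (sep_coprime QP (p := chi) (n := n)) => //.
  apply: (singular_kills DP (X := zero_sub K)) => y /=.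
  by have /(congr1 val) := vy y.
by move=> j nj; apply/m0P/(leq_trans mn).
Qed.

End OneModule.

Section TwoModules.
Variables (K L : lmodType H).
Hypotheses (KP : adically_complete K) (LP : adically_complete L).

(** m is chosen so that the eigenvalues of eu on L / F n do not occur in F m of K. Split the
    polynomial killing v into q1, with roots among these, and q2 coprime to them: q2(eu) v is killed
    by q1 and lies in F m, so it vanishes. Thus g v is killed by q2, and modulo F n by
    [bounds n]. *)
Lemma E_continuous (g : {linear E K -> L}) n :
  exists m, forall v : E K, F[K] m (sub_val v) -> F[L] n (g v).
Proof.
have [[Q QP] [Q' QP']] := (euler_boundP KP, euler_boundP LP).
have [m mP] := coprime_shift (bounds_neq0 QP' n) QP.1; exists m => v vF.
have [l vl] := E_nilpotent v.
have [q1 [q2 [qE cq2 cq1]]] := split_coprime (bounds_neq0 QP' n) (chis_neq0 D l).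
apply: (coprime_in (G := Fsp L n) _ cq2) => [u|//=|//=]; first exact: F_eu.
  exact: bounds_kill.
rewrite -linear_poly (_ : q2 @@ v = 0) ?linear0; first exact: adic0.
apply: val_inj; apply: (sep_coprime KP QP (p := q1) (n := m)).
- have := nil_kills DP vl; rewrite qE eu_actM => /(congr1 val) /=.
  by [].
- exact: F_peval.
- by move=> j mj; apply/cq1/mP.
Qed.

Lemma extend_map (g : {linear E K -> L}) :
  exists u : {linear K -> L}, forall e : E K, u (sub_val e) = g e.
Proof.
have [m mP] := choice (E_continuous g).
(* The graph of the extension: l is the limit of g along every approximation of v by nilpotent
   vectors. Linearity will follow from uniqueness of l. *)
pose R v l := forall n (e : E K), F[K] (m n) (v - sub_val e) -> F[L] n (l - g e).
have Rfun v : exists l, R v l.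
  (* The moduli m n come from a choice and need not be monotone; their partial sums are, and
     dominate them. *)
  pose M n := (\sum_(i < n.+1) m i)%N.
  have mM n : (m n <= M n)%N by rewrite /M big_ord_recr leq_addl.
  have MM n : (M n <= M n.+1)%N by rewrite [M n.+1]/M big_ord_recr leq_addr.
  have [e eP] := choice (fun n => denseE KP (M n) v).
  have [l lP] : exists l, forall n, F[L] n (l - g (e n)).
    apply: (ac_limit LP) => n; rewrite -linearB; apply: mP.
    apply: adicW (mM n) _; rewrite sub_valB.
    have := spaceB (S := Fsp K (M n)) (eP n) (adicW (MM n) (eP n.+1)).
    by rewrite opprB addrC addrA subrK.
  exists l => n e' ve'; rewrite -(subrK (g (e n)) l) -addrA -linearB.
  apply: adicD => //; apply: mP ; rewrite sub_valB.
  have := spaceB (S := Fsp K (m n)) ve' (adicW (mM n) (eP n)).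
  by rewrite opprB addrC addrA subrK.
have Runiq v l l' : R v l -> R v l' -> l = l'.
  move=> vl vl'; apply/eqP; rewrite -subr_eq0; apply/eqP/(ac_separated LP) => n.
  have [e eP] := denseE KP (m n) v.
  have := spaceB (S := Fsp L n) (vl n e eP) (vl' n e eP).
  by rewrite opprB addrA subrK.
have Rg (e : E K) : R (sub_val e) (g e).
  by move=> n e'; rewrite -linearB => ee'; apply: mP; rewrite sub_valB.
have RD v w l l' : R v l -> R w l' -> R (v + w) (l + l').
  move=> vl wl' n e ee; have [e1 e1P] := denseE KP (m n) v.
  have [e2 e2P] := denseE KP (m n) w.
  apply: (mod_trans (S := Fsp L n) (v := g (e1 + e2))).
    by rewrite linearD; apply: mod_add; [exact: vl|exact: wl'].
  rewrite -linearB; apply: mP; rewrite sub_valB.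
  apply: (mod_trans (S := Fsp K (m n)) _ ee); apply: mod_sym.
  by rewrite [X in _ - X]/= ; apply: mod_add.
(* The action of a costs d steps in K and d' in L, so e' approximates v closely enough for both
   losses. *)
have RZ a v l : R v l -> R (a *: v) (a *: l).
  move=> vl n e ee; have [d dP] := F_act K a; have [d' dP'] := F_act L a.
  have [e' e'P] := denseE KP (m n + d + m (n + d')%N) v.
  apply: (mod_trans (S := Fsp L n) (v := g (a *: e'))).
    rewrite linearZ -scalerBr; apply: dP'; apply: vl; apply: adicW e'P.
    exact: leq_addl.
  rewrite -linearB; apply: mP; rewrite sub_valB.
  apply: (mod_trans (S := Fsp K (m n)) _ ee); apply: mod_sym.
  rewrite /= -scalerBr; apply: dP; apply: adicW e'P; exact: leq_addr.
have [u uR] := choice Rfun.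
have ulin : linear u.
  by move=> a v w; apply: Runiq (uR _) _; apply: RD; [apply: RZ|]; exact: uR.
exists (HB.pack_for {linear K -> L} u (GRing.isLinear.Build _ _ _ _ u ulin)).
by move=> e /=; apply: Runiq (uR _) _; exact: Rg.
Qed.

Lemma extend_unique (f f' : {linear K -> L}) :
  (forall e : E K, f (sub_val e) = f' (sub_val e)) -> f =1 f'.
Proof.
move=> ff' v; apply/eqP; rewrite -subr_eq0; apply/eqP/(ac_separated LP) => n.
have FF (g : {linear K -> L}) u : F[K] n u -> F[L] n (g u).
  apply: adic_map => [u1 u2|a w Ja]; first exact: linearD.
  by exists a => //; exact: linearZ.
have [e eP] := denseE KP n v.
have -> : f v - f' v = f (v - sub_val e) - f' (v - sub_val e).
  by rewrite [f (_ - _)]linearB [f' (_ - _)]linearB ff' opprB addrA subrK.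
by apply: (spaceB (S := Fsp L n)); exact: FF.
Qed.

End TwoModules.

Section CompletionOfO.
Variables (N L : lmodType H) (eta : {linear N -> L}).
Hypotheses (NO : is_O N) (LP : adically_complete L).
Hypothesis eta_dense : forall n l, exists v, F[L] n (l - eta v).
Hypothesis eta_strict : forall v, (forall n, F[L] n (eta v)) -> forall n, F[N] n v.

Lemma completion_inj : injective eta.
Proof.
move=> v v' /eqP; rewrite -subr_eq0 -linearB => /eqP vv'; apply/eqP.
rewrite -subr_eq0; apply/eqP/(O_separated DP).
  by move=> u; apply/nilpotentP/NO.2.
by apply: eta_strict => n; rewrite vv'; exact: adic0.
Qed.

(** Approximate l by eta v, and write the polynomial killing v as q1 q2 with the roots of q1 among
    those of p and q2 coprime to p. The projector (b q2)(eu) fixes l and makes v killed by q1; the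
    difference is then killed by p q1 and too deep to be nonzero. *)
Lemma completion_nilpotent l : nilpotent_vector l -> exists v, l = eta v.
Proof.
move=> /nilpotentP[i /(nil_kills DP)]; set p := chis D i => pl.
have [Q QP] := euler_boundP LP.
have [m mP] := coprime_shift (chis_neq0 D i) QP.1.
have [v vl] := eta_dense m l.
have /nilpotentP[i' /(nil_kills DP) v0] := NO.2 v.
have [q1 [q2 [qE cq2 cq1]]] := split_coprime (chis_neq0 D i) (chis_neq0 D i').
have : coprimep (p * q1) q2 by rewrite coprimepMl cq2 cq1.
case/Bezout_eq1_coprimepP => [[a b] /= ab]; exists ((b * q2) @@ v).
have lE : l = (b * q2) @@ l.
  rewrite -{1}[l]eu_act1 -ab eu_actD [a * _]mulrC -mulrA eu_actM eu_actC.
  by rewrite pl scaler0 add0r.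
apply/eqP; rewrite -subr_eq0 {1}lE linear_poly -scalerBr; apply/eqP.
apply: (sep_coprime LP QP (p := p * q1) (n := m)).
- rewrite -eu_actM scalerBr -linear_poly mulrACA -qE.
  rewrite [X in eta X]eu_actM v0 scaler0 linear0 subr0.
  by rewrite -mulrA eu_actM eu_actC pl scaler0.
- exact: F_peval.
- by move=> j mj; rewrite coprimepMl mP // cq1 // mP.
Qed.

End CompletionOfO.
End AdicallyComplete.

(** * Hilbert's basis theorem *)

Section Noetherian.
Variables (C : fieldType) (B : pzRingType) (k : {rmorphism C -> B}).
Hypothesis mulC : commutative (@GRing.mul B).
Variable M : lmodType B.
Implicit Types (O : B -> Prop) (S V : M -> Prop) (g : seq M).

Inductive ospan O g : M -> Prop :=
  | ospan0 : ospan O g 0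
  | ospan_cons a u v : O a -> u \in g -> ospan O g v -> ospan O g (a *: u + v).

Lemma ospanD O g u v : ospan O g u -> ospan O g v -> ospan O g (u + v).
Proof.
elim=> {u} [|a u w Oa ug _ IHw] vg; first by rewrite add0r.
by rewrite -addrA; apply: ospan_cons => //; exact: IHw.
Qed.

Lemma ospanM O O' g a v : (forall b, O b -> O' (a * b)) -> ospan O g v ->
  ospan O' g (a *: v).
Proof.
move=> Oa; elim=> {v} [|b u v Ob ug _ IHv]; first by rewrite scaler0; exact: ospan0.
by rewrite scalerDr scalerA; apply: ospan_cons => //; exact: Oa.
Qed.

Lemma ospanW O O' g g' v : (forall a, O a -> O' a) -> {subset g <= g'} ->
  ospan O g v -> ospan O' g' v.
Proof.
move=> OO' gg'; elim=> {v} [|b u v Ob ug _ IHv]; first exact: ospan0.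
by apply: ospan_cons; [exact: OO'|exact: gg'|].
Qed.

Record osub O S : Prop := OSub {
  osub0 : S 0;
  osubD : forall u v, S u -> S v -> S (u + v);
  osubM : forall a u, O a -> S u -> S (a *: u)
}.

(** Coefficients are restricted by a predicate O on a fixed ring, so that ring generators are
    adjoined one at a time inside the same ring and module. *)
Definition noetherian O V := forall S, osub O S -> (forall v, S v -> V v) ->
  exists2 g, (forall u, u \in g -> S u) & forall v, S v -> ospan O g v.

Lemma osub_span O S g v : osub O S -> (forall u, u \in g -> S u) -> ospan O g v -> S v.
Proof.
move=> SP gS; elim=> {v} [|a u v Oa ug _ vS]; first exact: osub0 SP.
by apply: (osubD SP) => //; apply: (osubM SP) => //; exact: gS.
Qed.

Inductive adjoin O (x : B) : B -> Prop :=
  | adjoin_in a : O a -> adjoin O x a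
  | adjoin_x : adjoin O x x
  | adjoinD a b : adjoin O x a -> adjoin O x b -> adjoin O x (a + b)
  | adjoinM a b : adjoin O x a -> adjoin O x b -> adjoin O x (a * b).

Section HilbertBasis.
Variables (O : B -> Prop) (V : M -> Prop) (x : B).
Hypotheses (Ok : forall c, O (k c)) (VP : osub O V) (VN : noetherian O V).

(** Polynomials in x of degree less than d with coefficients in V, evaluated in M. *)
Fixpoint below (d : nat) (v : M) : Prop :=
  if d is d'.+1 then exists2 u, V u & below d' (v - x ^+ d' *: u) else v = 0.

Lemma belowD d u v : below d u -> below d v -> below d (u + v).
Proof.
elim: d u v => [|d IHd] u v /= ; first by move=> -> ->; rewrite addr0.
move=> [u' u'V ub] [v' v'V vb]; exists (u' + v'); first exact: (osubD VP).
by rewrite scalerDr opprD addrACA; exact: IHd.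
Qed.

Lemma belowM d a v : O a -> below d v -> below d (a *: v).
Proof.
move=> Oa; elim: d v => [|d IHd] v /=; first by move=> ->; rewrite scaler0.
move=> [u uV vb]; exists (a *: u); first exact: (osubM VP).
by rewrite scalerA mulC -scalerA -scalerBr; exact: IHd.
Qed.

Lemma belowN d v : below d v -> below d (- v).
Proof. by move=> vb; rewrite -scaleN1r -(rmorphN1 k); exact: belowM. Qed.

Lemma belowx d v : below d v -> below d.+1 (x *: v).
Proof.
elim: d v => [|d IHd] v.
  move=> ->; exists 0; first exact: osub0 VP.
  by rewrite !scaler0 subr0.
move=> [u uV /IHd vb]; exists u => //.
by rewrite exprS -scalerA -scalerBr.
Qed.

Lemma belowX n d v : below d v -> below (n + d) (x ^+ n *: v).
Proof.
move=> vb; elim: n => [|n IHn]; first by rewrite scale1r.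
by rewrite exprS -scalerA; exact: belowx.
Qed.

Lemma belowS d v : below d v -> below d.+1 v.
Proof.
move=> vb; exists 0; first exact: osub0 VP.
by rewrite scaler0 subr0.
Qed.

Lemma belowW d d' v : (d <= d')%N -> below d v -> below d' v.
Proof. by move/subnK <-; elim: (d' - d)%N => // n IHn vb; exact/belowS/IHn. Qed.

Definition adjoin_space (v : M) : Prop := exists d, below d v.

Lemma adjoin_osub : osub (adjoin O x) adjoin_space.
Proof.
split=> [|u v [d ud] [e ve]|a u Oa]; first by exists 0%N.
  exists (maxn d e); apply: belowD; first by apply: belowW ud; exact: leq_maxl.
  by apply: belowW ve; exact: leq_maxr.
elim: Oa u => {a} [a Oa||a b _ IHa _ IHb|a b _ IHa _ IHb] u.
- by case=> d ud; exists d; exact: belowM.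
- by case=> d ud; exists d.+1; exact: belowx.
- move=> uS; have [[d aud] [e bue]] := (IHa _ uS, IHb _ uS).
  exists (maxn d e); rewrite scalerDl; apply: belowD.
    by apply: belowW aud; exact: leq_maxl.
  by apply: belowW bue; exact: leq_maxr.
- by move=> uS; rewrite -scalerA; apply: IHa; exact: IHb.
Qed.

(* Hilbert's basis theorem; the powers of x need not be independent over V, *)
(* so the leading coefficients of a vector are not unique.                  *)
Lemma adjoin_noetherian : noetherian (adjoin O x) adjoin_space.
Proof.
move=> S SP SV.
have SO a u : O a -> S u -> S (a *: u).
  by move=> Oa; apply: (osubM SP); exact: adjoin_in.
have Sx n u : S u -> S (x ^+ n *: u).
  move=> uS; elim: n => [|n IHn]; first by rewrite scale1r.
  by rewrite exprS -scalerA; apply: (osubM SP) => //; exact: adjoin_x.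
have SN u : S u -> S (- u) by rewrite -scaleN1r -(rmorphN1 k); exact: SO.
(* Leading coefficients in degree d of elements of S. They grow with d, as S is stable under x, and
   are constant from some d0 on because their union is finitely generated. *)
pose L d u := V u /\ exists2 s, S s & below d (s - x ^+ d *: u).
have LP d : osub O (L d).
  split=> [|u v [uV [s sS sb]] [vV [t tS tb]]|a u Oa [uV [s sS sb]]].
  - split; first exact: osub0 VP.
    exists 0; first exact: osub0 SP.
    rewrite scaler0 subr0; elim: d => //= d IHd.
    by exists 0; [exact: osub0 VP|rewrite scaler0 subr0].
  - split; first exact: (osubD VP).
    exists (s + t); first exact: (osubD SP).
    by rewrite scalerDr opprD addrACA; exact: belowD.
  - split; first exact: (osubM VP).
    exists (a *: s); first exact: SO.
    by rewrite scalerA mulC -scalerA -scalerBr; exact: belowM.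
have LS n d u : L d u -> L (n + d)%N u.
  case=> uV [s sS sb]; split=> //; exists (x ^+ n *: s); first exact: Sx.
  by rewrite exprD -scalerA -scalerBr; exact: belowX.
have LW d d' u : (d <= d')%N -> L d u -> L d' u by move/subnK <-; exact: LS.
have [d0 d0P] : exists d0, forall d u, L d u -> L d0 u.
  have [|u [d [uV _]] //|g gL gS] := VN (S := fun u => exists d, L d u).
    split=> [|u v [d ud] [e ve]|a u Oa [d ud]]; first by exists 0%N; exact: osub0 (LP _).
      exists (maxn d e); apply: (osubD (LP _)).
        by apply: LW ud; exact: leq_maxl.
      by apply: LW ve; exact: leq_maxr.
    by exists d; exact: (osubM (LP _)).
  have [d0 gd0] : exists d0, forall u, u \in g -> L d0 u.
    elim: g {gS} gL => [|u g IHg] gL; first by exists 0%N.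
    have [|d dP] := IHg; first by move=> v vg; apply: gL; rewrite inE vg orbT.
    have [|e eP] := gL u; first exact: mem_head.
    exists (maxn d e) => v; rewrite inE => /predU1P[->|/dP].
      by apply: LW eP; exact: leq_maxr.
    by apply: LW; exact: leq_maxl.
  by exists d0 => d u ud; apply: osub_span (LP d0) gd0 (gS u _); exists d.
have gens n : exists2 g, (forall u, u \in g -> S u) & forall d u, (d < n)%N -> L d u ->
    exists2 s, ospan O g s & below d (s - x ^+ d *: u).
  elim: n => [|n [g gS gP]]; first by exists [::].
  have [g' g'L g'P] := VN (LP n) (fun u => @proj1 _ _).
  have [f fP] : exists f : M -> M, forall u, u \in g' -> S (f u) /\ below n (f u - x ^+ n *: u).
    have fE u : exists s, u \in g' -> S s /\ below n (s - x ^+ n *: u).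
      have [ug'|_] := boolP (u \in g'); last by exists 0.
      by have [_ [s sS sb]] := g'L u ug'; exists s.
    by have [f fP] := choice fE; exists f.
  exists (g ++ map f g') => [u|d u].
    by rewrite mem_cat => /orP[/gS //|/mapP[v /fP[vS _] ->]].
  rewrite ltnS leq_eqVlt => /predU1P[-> /g'P|dn /(gP _ _ dn)[s sg sb]]; last first.
    by exists s => //; apply: ospanW sg => // v vg; rewrite mem_cat vg.
  elim=> {u} [|a u v Oa ug _ [s sg sb]].
    by exists 0; [exact: ospan0|rewrite scaler0 subr0; elim: (n) => //= m IHm; exists 0;
      [exact: osub0 VP|rewrite scaler0 subr0]].
  exists (a *: f u + s).
    by apply: ospan_cons => //; rewrite mem_cat map_f ?orbT.
  rewrite scalerDr opprD addrACA; apply: belowD => //.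
  by rewrite scalerA mulC -scalerA -scalerBr; apply: belowM => //; have [] := fP u ug.
have [g gS gP] := gens d0.+1; exists g => // v vS; have [n vb] := SV v vS.
elim: n v vb vS => [|n IHn] v; first by move=> -> _; exact: ospan0.
case=> u uV vb vS; have uL : L n u by split=> //; exists v.
(* Beyond d0 the leading coefficient already occurs in degree d0; the combination found there is
   multiplied by x^(n - d0). *)
have [s sg sb] : exists2 s, ospan (adjoin O x) g s & below n (s - x ^+ n *: u).
  have [nd|dn] := leqP n d0.
    have [s sg sb] := gP n u nd uL; exists s => //.
    by apply: ospanW sg => // a; exact: adjoin_in.
  have [s sg sb] := gP d0 u (leqnn _) (d0P _ _ uL).
  exists (x ^+ (n - d0) *: s).
    apply: ospanM sg => a Oa; apply: adjoinM; last exact: adjoin_in.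
    elim: (n - d0)%N => [|m IHm]; first by apply: adjoin_in; rewrite expr0 -(rmorph1 k).
    by rewrite exprS; apply: adjoinM => //; exact: adjoin_x.
  by have := belowX (n - d0) sb; rewrite scalerBr scalerA -exprD subnK // ltnW.
rewrite -(subrK s v); apply: ospanD => //; apply: IHn.
  have := belowD vb (belowN sb).
  by rewrite opprB addrA subrK.
apply: (osubD SP) => //; apply: SN.
by apply: osub_span SP gS _; exact: sg.
Qed.

End HilbertBasis.

Lemma noetherian_base (e : seq M) :
  noetherian (fun a => exists c, a = k c) (ospan (fun a => exists c, a = k c) e).
Proof.
move=> S SP SV; pose l (i : 'I_(size e)) := e`_i.
have lc v : ospan (fun a => exists c, a = k c) e v -> exists c, v = lcomb k l c.
  elim=> {v} [|_ u v [a ->] ue _ [c ->]]; first by exists 0; rewrite lcomb0.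
  exists (a *: delta_mx 0 (Ordinal (etrans (index_mem u e) ue)) + c).
  rewrite lcombP; congr (_ *: _ + _).
  rewrite /lcomb (bigD1 (Ordinal (etrans (index_mem u e) ue))) //= big1 => [|i /negPf ie].
    by rewrite mxE !eqxx rmorph1 scale1r addr0 /l /= nth_index.
  by rewrite mxE ie andbF rmorph0 scale0r.
have PD c d : S (lcomb k l c) -> S (lcomb k l d) -> S (lcomb k l (c + d)).
  by move=> cS dS; rewrite -[c]scale1r lcombP rmorph1 scale1r; exact: (osubD SP).
have PZ a c : S (lcomb k l c) -> S (lcomb k l (a *: c)).
  move=> cS; rewrite -[_ *: c]addr0 lcombP lcomb0 addr0; apply: (osubM SP) => //.
  by exists a.
pose P : submodule ('rV[C]_(size e)) := @Submodule _ _ (fun c => S (lcomb k l c))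
  (eq_ind_r S (osub0 SP) (lcomb0 k l)) PD PZ.
have [X XP] := subspace_mx P; exists [seq lcomb k l (row i X) | i : 'I_(size e)].
  by move=> u /mapP[i _ uE]; rewrite uE; exact: (XP _).2 (row_sub i X).
move=> v vS; have [c vc] := lc v (SV v vS).
have /XP/submxP[d cE] : P c by rewrite /= -vc.
rewrite vc cE mulmx_sum_row; elim/big_rec: _ => [|i u _ IHu].
  by rewrite lcomb0; exact: ospan0.
rewrite lcombP; apply: ospan_cons => //; first by exists (d 0 i).
by apply: map_f; rewrite mem_enum.
Qed.

Lemma noetherian_adjoin (xs : seq B) (e : seq M) : exists O V,
  [/\ osub O V, noetherian O V, forall c, O (k c), forall x, x \in xs -> O x &
      [/\ forall u, u \in e -> V u, forall a b, O a -> O b -> O (a + b) &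
      forall a b, O a -> O b -> O (a * b)]].
Proof.
elim: xs => [|x xs [O [V [VP VN Ok Oxs [Ve OD OM]]]]].
  pose O a := exists c, a = k c; exists O, (ospan O e); split=> //.
  - split; [exact: ospan0|by move=> u v; exact: ospanD|].
    move=> _ u [c ->]; apply: ospanM => _ [d ->]; exists (c * d); exact/esym/rmorphM.
  - exact: noetherian_base.
  - by move=> c; exists c.
  - split=> [u ue|_ _ [c ->] [d ->]|_ _ [c ->] [d ->]].
    + rewrite -[u]scale1r -[1 *: u]addr0; apply: ospan_cons => //; last exact: ospan0.
      by exists 1; rewrite rmorph1.
    + by exists (c + d); rewrite rmorphD.
    + by exists (c * d); rewrite rmorphM.
exists (adjoin O x), (adjoin_space V x); split.
- exact: adjoin_osub.
- exact: adjoin_noetherian.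
- by move=> c; apply: adjoin_in.
- move=> y; rewrite inE => /predU1P[->|/Oxs ?]; first exact: adjoin_x.
  exact: adjoin_in.
- split=> [u ue|a b|a b]; last 2 first.
  + exact: adjoinD.
  + exact: adjoinM.
  exists 1%N; exists u; first exact: Ve.
  by rewrite /= scale1r subrr.
Qed.

End Noetherian.

(** * The coordinate ring and its invariants *)

Section CoordinateRing.
Variables (C : numClosedFieldType) (h : vectType C).

Local Notation k := (pcst (@poly_rel C h) : {rmorphism C -> coord_ring h}).

Lemma coord_commute (x : 'Hom(h, C^o)) (p : coord_ring h) :
  coordf x * p = p * coordf x.
Proof.
elim/palg_ind: p => [c|x'|p q IHp IHq|p q IHp IHq].
- by rewrite -pcstC.
- exact: (poly_relE (poly_comm x x')).
- by rewrite mulrDl mulrDr IHp IHq.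
- by rewrite mulrA IHp -!mulrA IHq.
Qed.

Lemma coord_mulC : commutative (@GRing.mul (coord_ring h)).
Proof.
move=> p q; elim/palg_ind: p => [c|x|p1 p2 IH1 IH2|p1 p2 IH1 IH2].
- exact: pcstC.
- exact: coord_commute.
- by rewrite mulrDl mulrDr IH1 IH2.
- by rewrite -mulrA IH2 mulrA IH1 -mulrA.
Qed.

Lemma coord_one_neq0 : 1 != 0 :> coord_ring h.
Proof.
apply/eqP => /(congr1 (poly_eval 0)); rewrite rmorph1 rmorph0.
by move/eqP; rewrite oner_eq0.
Qed.

(* coord_ring h is only a pzRingType; polynomials need a nontrivial ring. *)
Definition cring : Type := coord_ring h.
HB.instance Definition _ := GRing.PzRing.copy cring (coord_ring h).
HB.instance Definition _ := GRing.PzRing_hasCommutativeMul.Build cring coord_mulC.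
HB.instance Definition _ := GRing.PzSemiRing_isNonZero.Build cring coord_one_neq0.

Lemma coordf_lin a x x' : coordf (a *: x + x') = k a * coordf x + coordf x' :> coord_ring h.
Proof. exact: (poly_relE (poly_lin a x x')). Qed.

Lemma coordf0 : coordf 0 = 0 :> coord_ring h.
Proof.
have := coordf_lin 1 0 0; rewrite scaler0 addr0 rmorph1 mul1r => /eqP.
by rewrite eq_sym -subr_eq0 addrK => /eqP.
Qed.

Lemma coordf_sum (I : Type) (r : seq I) (P : pred I) c (F : I -> 'Hom(h, C^o)) :
  coordf (\sum_(i <- r | P i) c i *: F i) = \sum_(i <- r | P i) k (c i) * coordf (F i).
Proof.
elim/big_rec2: _ => [|i y1 y2 _ <-]; [exact: coordf0|exact: coordf_lin].
Qed.

Lemma coordf_cobas x : coordf x = \sum_i k (x (bas i)) * coordf (cobas i) :> coord_ring h.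
Proof. by rewrite {1}(form_cobas x) coordf_sum. Qed.

Lemma coord_noetherian (M : lmodType (coord_ring h)) (e : seq M) (S : M -> Prop) :
  (forall v, ospan (fun=> True) e v) -> osub (fun=> True) S ->
  exists2 g, (forall u, u \in g -> S u) & forall v, S v -> ospan (fun=> True) g v.
Proof.
move=> eM SP; have [O [V [VP VN Ok Ox [eV OD OM]]]] :=
  noetherian_adjoin k coord_mulC
    [seq coordf (cobas i) | i <- enum 'I_(\dim (fullv : {vspace h}))] e.
have OT p : O p.
  elim/palg_ind: p => [c|x|p q Op Oq|p q Op Oq]; [exact: Ok| |exact: OD|exact: OM].
  rewrite -/(coordf x) coordf_cobas; elim/big_ind: _ => [|a b|i _].
  - by rewrite -(rmorph0 k).
  - exact: OD.
  - by apply: OM => //; apply: Ox; apply/mapP; exists i; rewrite ?mem_enum.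
have VT v : V v.
  by apply: (osub_span VP eV); apply: ospanW (eM v).
have [|v _ //|g gS gP] := VN S; first by split=> [|u v|a u _];
  [exact: osub0 SP|exact: (osubD SP)|exact: (osubM SP)].
by exists g => // v /gP; apply: ospanW.
Qed.

(** * Invariant polynomials *)

Section Invariants.
Variables (W : finGroupType) (D : cherednik_data h W).
Hypothesis DP : is_cherednik_data D.

Local Notation A := (invariant D).
Local Notation incl := (inv_incl D).

Lemma poly_act_gen w x : poly_act D w (coordf x) = coordf (dact D w x).
Proof. exact: plift_gen. Qed.
Lemma poly_act_cst w c : poly_act D w (k c) = k c.
Proof. exact: plift_cst. Qed.
Lemma poly_eval_gen b x : poly_eval b (coordf x : coord_ring h) = x b.
Proof. exact: plift_gen. Qed.
Lemma poly_eval_cst b c : poly_eval b (k c) = c.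
Proof. exact: plift_cst. Qed.

Lemma dactM u w x : dact D (u * w)%g x = dact D u (dact D w x).
Proof. by rewrite /dact invMg (rhoM DP) comp_lfunA. Qed.

Lemma dact1 x : dact D 1%g x = x.
Proof. by rewrite /dact invg1 (rho1 DP) comp_lfun1r. Qed.

Lemma poly_actM u w p : poly_act D (u * w)%g p = poly_act D u (poly_act D w p).
Proof.
elim/palg_ind: p => [c|x|p q IHp IHq|p q IHp IHq].
- by rewrite !poly_act_cst.
- by rewrite !poly_act_gen dactM.
- by rewrite !rmorphD IHp IHq.
- by rewrite !rmorphM IHp IHq.
Qed.

Lemma incl_inj : injective incl.
Proof. exact: val_inj. Qed.

Lemma inv_act w (a : A) : poly_act D w (incl a) = incl a.
Proof. by case: a => a /= /asboolP; exact. Qed.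

Lemma inv_mulC : commutative (@GRing.mul A).
Proof. by move=> a b; apply: incl_inj; rewrite !rmorphM coord_mulC. Qed.

Definition orbit_sum (p : coord_ring h) : coord_ring h := \sum_w poly_act D w p.

Lemma orbit_sum_inv p : is_invariant D (k (#|W|%:R^-1) * orbit_sum p).
Proof.
apply/asboolP => u; rewrite rmorphM poly_act_cst rmorph_sum; congr (_ * _).
rewrite /orbit_sum [RHS](reindex_inj (mulgI u)).
by apply: eq_bigr => w _; rewrite poly_actM.
Qed.

Definition reynolds (p : coord_ring h) : A := Invariant (orbit_sum_inv p).

Lemma reynoldsD p q : reynolds (p + q) = reynolds p + reynolds q.
Proof.
apply: incl_inj; rewrite rmorphD /= /reynolds /= -mulrDr -big_split /=.
by congr (_ * _); apply: eq_bigr => w _; rewrite rmorphD.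
Qed.

Lemma reynolds0 : reynolds 0 = 0.
Proof. by apply: (addIr (reynolds 0)); rewrite -reynoldsD !add0r. Qed.

Lemma reynoldsM p a : reynolds (p * incl a) = reynolds p * a.
Proof.
apply: incl_inj; rewrite rmorphM /= -mulrA; congr (_ * _).
rewrite /orbit_sum mulr_suml; apply: eq_bigr => w _.
by rewrite rmorphM; congr (_ * _); exact: inv_act.
Qed.

Lemma reynolds_incl a : reynolds (incl a) = a.
Proof.
apply: incl_inj => /=; rewrite /orbit_sum (eq_bigr (fun=> incl a)) => [|w _].
  rewrite sumr_const -[X in _ * X]mulr_natl mulrA -(rmorph_nat k) -rmorphM mulVf.
    by rewrite rmorph1 mul1r.
  by rewrite pnatr_eq0 -lt0n; apply/card_gt0P; exists 1%g.
exact: inv_act.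
Qed.

(** Hilbert's argument: the C[h]-span of T is finitely generated, by elements that may be taken in
    T, and the Reynolds operator turns a C[h]-combination of them into one with invariant
    coefficients. *)
Lemma invariant_noetherian n (T : 'rV[A]_n -> Prop) : osub (fun=> True) T ->
  exists2 g, (forall u, u \in g -> T u) & forall v, T v -> ospan (fun=> True) g v.
Proof.
move=> TP; pose emb (v : 'rV[A]_n) : 'rV[coord_ring h]_n := map_mx incl v.
pose S v := exists2 g, (forall u, u \in g -> T u) & ospan (fun=> True) [seq emb t | t <- g] v.
have Sadd u v : S u -> S v -> S (u + v).
  move=> [g gT ug] [g' gT' vg']; exists (g ++ g') => [t|].
    by rewrite mem_cat => /orP[/gT|/gT'].
  apply: ospanD; [apply: ospanW ug|apply: ospanW vg'] => // t;
    by rewrite map_cat mem_cat => ->; rewrite ?orbT.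
have SP : osub (fun=> True) S.
  split=> //; first by exists [::] => //; exact: ospan0.
  by move=> a u _ [g gT ug]; exists g => //; apply: ospanM ug.
have [|g gS gP] := @coord_noetherian _ [seq delta_mx 0 i | i <- enum 'I_n] _ _ SP.
  move=> v; rewrite [v]row_sum_delta; elim/big_ind: _ => [|u u'|i _].
  - exact: ospan0.
  - exact: ospanD.
  - rewrite -[_ *: _]addr0; apply: ospan_cons => //; last exact: ospan0.
    by rewrite map_f // mem_enum.
have [g' gT' gg'] : exists2 g', (forall u, u \in g' -> T u) &
    forall v, v \in g -> ospan (fun=> True) [seq emb t | t <- g'] v.
  elim: g {gP} gS => [|v g IHg] gS; first by exists [::].
  have [|g1 g1T g1P] := IHg; first by move=> u ug; apply: gS; rewrite inE ug orbT.
  have [|g2 g2T g2P] := gS v; first exact: mem_head.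
  exists (g1 ++ g2) => [t|u]; first by rewrite mem_cat => /orP[/g1T|/g2T].
  rewrite inE => /predU1P[->|/g1P ug]; [apply: ospanW g2P|apply: ospanW ug] => // t;
    by rewrite map_cat mem_cat => ->; rewrite ?orbT.
exists g' => // t tT.
have : ospan (fun=> True) [seq emb t | t <- g'] (emb t).
  have /gP : S (emb t).
    exists [:: t]; first by move=> u; rewrite inE => /eqP ->.
    rewrite -[emb t]scale1r -[1 *: _]addr0; apply: ospan_cons => //; last exact: ospan0.
    exact: mem_head.
  move=> tg; apply: osub_span tg; last exact: gg'.
  by split=> [|u v|a u _ ug]; [exact: ospan0|exact: ospanD|apply: ospanM ug].
have tE : t = map_mx reynolds (emb t) by apply/rowP => i; rewrite !mxE reynolds_incl.
rewrite [X in _ -> ospan _ _ X]tE; move: (emb t) => v.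
elim=> {v} [|c _ v _ /mapP[u ug' ->] _ IHv].
  suff -> : map_mx reynolds (0 : 'rV_n) = 0 by exact: ospan0.
  by apply/rowP => i; rewrite !mxE reynolds0.
suff -> : map_mx reynolds (c *: emb u + v) = reynolds c *: u + map_mx reynolds v.
  by apply: ospan_cons.
by apply/rowP => i; rewrite !mxE reynoldsD reynoldsM.
Qed.

Definition orbit_poly (x : 'Hom(h, C^o)) : {poly cring} :=
  \prod_w ('X - (coordf (dact D w x) : cring)%:P).

Lemma orbit_poly_inv x i : is_invariant D (orbit_poly x)`_i.
Proof.
apply/asboolP => u; pose f : {rmorphism cring -> cring} := poly_act D u.
rewrite -[LHS](coef_map f); suff -> : map_poly f (orbit_poly x) = orbit_poly x by [].
rewrite /orbit_poly rmorph_prod [RHS](reindex_inj (mulgI u)); apply: eq_bigr => w _.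
by rewrite rmorphB /= map_polyX map_polyC /= poly_act_gen dactM.
Qed.

Definition orbit_coef x i : A := Invariant (orbit_poly_inv x i).

Lemma orbit_poly_root x : \sum_(i < #|W|.+1) incl (orbit_coef x i) * coordf x ^+ i = 0.
Proof.
have sz : size (orbit_poly x) = #|W|.+1 by rewrite size_prod_XsubC /index_enum -enumT -cardE.
transitivity (orbit_poly x).[(coordf x : cring)].
  by rewrite horner_coef sz.
rewrite /orbit_poly horner_prod (bigD1 1%g) //= hornerXsubC dact1 subrr.
exact: mul0r.
Qed.

Lemma orbit_poly_lead x : incl (orbit_coef x #|W|) = 1.
Proof.
have sz : size (orbit_poly x) = #|W|.+1 by rewrite size_prod_XsubC /index_enum -enumT -cardE.
have /monicP := monic_prod_XsubC (index_enum W) xpredT (fun w => coordf (dact D w x) : cring).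
by rewrite lead_coefE -/(orbit_poly x) sz.
Qed.

Lemma power_reduction x m : (m <= #|W|)%N -> exists a : 'I_#|W| -> A,
  coordf x ^+ m = \sum_i incl (a i) * coordf x ^+ i.
Proof.
rewrite leq_eqVlt => /predU1P[->|mW].
  exists (fun i : 'I_#|W| => - orbit_coef x i).
  have /eqP := orbit_poly_root x; rewrite big_ord_recr orbit_poly_lead mul1r /=.
  rewrite addrC addr_eq0 => /eqP ->; rewrite -sumrN; apply: eq_bigr => i _.
  by rewrite mulNr.
exists (fun i => (i == Ordinal mW)%:R).
rewrite (bigD1 (Ordinal mW)) //= eqxx rmorph1 mul1r big1 ?addr0 // => i /negPf ->.
by rewrite rmorph0 mul0r.
Qed.

(** The monomials with all exponents below |W| suffice, because x is a root of its orbit polynomial,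
    monic of degree |W| with invariant coefficients. *)
Lemma coord_finite : exists n (q : 'I_n -> coord_ring h),
  forall p, exists a : 'I_n -> A, p = \sum_i incl (a i) * q i.
Proof.
set dim := \dim (fullv : {vspace h}).
pose q (e : {ffun 'I_dim -> 'I_#|W|}) : cring := \prod_i (coordf (cobas i) : cring) ^+ e i.
pose T (p : coord_ring h) := exists a : {ffun 'I_dim -> 'I_#|W|} -> A,
  p = \sum_e incl (a e) * q e.
have TD p p' : T p -> T p' -> T (p + p').
  move=> [a ->] [a' ->]; exists (fun e => a e + a' e); rewrite -big_split.
  by apply: eq_bigr => e _; rewrite rmorphD mulrDl.
have TM c p : T p -> T (incl c * p).
  move=> [a ->]; exists (fun e => c * a e); rewrite mulr_sumr.
  by apply: eq_bigr => e _; rewrite rmorphM mulrA.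
have T0 : T 0 by exists (fun=> 0); rewrite big1 // => e _; rewrite rmorph0 mul0r.
have Tk c p : T p -> T (k c * p).
  have kA : is_invariant D (k c) by apply/asboolP => w; exact: poly_act_cst.
  exact: (TM (Invariant kA)).
have Tq e : T (q e).
  exists (fun e' => (e' == e)%:R); rewrite (bigD1 e) //= eqxx rmorph1 mul1r big1 ?addr0 //.
  by move=> e' /negPf ->; rewrite rmorph0 mul0r.
have Tx i p : T p -> T (coordf (cobas i) * p).
  move=> [a ->]; rewrite mulr_sumr; apply: (big_ind T) => // e _.
  rewrite mulrA [_ * incl _]coord_mulC -mulrA; apply: (TM).
  have [c cE] := @power_reduction (cobas i) (e i).+1 (ltn_ord _).
  have -> : coordf (cobas i) * q e =
      \sum_l incl (c l) * q [ffun j => if j == i then l else e j].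
    rewrite /q (bigD1 i) //= mulrA -[_ * _ ^+ _]exprS [X in X * _]cE mulr_suml.
    apply: eq_bigr => l _; rewrite -mulrA; congr (_ * _).
    rewrite [RHS](bigD1 i) //= ffunE eqxx; congr (_ * _).
    by apply: eq_bigr => j /negPf ji; rewrite ffunE ji.
  by apply: (big_ind T) => // l _; exact: (TM _ _ (Tq _)).
have T1 : T 1.
  have W0 : (0 < #|W|)%N by apply/card_gt0P; exists 1%g.
  suff -> : 1 = q [ffun=> Ordinal W0] by exact: Tq.
  by rewrite /q big1 // => i _; rewrite ffunE.
have Tall p p' : T p' -> T (p * p').
  elim/palg_ind: p p' => [c|x|p1 p2 IH1 IH2|p1 p2 IH1 IH2] p' Tp'.
  - exact: Tk.
  - rewrite -/(coordf x) coordf_cobas mulr_suml; apply: (big_ind T) => // i _.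
    by rewrite -mulrA; apply: Tk; exact: Tx.
  - by rewrite mulrDl; apply: TD; [exact: IH1|exact: IH2].
  - by rewrite -mulrA; apply: IH1; exact: IH2.
exists #|{ffun 'I_dim -> 'I_#|W|}|, (fun i => q (enum_val i)) => p.
have [a pE] := Tall p 1 T1; exists (fun i => a (enum_val i)).
rewrite -[p]mulr1 pE.
exact: (big_enum_val (A := {ffun 'I_dim -> 'I_#|W|}) (fun e => incl (a e) * q e)).
Qed.

(** Subtract the relation that x satisfies from the same polynomial with its coefficients replaced
    by their values at b: the differences of coefficients are invariants vanishing at b. *)
Lemma shifted_orbit_relation b x : exists m : 'I_#|W|.+1 -> A,
  (forall i, max_ideal D b (m i)) /\
  \prod_w (coordf x - k (dact D w x b)) = \sum_i incl (m i) * coordf x ^+ i.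
Proof.
have kA c : is_invariant D (k c) by apply/asboolP => w; exact: poly_act_cst.
exists (fun i : 'I_#|W|.+1 => Invariant (kA (poly_eval b (incl (orbit_coef x i))))
  - orbit_coef x i).
split=> [i|]; first by rewrite /= !rmorphB /= poly_eval_cst subrr.
pose f : {rmorphism cring -> cring} := k \o (poly_eval b : {rmorphism cring -> C}).
pose P : {poly cring} := \prod_w ('X - (k (dact D w x b) : cring)%:P).
have PE : P = map_poly f (orbit_poly x).
  rewrite /orbit_poly rmorph_prod; apply: eq_bigr => w _.
  by rewrite rmorphB /= map_polyX map_polyC /= poly_eval_gen.
have sz : size P = #|W|.+1 by rewrite size_prod_XsubC /index_enum -enumT -cardE.
transitivity (P.[(coordf x : cring)]).
  rewrite /P horner_prod; apply: eq_bigr => w _.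
  by rewrite hornerXsubC.
rewrite horner_coef sz; under [RHS]eq_bigr => i _ do rewrite rmorphB mulrBl.
rewrite sumrB orbit_poly_root subr0; apply: eq_bigr => i _.
by rewrite PE coef_map.
Qed.

(** p is the norm of x + c, the product over its W-orbit, with value c^|W| at 0. *)
Lemma shifted_form_divides c x : c != 0 -> exists (p : A) (q : coord_ring h),
  incl p = (coordf x + k c) * q /\ poly_eval 0 (incl p) != 0.
Proof.
move=> c0; pose P : cring := \prod_w (coordf (dact D w x) + k c : cring).
have Pinv : is_invariant D P.
  apply/asboolP => u; pose f : {rmorphism cring -> cring} := poly_act D u.
  rewrite -[LHS]/(f P) /P rmorph_prod [RHS](reindex_inj (mulgI u)).
  by apply: eq_bigr => w _; rewrite rmorphD /= poly_act_gen poly_act_cst dactM.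
exists (Invariant Pinv), (\prod_(w | w != 1%g) (coordf (dact D w x) + k c : cring)).
split; first by rewrite /= /P (bigD1 1%g) //= dact1.
pose f : {rmorphism cring -> C} := poly_eval 0.
rewrite -[X in X != 0]/(f P) /P rmorph_prod; apply/prodf_neq0 => w _.
by rewrite rmorphD /= poly_eval_gen poly_eval_cst linear0 add0r.
Qed.

End Invariants.

End CoordinateRing.

(** * Completions of modules over a noetherian ring *)

Lemma ospan_sum (B : pzRingType) (M : lmodType B) (g : seq M) v :
  ospan (fun=> True) g v -> exists a : 'I_(size g) -> B, v = \sum_i a i *: g`_i.
Proof.
elim=> {v} [|a u v _ ug _ [c ->]].
  by exists (fun=> 0); rewrite big1 // => i _; rewrite scale0r.
pose i0 := Ordinal (etrans (index_mem u g) ug).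
exists (fun i => (if i == i0 then a else 0) + c i).
under [RHS]eq_bigr => i _ do rewrite scalerDl.
rewrite big_split /=; congr (_ + _).
rewrite (bigD1 i0) //= eqxx nth_index // big1 ?addr0 // => i /negPf ->.
exact: scale0r.
Qed.

Section PowersOfAnIdeal.
Variables (A : pzRingType) (m : ideal A).
Hypothesis mulC : commutative (@GRing.mul A).
Implicit Types (n : nat) (a : A) (f : adic_completion m).

Lemma ipowB n a b : ideal_pow m n a -> ideal_pow m n b -> ideal_pow m n (a - b).
Proof. by move=> aI bI; apply: ipowD => //; exact: (idealN (I := ipow m n)). Qed.

Lemma ipow_sum n (I : Type) (r : seq I) (P : pred I) (F : I -> A) :
  (forall i, P i -> ideal_pow m n (F i)) -> ideal_pow m n (\sum_(i <- r | P i) F i).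
Proof. by move=> FS; elim/big_ind: _ => //; [exact: ipow0|exact: ipowD]. Qed.

Lemma ipowS n a : ideal_pow m n.+1 a -> ideal_pow m n a.
Proof.
elim: n a => [|n IHn] a; first by move=> _; exact: ipow_all.
move En : n.+2 => n2 aI; elim: aI En => {n2 a} [a //|j _|j a b _ IHa _ IHb jn|].
- exact: ipow0.
- by apply: ipowD; [exact: IHa|exact: IHb].
- by move=> j a b ma bj _ [jn]; apply: ipowM => //; apply: IHn; rewrite jn.
Qed.

Lemma ipowW n n' a : (n <= n')%N -> ideal_pow m n' a -> ideal_pow m n a.
Proof. by move/subnK <-; elim: (n' - n)%N => // j IHj /ipowS. Qed.

Lemma ipow_trans n b a c : ideal_pow m n (a - b) -> ideal_pow m n (b - c) -> ideal_pow m n (a - c).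
Proof. by move=> ab bc; rewrite -(subrK b a) -addrA; exact: ipowD. Qed.

Lemma ipow_sym n a b : ideal_pow m n (a - b) -> ideal_pow m n (b - a).
Proof. by move=> ab; rewrite -opprB; exact: (idealN (I := ipow m n)). Qed.

(** Taken from a chosen representative, hence meaningful, additive and multiplicative only modulo
    m^n. *)
Definition truncation n f : A := (qrepr f : compatible m) n.

Lemma compatibleP (u : compatible m) n : ideal_pow m n (u n.+1 - u n).
Proof. by case: u => u /= /asboolP. Qed.

Lemma compatible_le (u : compatible m) n n' : (n <= n')%N -> ideal_pow m n (u n' - u n).
Proof.
move/subnK <-; elim: (n' - n)%N => [|j IHj]; first by rewrite subrr; exact: ipow0.
apply: ipow_trans IHj; apply: (ipowW (n' := (j + n)%N)); first exact: leq_addl.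
exact: compatibleP.
Qed.

Lemma truncation_proj n (u : compatible m) :
  ideal_pow m n (truncation n (rproj (null_seq m) u) - u n).
Proof. exact: (rquotP (null_seq m) _ u).1 (qreprK _) n. Qed.

Lemma truncationE f : rproj (null_seq m) (qrepr f) = f.
Proof. exact: qreprK. Qed.

Lemma truncationD n f g :
  ideal_pow m n (truncation n (f + g) - (truncation n f + truncation n g)).
Proof.
rewrite -{1}(truncationE f) -{1}(truncationE g) -rmorphD.
exact: truncation_proj.
Qed.

Lemma truncationM n f g :
  ideal_pow m n (truncation n (f * g) - truncation n f * truncation n g).
Proof.
rewrite -{1}(truncationE f) -{1}(truncationE g) -rmorphM.
exact: truncation_proj.
Qed.

Definition approx n f a : Prop := ideal_pow m n (truncation n f - a).

Lemma approx_refl n f : approx n f (truncation n f).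
Proof. by rewrite /approx subrr; exact: ipow0. Qed.

Lemma approxD n f g a b : approx n f a -> approx n g b -> approx n (f + g) (a + b).
Proof.
move=> fa gb; apply: ipow_trans (truncationD n f g) _.
by rewrite opprD addrACA; exact: ipowD.
Qed.

Lemma approxM n f g a b : approx n f a -> approx n g b -> approx n (f * g) (a * b).
Proof.
move=> fa gb; apply: ipow_trans (truncationM n f g) _.
apply: (ipow_trans (b := a * truncation n g)).
  by rewrite -mulrBl; exact: ipowMr.
by rewrite -mulrBr; exact: ipowMl.
Qed.

Lemma approx_cst n a : approx n (to_completion m a) a.
Proof. exact: truncation_proj. Qed.

Lemma approx_sum n (I : Type) (r : seq I) (P : pred I) (F : I -> adic_completion m) G :
  (forall i, P i -> approx n (F i) (G i)) ->
  approx n (\sum_(i <- r | P i) F i) (\sum_(i <- r | P i) G i).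
Proof.
move=> FG; elim/big_ind2: _ => //; last by move=> *; exact: approxD.
by have := approx_cst n 0; rewrite rmorph0.
Qed.

Lemma approxB n f g a b : approx n f a -> approx n g b -> approx n (f - g) (a - b).
Proof.
move=> fa gb; apply: approxD fa _.
have := approxM (approx_cst n (-1)) gb.
by rewrite rmorphN1 !mulN1r.
Qed.

Lemma approx_mod n f a b : approx n f a -> ideal_pow m n (a - b) -> approx n f b.
Proof. exact: ipow_trans. Qed.

Lemma truncation_le n n' f : (n <= n')%N ->
  ideal_pow m n (truncation n' f - truncation n f).
Proof. exact: compatible_le. Qed.

Lemma completion_eq f g : (forall n, ideal_pow m n (truncation n f - truncation n g)) -> f = g.
Proof.
move=> fg; rewrite -(truncationE f) -(truncationE g).
exact: (rquotP (null_seq m) (qrepr f) (qrepr g)).2 fg.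
Qed.

Lemma completion_limit (u : nat -> A) : (forall n, ideal_pow m n (u n.+1 - u n)) ->
  exists f, forall n, approx n f (u n).
Proof.
move=> uP; have uC : is_compatible m u by apply/asboolP.
by exists (rproj (null_seq m) (Compatible uC)) => n; exact: truncation_proj.
Qed.

Lemma ideal_pow_gen s (p : 'I_s -> A) n :
  (forall a, ideal_pow m n a -> exists c, a = \sum_i c i * p i) ->
  forall j a, ideal_pow m (j + n) a ->
    exists2 c, (forall i, ideal_pow m j (c i)) & a = \sum_i c i * p i.
Proof.
move=> gen; elim=> [|j IHj] a.
  by move=> /gen[c ->]; exists c => // i; exact: ipow_all.
rewrite addSn; move En : (j + n).+1 => n' aI; elim: aI En => {n' a}
  [a //|n' _|n' a b _ IHa _ IHb n'E|n' a b ma bI _ [n'E]].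
- by exists (fun=> 0) => [i|]; [exact: ipow0|rewrite big1 // => i _; rewrite mul0r].
- have [[c cI ->] [d dI ->]] := (IHa n'E, IHb n'E).
  exists (fun i => c i + d i) => [i|]; first exact: ipowD.
  by rewrite -big_split; apply: eq_bigr => i _; rewrite mulrDl.
- have [|c cI ->] := IHj b; first by rewrite n'E.
  exists (fun i => a * c i) => [i|]; first exact: ipowM.
  by rewrite mulr_sumr; apply: eq_bigr => i _; rewrite mulrA.
Qed.

(* Sum the series of the successive differences. *)
Lemma truncation_gen s (p : 'I_s -> A) n f :
  (forall a, ideal_pow m n a -> exists c, a = \sum_i c i * p i) ->
  ideal_pow m n (truncation n f) ->
  exists g : 'I_s -> adic_completion m, f = \sum_i g i * to_completion m (p i).
Proof.
move=> gen fI; have [c0 c0E] := gen _ fI.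
have step j : exists c : 'I_s -> A, (forall i, ideal_pow m j (c i)) /\
    truncation (j + n).+1 f - truncation (j + n) f = \sum_i c i * p i.
  have [|c cI cE] := ideal_pow_gen gen (j := j)
    (a := truncation (j + n).+1 f - truncation (j + n) f).
    exact: compatibleP.
  by exists c.
have [c cP] := choice step.
have gE i : exists f', forall j, approx j f' (c0 i + \sum_(l < j) c l i).
  apply: completion_limit => j.
  by rewrite big_ord_recr /= addrA [_ + c j i]addrC addrK; apply: (cP j).1.
have [g gP] := choice gE; exists g; apply: completion_eq => j.
have fE : truncation (j + n) f = \sum_i (c0 i + \sum_(l < j) c l i) * p i.
  elim: j => [|j IHj].
    by rewrite add0n c0E; apply: eq_bigr => i _; rewrite big_ord0 addr0.
  rewrite addSn -(subrK (truncation (j + n) f) (truncation _ _)) (cP j).2 IHj -big_split.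
  by apply: eq_bigr => i _; rewrite big_ord_recr /= -mulrDl [c j i + _]addrC addrA.
apply: (ipow_trans (b := truncation (j + n) f)).
  by apply/ipow_sym/truncation_le/leq_addr.
rewrite fE; apply: ipow_sym; apply: approx_sum => i _.
by apply: approxM; [exact: gP|exact: approx_cst].
Qed.

End PowersOfAnIdeal.

Section CompletedModule.
Variables (C : fieldType) (A : pzRingType) (k : {rmorphism C -> A}) (m : ideal A).
Hypothesis mulC : commutative (@GRing.mul A).
Hypothesis residue : forall a, exists c, m (a - k c).
Hypothesis noeth : forall n (T : 'rV[A]_n -> Prop), osub (fun=> True) T ->
  exists2 g, (forall u, u \in g -> T u) & forall v, T v -> ospan (fun=> True) g v.
Implicit Types (n : nat) (a : A).

Let kC : central_scalars k. Proof. by move=> c a; exact: mulC. Qed.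

Lemma ideal_pow_fg n : exists s (p : 'I_s -> A), (forall i, ideal_pow m n (p i)) /\
  forall a, ideal_pow m n a -> exists c, a = \sum_i c i * p i.
Proof.
pose T (v : 'rV[A]_1) := ideal_pow m n (v 0 0).
have TP : osub (fun=> True) T.
  rewrite /T; split=> [|u v uI vI|a u _ uI]; rewrite mxE.
  - exact: ipow0.
  - exact: ipowD.
  - exact: ipowMl.
have [g gT gP] := noeth TP.
exists (size g), (fun i => g`_i 0 0); split=> [i|a aI].
  by apply: gT; exact: mem_nth.
have /gP/ospan_sum[c cE] : T (const_mx a) by rewrite /T mxE.
exists c; have /(congr1 (fun v : 'rV_1 => v 0 0)) := cE.
by rewrite mxE summxE => ->; apply: eq_bigr => i _; rewrite mxE.
Qed.

Section FinitelyGenerated.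
Variables (M : lmodType A) (r : nat) (e : 'I_r -> M).
Hypothesis eM : forall v, exists a : 'I_r -> A, v = \sum_i a i *: e i.

Local Notation "'I[' N ]" := (@adic A N m).

Lemma adic_ipow (N : lmodType A) n a (v : N) : ideal_pow m n a -> I[N] n (a *: v).
Proof.
move=> aI; elim: aI v => {n a} [a|n|n a b _ IHa _ IHb|n a b ma _ IHb] v.
- exact: adic_all.
- by rewrite scale0r; exact: adic0.
- by rewrite scalerDl; apply: adicD.
- by rewrite -scalerA; apply: adicM.
Qed.

Lemma adicE n v : I[M] n v ->
  exists2 a : 'I_r -> A, (forall i, ideal_pow m n (a i)) & v = \sum_i a i *: e i.
Proof.
elim=> {n v} [v|n|n u v _ [a aI ->] _ [b bI ->]|n c v mc _ [a aI ->]].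
- by have [a ->] := eM v; exists a => // i; exact: ipow_all.
- by exists (fun=> 0) => [i|]; [exact: ipow0|rewrite big1 // => i _; rewrite scale0r].
- exists (fun i => a i + b i) => [i|]; first exact: ipowD.
  by rewrite -big_split; apply: eq_bigr => i _; rewrite scalerDl.
- exists (fun i => c * a i) => [i|]; first exact: ipowM.
  by rewrite scaler_sumr; apply: eq_bigr => i _; rewrite scalerA.
Qed.

Lemma adic_fg_cofinite n : cofinite k (I[M] n).
Proof.
have [s [p [pI pP]]] := ideal_pow_fg 1.
have m1 a : ideal_pow m 1 a <-> m a.
  split=> [|ma]; last by rewrite -[a]mulr1; apply: ipowM => //; exact: ipow_all.
  move E1 : 1%N => n1 aI; elim: aI E1 => {n1 a} [|n1 _|n1 a b _ IHa _ IHb n1E|n1 a b ma _ _ _] //.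
  - exact: ideal0.
  - by apply: idealD; [exact: IHa|exact: IHb].
  - exact: idealMr.
apply: (adic_cofinite kC (g := p)) => [i|a /m1/pP[c ->]|].
- exact/m1.
- exists c; first by apply: eq_bigr => i _; rewrite mulC.
  by move=> i j v; apply: adicZ => b _; exact: mulC.
exists r, e => v; have [a ->] := eM v; have [c cP] := choice residue.
exists (\row_i c (a i)); rewrite /lcomb -sumrB; apply: adic_sum => i _.
by rewrite mxE -scalerBl; apply: adicM => //; exact: adic_all.
Qed.

End FinitelyGenerated.

Section Completion.
Variables (M : lmodType A) (r : nat) (e : 'I_r -> M).
Hypothesis eM : forall v, exists a : 'I_r -> A, v = \sum_i a i *: e i.
Local Notation Ahat := (adic_completion m).
Local Notation iota := (to_completion m).
Variables (X : lmodType Ahat) (eta : M -> X).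
Hypothesis etaD : {morph eta : u v / u + v}.
Hypothesis etaZ : forall a v, eta (a *: v) = iota a *: eta v.
Hypothesis etaX : forall t, exists f : 'I_r -> Ahat, t = \sum_i f i *: eta (e i).
(* The universal property of the extension of scalars, which makes X the    *)
(* module Ahat (x) M.                                                       *)
Hypothesis univ : forall (V : zmodType) (beta : Ahat -> M -> V),
  (forall f g v, beta (f + g) v = beta f v + beta g v) ->
  (forall f u v, beta f (u + v) = beta f u + beta f v) ->
  (forall f a v, beta (f * iota a) v = beta f (a *: v)) ->
  exists2 pi : X -> V, {morph pi : s t / s + t} & forall f v, pi (f *: eta v) = beta f v.

Definition Jhat (f : Ahat) : Prop := exists2 a, m a & f = iota a.
Local Notation G := (@adic Ahat X Jhat).
Local Notation "'I[' N ]" := (@adic A N m).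

Lemma G_ipow n a t : ideal_pow m n a -> G n (iota a *: t).
Proof.
move=> aI; elim: aI t => {n a} [a|n|n a b _ IHa _ IHb|n a b ma _ IHb] t.
- exact: adic_all.
- by rewrite rmorph0 scale0r; exact: adic0.
- by rewrite rmorphD scalerDl; apply: adicD.
- by rewrite rmorphM -scalerA; apply: adicM => //; exists a.
Qed.

Lemma GN n t : G n t -> G n (- t).
Proof.
by rewrite -scaleN1r; apply: adicZ => f _; rewrite mulN1r mulrN1.
Qed.

Lemma G_trans n s t u : G n (s - t) -> G n (t - u) -> G n (s - u).
Proof. by move=> st tu; rewrite -(subrK t s) -addrA; exact: adicD. Qed.

Lemma eta_sum (I : Type) (s : seq I) (P : pred I) (F : I -> M) :
  eta (\sum_(i <- s | P i) F i) = \sum_(i <- s | P i) eta (F i).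
Proof.
apply: (big_morph eta etaD); apply: (addIr (eta 0)).
by rewrite -etaD !add0r.
Qed.

Lemma hat_mulC : commutative (@GRing.mul Ahat).
Proof.
move=> f g; apply: completion_eq => n.
apply: (ipow_trans (truncationM n f g)); rewrite mulC.
exact/ipow_sym/truncationM.
Qed.

(** Finite generation of m^n is what puts f - iota a in m^n Ahat, rather than merely in the kernel
    of the map to A / m^n. *)
Lemma hat_action n f a t : approx n f a -> G n (f *: t - iota a *: t).
Proof.
move=> fa; rewrite -scalerBl; have [s [p [pI pP]]] := ideal_pow_fg n.
have [|g ->] := truncation_gen pP (f := f - iota a).
  by have := approxB fa (approx_cst m n a); rewrite /approx subrr subr0.
rewrite scaler_suml; apply: adic_sum => i _; rewrite -scalerA.
apply: adicZ (G_ipow _ (pI i)) => h [b _ ->].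
exact: hat_mulC.
Qed.

Lemma G_truncation n (f : 'I_r -> Ahat) (a : 'I_r -> A) :
  (forall i, approx n (f i) (a i)) ->
  G n (\sum_i f i *: eta (e i) - eta (\sum_i a i *: e i)).
Proof.
move=> fa; rewrite eta_sum -sumrB; apply: adic_sum => i _; rewrite etaZ.
exact: hat_action.
Qed.

Lemma completion_dense n t : exists v, G n (t - eta v).
Proof.
have [f ->] := etaX t; exists (\sum_i truncation n (f i) *: e i).
by apply: G_truncation => i; exact: approx_refl.
Qed.

Lemma GE n t : G n t -> exists2 f : 'I_r -> Ahat, t = \sum_i f i *: eta (e i) &
  forall i, approx n (f i) 0.
Proof.
elim=> {n t} [t|n|n s t _ [f -> fI] _ [g -> gI]|n _ t [a ma ->] _ [f -> fI]].
- have [f ->] := etaX t; exists f => // i.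
  by apply: approx_mod (approx_refl 0 _) _; exact: ipow_all.
- exists (fun=> 0) => [|i]; first by rewrite big1 // => i _; rewrite scale0r.
  by have := approx_cst m n 0; rewrite rmorph0.
- exists (fun i => f i + g i) => [|i].
    by rewrite -big_split; apply: eq_bigr => i _; rewrite scalerDl.
  by have := approxD (fI i) (gI i); rewrite addr0.
- exists (fun i => iota a * f i) => [|i].
    by rewrite scaler_sumr; apply: eq_bigr => i _; rewrite scalerA.
  have fi : ideal_pow m n (truncation n.+1 (f i)).
    rewrite -[truncation _ _](subrK (truncation n (f i))).
    by apply: ipowD; [exact: truncation_le|have := fI i; rewrite /approx subr0].
  apply: approx_mod (approxM (approx_cst m n.+1 a) (approx_refl n.+1 (f i))) _.
  by rewrite subr0; exact: ipowM.
Qed.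

(** pi is the map X -> M / m^n M given by the universal property, its target embedded in a space of
    rows by [exact_coords]. Truncation becomes bilinear because phi sees coefficients only modulo
    m^n. *)
Lemma coordinates_mod n : exists d (phi : M -> 'rV[C]_d) (pi : X -> 'rV[C]_d),
  [/\ forall v, phi v = 0 <-> I[M] n v, forall t, G n t -> pi t = 0 &
      forall (f : 'I_r -> Ahat) (a : 'I_r -> A), (forall i, approx n (f i) (a i)) ->
        pi (\sum_i f i *: eta (e i)) = phi (\sum_i a i *: e i)].
Proof.
have [d [phi [phiB phi0]]] := exact_coords (G := adic_space kC M m n) (adic_fg_cofinite eM n).
have phi00 : phi 0 = 0 by apply/phi0; exact: adic0.
have phiN v : phi (- v) = - phi v by rewrite -[- v]sub0r phiB phi00 sub0r.
have phiD u v : phi (u + v) = phi u + phi v by rewrite -{1}[v]opprK phiB phiN opprK.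
have phi_sum (I : finType) (F : I -> M) : phi (\sum_i F i) = \sum_i phi (F i).
  exact: (big_morph phi phiD phi00).
have phiM a b v : ideal_pow m n (a - b) -> phi (a *: v) = phi (b *: v).
  move=> ab; apply/eqP; rewrite -subr_eq0 -phiB -scalerBl; apply/eqP/phi0.
  exact: adic_ipow.
have [|||pi piD piE] := univ (beta := fun f v => phi (truncation n f *: v)).
- by move=> f g v; rewrite -phiD -scalerDl; apply: phiM; exact: truncationD.
- by move=> f u v; rewrite scalerDr phiD.
- move=> f a v; rewrite scalerA; apply: phiM.
  by apply: approxM (approx_refl n f) (approx_cst m n a).
have pi00 : pi 0 = 0 by apply: (addIr (pi 0)); rewrite -piD !add0r.
have piF (f : 'I_r -> Ahat) (a : 'I_r -> A) : (forall i, approx n (f i) (a i)) ->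
    pi (\sum_i f i *: eta (e i)) = phi (\sum_i a i *: e i).
  move=> fa; rewrite (big_morph pi piD pi00) phi_sum; apply: eq_bigr => i _.
  by rewrite piE; apply: phiM; exact: fa.
exists d, phi, pi; split=> // t /GE[f -> f0].
by rewrite (piF _ (fun=> 0)) // big1 // => i _; rewrite scale0r.
Qed.

Lemma completion_strict n v : G n (eta v) -> I[M] n v.
Proof.
have [d [phi [pi [phi0 piG piE]]]] := coordinates_mod n.
have [a vE] := eM v; move=> /piG; rewrite {1}vE eta_sum.
under eq_bigr => i _ do rewrite etaZ.
rewrite (piE _ a) => [|i]; last exact: approx_cst.
by rewrite -vE => /phi0.
Qed.

(** Replace the u n by elements of M by density; by strictness their differences have coefficients
    in m^n on the e_i, and these coefficient series are summed in Ahat. *)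
Lemma completion_complete (u : nat -> X) : (forall n, G n (u n.+1 - u n)) ->
  exists t, forall n, G n (t - u n).
Proof.
move=> uG; have [v vP] := choice (fun n => completion_dense n (u n)).
have step n : exists a : 'I_r -> A, (forall i, ideal_pow m n (a i)) /\
    v n.+1 - v n = \sum_i a i *: e i.
  have [|a aI aE] := adicE eM (n := n) (v := v n.+1 - v n); last by exists a.
  apply: completion_strict.
  have -> : eta (v n.+1 - v n) = eta (v n.+1) - eta (v n).
    by apply/eqP; rewrite eq_sym subr_eq -etaD subrK.
  apply: (G_trans (t := u n.+1)); first by rewrite -opprB; apply: GN; exact/adicS/vP.
  exact: (G_trans (uG n) (vP n)).
have [a aP] := choice step.
have [a0 v0] := eM (v 0%N).
have fE i : exists f : Ahat, forall n, approx n f (a0 i + \sum_(l < n) a l i).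
  apply: completion_limit => n.
  rewrite big_ord_recr /= addrA [_ + a n i]addrC addrK. apply: (aP n).1.
have [f fP] := choice fE.
have vE n : v n = \sum_i (a0 i + \sum_(l < n) a l i) *: e i.
  elim: n => [|n IHn].
    by rewrite v0; apply: eq_bigr => i _; rewrite big_ord0 addr0.
  rewrite -(subrK (v n) (v n.+1)) (aP n).2 IHn -big_split.
  by apply: eq_bigr => i _; rewrite big_ord_recr /= -scalerDl [a n i + _]addrC addrA.
exists (\sum_i f i *: eta (e i)) => n.
apply: (G_trans (t := eta (v n))); last by rewrite -opprB; apply: GN; exact: vP.
by rewrite vE; apply: G_truncation => i; exact: fP.
Qed.

(* The relations between the e_i are finitely generated; the approximate    *)
(* solutions of the resulting linear system form cosets of subspaces of     *)
(* finite codimension, so a limit solution exists by compactness.           *)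
Lemma completion_separated t : (forall n, G n t) -> t = 0.
Proof.
move=> tG; have [f tE] := etaX t.
pose Rel (a : 'rV[A]_r) := \sum_i a 0 i *: e i = 0.
have RelP : osub (fun=> True) Rel.
  rewrite /Rel; split=> [|a b a0 b0|c a _ a0].
  - by rewrite big1 // => i _; rewrite mxE scale0r.
  - under eq_bigr => i _ do rewrite mxE scalerDl.
    by rewrite big_split /= a0 b0 addr0.
  - under eq_bigr => i _ do rewrite mxE -scalerA.
    by rewrite -scaler_sumr a0 scaler0.
have [rho rhoRel rhoP] := noeth RelP; set p := size rho.
pose comb (c : 'rV[A]_p) i := \sum_(j < p) c 0 j * rho`_j 0 i.
have combB c d i : comb (c - d) i = comb c i - comb d i.
  by rewrite /comb -sumrB; apply: eq_bigr => j _; rewrite !mxE mulrBl.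
(* Those c for which the relation with coefficients c agrees with f modulo m^n. A solution in Ahat
   valid for all n makes t a combination of relations, hence 0. *)
pose S n (c : 'rV[A]_p) := forall i, ideal_pow m n (comb c i - truncation n (f i)).
have Sle n n' c : (n <= n')%N -> S n' c -> S n c.
  move=> nn' cS i; apply: ipow_trans (ipowW nn' (cS i)) _; exact: truncation_le.
have Sex n : exists c, S n c.
  have [d [phi [pi [phi0 piG piE]]]] := coordinates_mod n.
  have /phi0/(adicE eM)[g gI gE] : phi (\sum_i truncation n (f i) *: e i) = 0.
    by rewrite -(piE f) => [|i]; [rewrite -tE; exact: piG|exact: approx_refl].
  have /rhoP/ospan_sum[c cE] : Rel (\row_i (truncation n (f i) - g i)).
    rewrite /Rel; under eq_bigr => i _ do rewrite mxE scalerBl.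
    by rewrite sumrB gE subrr.
  exists (\row_j c j) => i; rewrite /comb; under eq_bigr => j _ do rewrite mxE.
  have /(congr1 (fun v : 'rV_r => v 0 i)) := cE.
  rewrite summxE mxE; under [X in _ = X -> _]eq_bigr => j _ do rewrite mxE.
  move=> <-; rewrite addrAC subrr sub0r.
  exact: (idealN (I := ipow m n)).
have TP n : exists T : subspace k 'rV[A]_p, forall c, T c <-> forall i, ideal_pow m n (comb c i).
  pose T c := forall i, ideal_pow m n (comb c i).
  have T0 : T 0.
    move=> i; rewrite /comb big1 => [|j _]; first exact: ipow0.
    by rewrite mxE mul0r.
  have TD c d : T c -> T d -> T (c + d).
    move=> cT dT i; rewrite -[d]opprK combB -[- d]sub0r combB opprB.
    rewrite addrC -addrA; apply: ipowD => //; rewrite addrC; exact: ipowB.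
  have TZ (a : C) c : T c -> T (k a *: c).
    move=> cT i; rewrite /comb; under eq_bigr => j _ do rewrite mxE -mulrA.
    by rewrite -mulr_sumr; apply: ipowMl; exact: cT.
  by exists (Subspace T0 TD TZ).
have [T Tn] := choice TP.
have deltaE (v : 'rV[A]_p) : exists a : 'I_p -> A, v = \sum_i a i *: delta_mx 0 i.
  by exists (v 0); exact: row_sum_delta.
have adic_row n (c : 'rV[A]_p) j : I['rV[A]_p] n c -> ideal_pow m n (c 0 j).
  elim=> {n c} [c|n|n c d _ cI _ dI|n a c ma _ cI]; rewrite ?mxE.
  - exact: ipow_all.
  - exact: ipow0.
  - exact: ipowD.
  - exact: ipowM.
have stab n := chain_stab (G := adic_space kC 'rV[A]_p m n) (T := T)
  (adic_fg_cofinite deltaE n).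
have lam0E n : exists l0, forall l, (l0 <= l)%N ->
    forall c, T l0 c -> exists2 c', T l c' & I['rV[A]_p] n (c - c').
  by apply: stab => l c /Tn cT; apply/Tn => i; exact/ipowS/cT.
have [lam0 lam0P] := choice lam0E.
(* From this level on, the homogeneous solutions modulo m^n no longer shrink; the maximum with n
   makes solutions at this level solutions modulo m^n as well. *)
pose lam n := maxn (lam0 n) n.
have lamP n l : (lam n <= l)%N -> forall c, T (lam n) c ->
  exists2 c', T l c' & I['rV[A]_p] n (c - c').
  rewrite geq_max => /andP[ll _] c /Tn cT; apply: lam0P => //; apply/Tn => i.
  by apply: ipowW (cT i); exact: leq_maxl.
(* Modulo m^n, c is the beginning of solutions at every deeper level, which allows the sequence to
   be continued. *)
pose P n c := exists2 s, S (lam n) s & I['rV[A]_p] n (c - s).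
have Pext n c l : P n c -> (lam n <= l)%N -> exists2 s, S l s & I['rV[A]_p] n (c - s).
  move=> [s sS cs] ll; have [s' s'S] := Sex l.
  have [|c' /Tn c'T sc'] := lamP n l ll (s - s').
    apply/Tn => i; rewrite combB; apply: ipow_trans (sS i) _.
    by apply: ipow_sym; exact: (Sle _ _ _ ll s'S).
  exists (s' + c') => [i|].
    rewrite -[c']opprK combB -[- c']sub0r combB opprB addrAC.
    apply: ipowD; first exact: s'S.
    rewrite -opprB; apply: (idealN (I := ipow m l)).
    rewrite [comb 0 i](_ : _ = 0) ?sub0r; first exact: (idealN (I := ipow m l)).
    by rewrite /comb big1 // => j _; rewrite mxE mul0r.
  rewrite -(subrK s c) -addrA; apply: adicD => //.
  by rewrite opprD addrA.
have Pstep n c : exists c', P n c -> P n.+1 c' /\ I['rV[A]_p] n (c - c').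
  have [Pc|nP] := pselect (P n c); last by exists 0.
  have [s sS cs] := Pext n c _ Pc (leq_maxl (lam n) (lam n.+1)).
  exists s => _; split=> //; exists s; last by rewrite subrr; exact: adic0.
  by apply: Sle sS; exact: leq_maxr.
have [next nextP] := choice (fun nc : nat * 'rV[A]_p => Pstep nc.1 nc.2).
have [s0 s0S] := Sex (lam 0%N).
pose seqc := fix seqc n := if n is n'.+1 then next (n', seqc n') else s0.
have seqP n : P n (seqc n).
  elim: n => [|n IHn]; first by exists s0 => //; exact: adic_all.
  by have [] := nextP (n, seqc n) IHn.
have chatE j : exists g : Ahat, forall n, approx n g (seqc n 0 j).
  apply: completion_limit => n.
  have [_ /(@adic_row _ _ j)] := nextP (n, seqc n) (seqP n).
  by rewrite !mxE => /ipow_sym.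
have [chat chatP] := choice chatE.
have fE i : f i = \sum_(j < p) chat j * iota (rho`_j 0 i).
  apply: completion_eq => n; apply: ipow_sym.
  apply: (ipow_trans (b := comb (seqc n) i)).
    by apply: approx_sum => j _; apply: approxM; [exact: chatP|exact: approx_cst].
  have [s sS cs] := seqP n; apply: (ipow_trans (b := comb s i)).
    rewrite -combB; apply: ipow_sum => j _; apply: ipowMr; exact: adic_row.
  apply: ipow_trans (ipowW (leq_maxr _ n) (sS i)) _.
  exact/truncation_le/leq_maxr.
rewrite tE; under eq_bigr => i _ do rewrite fE scaler_suml.
rewrite exchange_big big1 // => j _.
under eq_bigr => i _ do rewrite -scalerA -etaZ.
rewrite -scaler_sumr -eta_sum.
have -> : \sum_i rho`_j 0 i *: e i = 0 by apply: rhoRel; exact: mem_nth.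
suff -> : eta 0 = 0 by rewrite scaler0.
by apply: (addIr (eta 0)); rewrite -etaD !add0r.
Qed.

End Completion.
End CompletedModule.

(** * Completed modules over a Cherednik algebra *)

Section CompletedCherednik.
Variables (C : numClosedFieldType) (h : vectType C) (W : finGroupType).
Variables (D : cherednik_data h W) (DP : is_cherednik_data D) (b : h).
Variable cc : completed_cherednik D b.

Local Notation H := (cherednik D).
Local Notation k := (pcst (cher_rel D) : {rmorphism C -> H}).
Local Notation A := (invariant D).
Local Notation m := (max_ideal D b).
Local Notation Ahat := (adic_completion m).
Local Notation ppol := (pcst (@poly_rel C h) : {rmorphism C -> coord_ring h}).

Lemma scalar_inv c : is_invariant D (ppol c).
Proof. by apply/asboolP => w; exact: poly_act_cst. Qed.

Definition inv_cst c : A := Invariant (scalar_inv c).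

Fact inv_cst_zmod : zmod_morphism inv_cst.
Proof. by move=> a c; apply: val_inj; rewrite /= rmorphB. Qed.
Fact inv_cst_monoid : monoid_morphism inv_cst.
Proof. by split=> [|a c]; apply: val_inj; rewrite /= ?rmorph1 ?rmorphM. Qed.
HB.instance Definition _ := GRing.isZmodMorphism.Build C A inv_cst inv_cst_zmod.
HB.instance Definition _ := GRing.isMonoidMorphism.Build C A inv_cst inv_cst_monoid.

Lemma inv_residue (a : A) : exists c, m (a - inv_cst c).
Proof.
exists (poly_eval b (inv_incl D a)).
by rewrite /= !rmorphB /= poly_eval_cst subrr.
Qed.

Lemma inv_toH_cst c : inv_toH D (inv_cst c) = Hc D c.
Proof. exact: poly_toH_cst. Qed.

Section Module.
Variables (M : lmodType H) (Mfg : fg_over_poly M).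

Local Notation X := (tensor (ext_bimodule (cc_H cc)) M).
Local Notation XH := (restr (cc_H cc) X).
Local Notation MA := (restr (inv_toH D) M).
Local Notation XA := (restr (cc_fun cc) X).

Lemma fg_over_inv : exists r (e : 'I_r -> MA), forall v, exists a : 'I_r -> A,
  v = \sum_i a i *: e i.
Proof.
have [n [g gP]] := Mfg; have [s [q qP]] := coord_finite DP.
exists #|{: 'I_n * 'I_s}|, (fun i => poly_toH D (q (enum_val i).2) *: g (enum_val i).1).
move=> v; have [p vE] := gP v; have [a aP] := choice (fun i => qP (p i)).
exists (fun i => a (enum_val i).1 (enum_val i).2).
rewrite -(big_enum_val (A := {: 'I_n * 'I_s})
  (fun ij => a ij.1 ij.2 *: (poly_toH D (q ij.2) *: g ij.1 : MA))) /=.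
rewrite -(pair_bigA _ (fun i j => a i j *: (poly_toH D (q j) *: g i : MA))) vE /=.
apply: eq_bigr => i _; rewrite {1}(aP i) rmorph_sum scaler_suml.
by apply: eq_bigr => j _; rewrite rmorphM -scalerA.
Qed.

Definition unit_map (v : M) : X := pure (1 : ext_bimodule (cc_H cc)) v.

Lemma unit_mapD : {morph unit_map : u v / u + v}.
Proof. by move=> u v; exact: pureDr. Qed.

Lemma unit_mapZ (a : H) v : unit_map (a *: v) = cc_H cc a *: unit_map v.
Proof.
rewrite /unit_map -pure_bal pureZ; congr pure.
by rewrite [LHS]/= mul1r /GRing.scale /= mulr1.
Qed.

Lemma pureE (u : ext_bimodule (cc_H cc)) v : pure u v = (u : cc) *: unit_map v.
Proof. by rewrite /unit_map pureZ /GRing.scale /= mulr1. Qed.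

Definition unit_fun : M -> XH := unit_map.
Fact unit_fun_linear : linear unit_fun.
Proof. by move=> a u v; rewrite /unit_fun unit_mapD unit_mapZ. Qed.
HB.instance Definition _ := GRing.isLinear.Build H M XH _ unit_fun unit_fun_linear.

Lemma cc_surj (u : cc) : exists t, u = cc_mul cc t.
Proof. by have [g _ gK] := cc_mul_bij cc; exists (g u); rewrite gK. Qed.

(** Surjectivity of [cc_mul] writes an element of the completed algebra as a sum of products f a
    with a in H, and a is absorbed into M. *)
Lemma unit_span r (e : 'I_r -> MA) : (forall v, exists a : 'I_r -> A, v = \sum_i a i *: e i) ->
  forall t : X, exists f : 'I_r -> Ahat, (t : XA) = \sum_i f i *: (unit_map (e i) : XA).
Proof.
move=> eM t; pose P (t : X) := exists f : 'I_r -> Ahat,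
  (t : XA) = \sum_i f i *: (unit_map (e i) : XA).
have P0 : P 0 by exists (fun=> 0); rewrite big1 // => i _; rewrite scale0r.
have PD s s' : P s -> P s' -> P (s + s').
  move=> [f sE] [g s'E]; exists (fun i => f i + g i).
  rewrite (_ : s + s' = (s : XA) + (s' : XA)) // sE s'E -big_split.
  by apply: eq_bigr => i _; rewrite scalerDl.
have PN s : P s -> P (- s).
  move=> [f sE]; exists (fun i => - f i).
  rewrite (_ : - s = - (s : XA)) // sE -sumrN.
  by apply: eq_bigr => i _; rewrite scaleNr.
apply: (tensor_ind (Q := P)) => // u v; rewrite pureE; have [s ->] := cc_surj u.
move: s; apply: tensor_ind => [|s s' Ps Ps'|s Ps|f a].
- by rewrite raddf0 scale0r.
- by rewrite raddfD scalerDl; exact: PD.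
- by rewrite raddfN scaleNr; exact: PN.
- rewrite (cc_mulE cc f a) -scalerA -unit_mapZ.
  have [c cE] := eM (a *: v); exists (fun i => (f : Ahat) * to_completion m (c i)).
  have unit_sum (I : finType) (F : I -> M) : unit_map (\sum_i F i) = \sum_i unit_map (F i).
    exact: (raddf_sum (unit_fun : {linear M -> XH})).
  rewrite cE unit_sum.
  rewrite scaler_sumr; apply: eq_bigr => i _.
  rewrite -[LHS]/((f : Ahat) *: (unit_map (c i *: e i) : XA)) -scalerA; congr (_ *: _).
  rewrite [LHS]unit_mapZ -cc_compat.
  by [].
Qed.

(* The inverse of cc_mul turns Hb (x)_H M into Ahat (x)_A M. *)
Lemma unit_universal (V : zmodType) (beta : Ahat -> MA -> V) :
  (forall f g v, beta (f + g) v = beta f v + beta g v) ->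
  (forall f u v, beta f (u + v) = beta f u + beta f v) ->
  (forall f a v, beta (f * to_completion m a) v = beta f (a *: v)) ->
  exists2 pi : XA -> V, {morph pi : s t / s + t} &
    forall f v, pi (f *: (unit_map v : XA)) = beta f v.
Proof.
move=> bDl bDr bal; have [g mK gK] := cc_mul_bij cc.
have gD : {morph g : u u' / u + u'}.
  by move=> u u'; apply: (can_inj mK); rewrite raddfD !gK.
pose b0 v (f : ext_bimodule (inv_to_completion D b)) (a : restr (inv_toH D) H^o) : V :=
  beta f ((a : H) *: v).
have b0P v : balanced (b0 v).
  rewrite /b0; split=> [f f' a|f a a'|f c a].
  - exact: bDl.
  - by rewrite (scalerDl (v : M)) bDr.
  - rewrite [LHS]bal; congr (beta f _).
    by rewrite [LHS](scalerA (inv_toH D c) a (v : M)).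
pose B (u : ext_bimodule (cc_H cc)) (v : M) : V := text (b0 v) (g u).
have Bmul v t : B (cc_mul cc t) v = text (b0 v) t by rewrite /B mK.
have BDr u v v' : B u (v + v') = B u v + B u v'.
  rewrite /B; move: (g u) => {u}.
  apply: text_ext => [s t|s t|f a].
  - exact: (textD (b0P _)).
  - by rewrite !(textD (b0P _)) addrACA.
  - by rewrite !(text_pure (b0P _)) /b0 scalerDr bDr.
have BP : balanced B.
  split=> [u u' v|u v v'|u a v].
  - by rewrite /B gD (textD (b0P _)).
  - exact: BDr.
  - have [t ->] := cc_surj u; rewrite Bmul; move: t.
    pose T1 t := B ((cc_mul cc t : cc) * cc_H cc a) v.
    rewrite -/(_ =1 _); apply: text_ext => [s t|s t|f c].
    + by rewrite /= raddfD mulrDl /B gD (textD (b0P _)).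
    + exact: (textD (b0P _)).
    + rewrite /= (cc_mulE cc f c) -mulrA -rmorphM.
      rewrite -(cc_mulE cc f (c * a)) Bmul !(text_pure (b0P _)) /b0.
      by rewrite [in RHS]scalerA.
exists (text B) => [|f v]; first exact: (textD BP).
rewrite [X in text B X](_ : _ = pure (cc_fun cc f : ext_bimodule (cc_H cc)) v); last first.
  by rewrite pureE.
rewrite (text_pure BP) -[cc_fun cc f]mulr1 -(rmorph1 (cc_H cc)) -(cc_mulE cc f 1) Bmul.
by rewrite (text_pure (b0P _)) /b0 scale1r.
Qed.

Definition J_at (u : H) : Prop := exists2 a, m a & u = inv_toH D a.
Local Notation "'G[' N ]" := (@adic H N J_at).

Lemma G_restr n (t : X) : @adic Ahat XA (@Jhat A m) n t <-> G[XH] n t.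
Proof.
split.
  apply: (adic_map (T := fun t : XA => (t : XH))) => // _ s [a ma ->].
  exists (inv_toH D a); first by exists a.
  by rewrite !restrE -cc_compat.
apply: (adic_map (T := fun t : XH => (t : XA))) => // _ s [a ma ->].
exists (to_completion m a); first by exists a.
exact: (congr1 (fun z : cc => z *: (s : X)) (esym (cc_compat cc a))).
Qed.

Lemma G_restrM n (v : M) : @adic A MA m n v <-> G[M] n v.
Proof.
split.
  apply: (adic_map (T := fun v : MA => (v : M))) => // a s ma.
  by exists (inv_toH D a); first by exists a.
apply: (adic_map (T := fun v : M => (v : MA))) => // _ s [a ma ->].
by exists a.
Qed.

Lemma completed_module :
  [/\ forall t, (forall n, G[XH] n t) -> t = 0,
      forall u : nat -> X, (forall n, G[XH] n (u n.+1 - u n)) ->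
        exists t, forall n, G[XH] n (t - u n),
      forall n t, exists v, G[XH] n (t - unit_fun v),
      forall n v, G[XH] n (unit_fun v) -> G[M] n v &
      (forall n, cofinite k (G[XH] n)) /\
      forall n f, exists a, forall t : X,
        G[XH] n ((cc_fun cc f *: t : X) - inv_toH D a *: (t : XH))].
Proof.
have [r [e eM]] := fg_over_inv.
have mulC := @inv_mulC _ _ _ D.
have noeth n T := @invariant_noetherian _ _ _ _ DP n T.
have etaZ (a : A) (v : MA) : (unit_map (a *: v) : XA) = to_completion m a *: (unit_map v : XA).
  by rewrite [LHS]unit_mapZ; exact:
    (congr1 (fun z : cc => z *: unit_map v) (esym (cc_compat cc a))).
have dense n t : exists v, G[XH] n (t - unit_fun v).
  have [v vG] := completion_dense mulC noeth (eta := unit_map : MA -> XA) unit_mapD etaZ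
    (unit_span eM) n t.
  by exists v; apply/G_restr.
split=> //.
- move=> t tG; apply: (completion_separated (k := inv_cst) mulC inv_residue noeth eM
    (eta := unit_map : MA -> XA) unit_mapD etaZ (unit_span eM) unit_universal).
  by move=> n; exact/G_restr.
- move=> u uG; have [|t tG] := completion_complete (k := inv_cst) mulC inv_residue noeth eM
    (eta := unit_map : MA -> XA) unit_mapD etaZ (unit_span eM) unit_universal (u := u).
    by move=> n; exact/G_restr.
  by exists t => n; exact: (G_restr n (t - u n)).1 (tG n).
- move=> n v /G_restr vG; apply/G_restrM.
  exact: (completion_strict (k := inv_cst) mulC inv_residue noeth eM
    (eta := unit_map : MA -> XA) unit_mapD etaZ (unit_span eM) unit_universal vG).
split=> [n|n f].
  have [s [l lP]] := adic_fg_cofinite (k := inv_cst) mulC inv_residue noeth eM n.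
  exists s, (fun i => unit_fun (l i : M)) => t.
  have [v tv] := dense n t; have [c cP] := lP v; exists c.
  have : G[M] n (v - lcomb k (l : 'I_s -> M) c).
    apply/G_restrM.
    rewrite (_ : lcomb k _ c = lcomb inv_cst l c :> M) //.
    by apply: eq_bigr => i _; rewrite restrE inv_toH_cst.
  have etaG u : G[M] n u -> G[XH] n (unit_fun u).
    apply: adic_map => [u1 u2|a u1 Ja]; first exact: unit_mapD.
    by exists a => //; exact: unit_mapZ.
  move=> /etaG vG; have := adicD tv vG.
  rewrite linearB addrA subrK /lcomb linear_sum.
  by under eq_bigr => i _ do rewrite linearZ.
exists (truncation n f) => t; apply/G_restr; set a := truncation n f.
have -> : (inv_toH D a *: (t : XH) : X) = to_completion m a *: (t : XA).
  exact: (congr1 (fun z : cc => z *: t) (esym (cc_compat cc a))).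
exact: (hat_action mulC noeth (X := XA) t (approx_refl n f)).
Qed.

End Module.
End CompletedCherednik.

(** * Comparison of the two filtrations *)

Section Comparison.
Variables (C : numClosedFieldType) (h : vectType C) (W : finGroupType).
Variables (D : cherednik_data h W) (DP : is_cherednik_data D).

Local Notation H := (cherednik D).
Local Notation k := (pcst (cher_rel D) : {rmorphism C -> H}).
Local Notation dim := (\dim (fullv : {vspace h})).
Local Notation kC := (@HcC C h W D).
Local Notation polyH := (poly_toH D).

Variables (K : lmodType H) (Jp : coord_ring h -> Prop).
Local Notation F := (@adic H K (@is_x _ _ _ D)).

Definition poly_J (u : H) : Prop := exists2 p, Jp p & u = polyH p.
Local Notation G := (@adic H K poly_J).

Definition mono (e : 'I_dim -> nat) : coord_ring h :=
  \prod_(i : 'I_dim) (coordf (cobas i) : cring h) ^+ e i.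

Lemma mono_x i e : polyH (mono e) * Hx D (cobas i) = polyH (mono (fun j => (j == i) + e j)%N).
Proof.
rewrite -poly_toH_gen -rmorphM coord_mulC; congr (poly_toH _ _).
rewrite /mono (bigD1 i) //= mulrA -exprS [RHS](bigD1 i) //= eqxx add1n.
by congr (_ * _); apply: eq_bigr => j /negPf ->.
Qed.

Lemma poly_commute p q : polyH p * polyH q = polyH q * polyH p.
Proof. by rewrite -!rmorphM coord_mulC. Qed.

(** An induction principle saying that F (n + j) is spanned by the monomials of degree n applied to
    F j. *)
Lemma F_mono n j (P : K -> Prop) v : P 0 -> (forall u v, P u -> P v -> P (u + v)) ->
  (forall e u, (\sum_i e i = n)%N -> F j u -> P (polyH (mono e) *: u)) ->
  F (n + j) v -> P v.
Proof.
elim: n P v => [|n IHn] P v P0 PD Pe.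
  move=> vF; have := Pe (fun=> 0%N) v; rewrite big1 // => /(_ erefl vF).
  by rewrite /mono big1 // rmorph1 scale1r.
rewrite addSn => vF.
have [|u -> uF] := adic_gen (g := fun i => Hx D (cobas i)) _ vF.
  move=> _ [x ->]; exists (fun i => Hc D (x (bas i))).
    by rewrite {1}(form_cobas x) Hx_sum; apply: eq_bigr => i _; rewrite HxZ /Hc HcC.
  by move=> i n' v'; exact: F_c.
apply: (big_ind P) => // i _; apply: (IHn (fun u => P (Hx D (cobas i) *: u))) (uF i).
- by rewrite scaler0.
- by move=> u1 u2 Pu1 Pu2; rewrite scalerDr; exact: PD.
move=> e w en wF; rewrite scalerA -poly_toH_gen poly_commute poly_toH_gen mono_x.
apply: Pe => //; rewrite big_split /= en -[in RHS]add1n; congr (_ + _)%N.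
by rewrite (bigD1 i) //= eqxx big1 // => l /negPf ->.
Qed.

Lemma G_poly n p v : G n v -> G n (polyH p *: v).
Proof.
by apply: adicZ => _ [q _ ->]; exact: poly_commute.
Qed.

Hypothesis J0 : forall p, Jp p -> poly_eval 0 p = 0.

(** The induction is run on p - p(0), for which the case of constants is trivial. *)
Lemma F_poly n p v : poly_eval 0 p = 0 -> F n v -> F n.+1 (polyH p *: v).
Proof.
move=> p0 vF; suff: F n.+1 ((polyH p - Hc D (poly_eval 0 p)) *: v).
  by rewrite p0 /Hc rmorph0 subr0.
elim/palg_ind: p {p0} v vF => [c|x|p q IHp IHq|p q IHp IHq] v vF.
- by rewrite poly_eval_cst poly_toH_cst subrr scale0r; exact: adic0.
- rewrite -/(coordf x) poly_eval_gen linear0 poly_toH_gen /Hc rmorph0 subr0.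
  exact: F_x.
- rewrite !rmorphD /Hc rmorphD opprD addrACA scalerDl.
  by apply: adicD; [exact: IHp|exact: IHq].
- have -> : polyH (p * q) - Hc D (poly_eval 0 (p * q)) =
      polyH p * (polyH q - Hc D (poly_eval 0 q)) +
      (polyH p - Hc D (poly_eval 0 p)) * Hc D (poly_eval 0 q).
    by rewrite mulrBr mulrBl addrA subrK !rmorphM /Hc rmorphM.
  rewrite scalerDl -!scalerA.
  apply: adicD; last by apply: IHp; exact: F_c.
  have FX (r : coord_ring h) n' u : F n' u -> F n' (polyH r *: u).
    move=> uF; elim/palg_ind: r u uF => [c|x|r r' IHr IHr'|r r' IHr IHr'] u uF.
    + by rewrite poly_toH_cst; exact: F_c.
    + by rewrite poly_toH_gen; exact: F_xx.
    + by rewrite rmorphD scalerDl; apply: adicD; [exact: IHr|exact: IHr'].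
    + by rewrite rmorphM -scalerA; apply: IHr; exact: IHr'.
  by apply: FX; exact: IHq.
Qed.

Lemma G_sub_F n v : G n v -> F n v.
Proof.
elim=> {n v} [v|n|n u v _ uF _ vF|n _ v [p Jpp ->] _ vF].
- exact: adic_all.
- exact: adic0.
- exact: adicD.
- by apply: F_poly => //; exact: J0.
Qed.

Variable d : nat.
Hypothesis Gx : forall x v, G 1 (Hx D x ^+ d *: v).

Lemma G_xd n x v : G n v -> G n.+1 (Hx D x ^+ d *: v).
Proof.
elim=> {n v} [v|n|n u v _ uF _ vF|n _ v [p Jpp ->] _ vF].
- exact: Gx.
- by rewrite scaler0; exact: adic0.
- by rewrite scalerDr; exact: adicD.
- rewrite -poly_toH_gen -rmorphXn scalerA poly_commute -scalerA rmorphXn poly_toH_gen.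
  by apply: adicM => //; exists p.
Qed.

Local Notation N := (dim * d).+1.

(** Pigeonhole: among dim variables, a monomial of degree dim * d + 1 has an exponent at least d,
    and x^d gains one step of G. *)
Lemma F_sub_G n v : F (n * N) v -> G n v.
Proof.
elim: n v => [|n IHn] v; first by move=> _; exact: adic_all.
rewrite mulSn => vF; apply: F_mono vF; [exact: adic0|exact: adicD|].
move=> e u eN uF.
have [i di] : exists i, (d <= e i)%N.
  apply/existsP; rewrite -[[exists _, _]]negbK negb_exists; apply/forallP => ed.
  have : (\sum_i e i <= \sum_(i < dim) d)%N.
    by apply: leq_sum => i _; apply: ltnW; rewrite ltnNge ed.
  by rewrite eN sum_nat_const card_ord ltnn.
have -> : mono e = coordf (cobas i) ^+ d * mono (fun j => e j - (j == i) * d)%N.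
  rewrite /mono (bigD1 i) //= -{1}(subnKC di) exprD -mulrA; congr (_ * _).
  rewrite [RHS](bigD1 i) //= eqxx mul1n; congr (_ * _).
  by apply: eq_bigr => j /negPf ->; rewrite mul0n subn0.
rewrite rmorphM rmorphXn poly_toH_gen -scalerA; apply: G_xd.
by apply: G_poly; exact: IHn.
Qed.

Lemma F_le (u : nat -> K) n n' : (forall j, F j (u j.+1 - u j)) -> (n <= n')%N -> F n (u n' - u n).
Proof.
move=> uF /subnK <-; elim: (n' - n)%N => [|j IHj]; first by rewrite subrr; exact: adic0.
apply: (mod_trans (S := adic_space kC K (@is_x _ _ _ D) n)) IHj.
by apply: adicW (uF _); exact: leq_addl.
Qed.

Lemma comparison_complete :
  cofinite k (G 1) -> (forall v, (forall n, G n v) -> v = 0) ->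
  (forall u : nat -> K, (forall n, G n (u n.+1 - u n)) -> exists v, forall n, G n (v - u n)) ->
  adically_complete K.
Proof.
move=> [r [l lP]] sep cpl; split.
- by exists r, l => v; have [c cP] := lP v; exists c; exact: G_sub_F.
- by move=> v vF; apply: sep => n; apply: F_sub_G; exact: vF.
(* The subsequence u (n N) is Cauchy for G; its limit is also the limit of u for F. *)
move=> u uF; have [|v vP] := cpl (fun n => u (n * N)%N).
  by move=> n; apply: F_sub_G; apply: F_le => //; rewrite leq_mul.
exists v => n; apply: (mod_trans (S := adic_space kC K (@is_x _ _ _ D) n)).
  exact/G_sub_F/vP.
by apply: F_le => //; rewrite leq_pmulr.
Qed.

End Comparison.

(** * Units and continuity in the completion at 0 *)

Section CompletionAtZero.
Variables (C : numClosedFieldType) (h : vectType C) (W : finGroupType).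
Variables (D : cherednik_data h W) (DP : is_cherednik_data D).
Variable cc : completed_cherednik D 0.

Local Notation H := (cherednik D).
Local Notation k := (pcst (cher_rel D) : {rmorphism C -> H}).
Local Notation m := (max_ideal D 0).

(** The norm p of x + c is an invariant that does not vanish at 0, so a geometric series in mu = 1 -
    p/p(0) inverts it; p is a multiple of x + c. *)
Lemma completed_inverse c x : c != 0 -> exists r : cc,
  (cc_H cc (Hx D x) + cc_H cc (Hc D c)) * r = 1 /\
  r * (cc_H cc (Hx D x) + cc_H cc (Hc D c)) = 1.
Proof.
move=> c0; have [p [q [pE p0]]] := shifted_form_divides DP x c0.
set c1 := poly_eval 0 _ in p0.
have [f fE] : exists f : adic_completion m, to_completion m p * f = 1.
  pose mu : invariant D := 1 - inv_cst D c1^-1 * p.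
  have muI : m mu.
    suff : poly_eval 0 (inv_incl D mu) = 1 - c1^-1 * c1 by rewrite mulVf // subrr.
    rewrite /mu rmorphB rmorphM rmorph1; congr (_ - _ * _).
    exact: poly_eval_cst.
  have muX n : ideal_pow m n (mu ^+ n).
    elim: n => [|n IHn]; first exact: ipow_all.
    by rewrite exprS; apply: ipowM.
  have [f fP] : exists f : adic_completion m, forall n,
      approx n f (inv_cst D c1^-1 * \sum_(i < n) mu ^+ i).
    apply: completion_limit => n; rewrite big_ord_recr /= mulrDr addrAC subrr add0r.
    by apply: ipowMl.
  exists f; apply: completion_eq => n.
  have := approxM (approx_cst m n p) (fP n).
  rewrite mulrA [p * _]inv_mulC.
  have -> : inv_cst D c1^-1 * p = 1 - mu by rewrite opprB addrCA subrr addr0.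
  rewrite -[1 - mu]opprB mulNr -subrX1 opprB => pf.
  apply: (ipow_trans (b := 1)); last first.
    by apply: ipow_sym; have := approx_cst m n 1; rewrite /approx rmorph1.
  apply: approx_mod pf _; rewrite addrAC subrr sub0r.
  exact: (idealN (I := ipow m n)).
pose Q := cc_H cc (poly_toH D q); pose P := cc_fun cc f.
have pP : cc_H cc (poly_toH D (inv_incl D p)) * P = 1.
  by rewrite -[cc_H _ _](cc_compat cc p) -rmorphM [X in cc_fun cc X]fE rmorph1.
have Pp : P * cc_H cc (poly_toH D (inv_incl D p)) = 1.
  rewrite -[cc_H _ _](cc_compat cc p) -rmorphM [X in cc_fun cc X](hat_mulC (@inv_mulC _ _ _ D)).
  by rewrite fE rmorph1.
set xc := _ + _; have xcE : xc = cc_H cc (poly_toH D (coordf x + pcst _ c)).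
  by rewrite [poly_toH _ _]rmorphD /= [X in cc_H cc (X + _)]poly_toH_gen poly_toH_cst rmorphD.
have r1 : xc * (Q * P) = 1 by rewrite mulrA xcE /Q -!rmorphM -pE.
have r2 : (P * Q) * xc = 1 by rewrite -mulrA xcE /Q -!rmorphM coord_mulC -pE.
exists (Q * P); split=> //.
suff -> : Q * P = P * Q by [].
by rewrite -[LHS]mul1r -r2 -mulrA r1 mulr1.
Qed.

Section Module.
Variables (M : lmodType H) (MO : is_O M).

Local Notation L := (restr (cc_H cc) (tensor (ext_bimodule (cc_H cc)) M)).
Local Notation F := (@adic H L (@is_x _ _ _ D)).

Definition J_zero (p : coord_ring h) : Prop := exists2 a : invariant D, m a & p = inv_incl D a.

Lemma J_zeroE (N : lmodType H) n v : @adic H N (@J_at _ _ _ D 0) n v <->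
  @adic H N (@poly_J _ _ _ D J_zero) n v.
Proof.
split; apply: (adic_map (T := idfun : N -> N)) => // u u' Ju; exists u => //.
  by have [a ma ->] := Ju; exists (inv_incl D a) => //; exists a.
by have [_ [a ma ->] ->] := Ju; exists a.
Qed.

Lemma J_zero0 p : J_zero p -> poly_eval 0 p = 0.
Proof. by move=> [a ma ->]. Qed.

Lemma zero_xd (N : lmodType H) x (v : N) :
  @adic H N (@poly_J _ _ _ D J_zero) 1 (Hx D x ^+ #|W| *: v).
Proof.
have [a [aI aE]] := shifted_orbit_relation DP 0 x.
have <- : poly_toH D (\prod_(w : W) (coordf x - pcst _ (dact D w x 0))) = Hx D x ^+ #|W|.
  rewrite (eq_bigr (fun=> coordf x)) => [|w _]; last by rewrite linear0 rmorph0 subr0.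
  rewrite -poly_toH_gen -rmorphXn; congr (poly_toH _ _).
  exact: (@prodr_const (cring h) W predT).
rewrite aE rmorph_sum scaler_suml; apply: adic_sum => i _.
rewrite rmorphM -scalerA; apply: adicM; last exact: adic_all.
by exists (inv_incl D (a i)) => //; exists (a i).
Qed.

Lemma completion_adically_complete : adically_complete L.
Proof.
have [sep cpl _ _ [cof _]] := completed_module DP cc MO.1.
apply: (comparison_complete (Jp := J_zero) J_zero0 (d := #|W|)).
- exact: zero_xd.
- have [r [l lP]] := cof 1%N; exists r, l => v; have [c cP] := lP v; exists c.
  exact/J_zeroE.
- by move=> v vG; apply: sep => n; apply/J_zeroE; exact: vG.
- move=> u uG; have [|v vP] := cpl u; first by move=> n; apply/J_zeroE; exact: uG.
  by exists v => n; apply/J_zeroE; exact: vP.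
Qed.

Lemma completion_F_dense n t : exists v, F n (t - unit_fun cc v).
Proof.
have [_ _ dense _ _] := completed_module DP cc MO.1.
have [v vt] := dense n t; exists v.
by apply: (G_sub_F J_zero0); apply/J_zeroE.
Qed.

Lemma completion_F_strict v : (forall n, F n (unit_fun cc v)) ->
  forall n, @adic H M (@is_x _ _ _ D) n v.
Proof.
have [_ _ _ strict _] := completed_module DP cc MO.1.
move=> vF n; apply: (G_sub_F J_zero0); apply/J_zeroE; apply: strict; apply/J_zeroE.
by apply: (F_sub_G (d := #|W|)); [exact: zero_xd|exact: vF].
Qed.

End Module.

Lemma zero_action (T : lmodType cc) (f : adic_completion m) n (t : T) :
  @adic H (restr (cc_H cc) T) (@is_x _ _ _ D) n
    ((cc_fun cc f *: t : T) - inv_toH D (truncation n f) *: (t : restr (cc_H cc) T)).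
Proof.
have noeth n' S := @invariant_noetherian _ _ _ _ DP n' S.
have := hat_action (@inv_mulC _ _ _ D) noeth (X := restr (cc_fun cc) T) t (approx_refl n f).
set u := _ - _; have -> : u = (cc_fun cc f *: t : T) -
    inv_toH D (truncation n f) *: (t : restr (cc_H cc) T).
  congr (_ - _).
  exact: (congr1 (fun z : cc => z *: t) (cc_compat cc (truncation n f))).
move/(adic_map (T := fun t : restr (cc_fun cc) T => (t : restr (cc_H cc) T))
  (J' := @poly_J _ _ _ D J_zero)) => uG.
apply: (G_sub_F J_zero0); apply: uG => // _ v [a ma ->].
exists (inv_toH D a); first by exists (inv_incl D a) => //; exists a.
exact: (congr1 (fun z : cc => z *: v) (cc_compat cc a)).
Qed.

(* The elements of the completed invariants act continuously, so a map      *)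
(* which commutes with H commutes with them.                                *)
Lemma completed_linear (K L : lmodType cc)
    (f : {linear restr (cc_H cc) K -> restr (cc_H cc) L}) :
  adically_complete (restr (cc_H cc) L) -> linear (f : K -> L).
Proof.
move=> LP.
have fF n v : @adic H (restr (cc_H cc) K) (@is_x _ _ _ D) n v ->
    @adic H (restr (cc_H cc) L) (@is_x _ _ _ D) n (f v).
  apply: adic_map => [u v'|a u Ja]; first exact: linearD.
  by exists a => //; exact: linearZ.
have fD (u v : K) : f (u + v : K) = (f u : L) + f v by exact: (linearD f).
have fN (u : K) : f (- u : K) = - (f u : L) by exact: (linearN f).
have fhat g (v : K) : f (cc_fun cc g *: v : K) = cc_fun cc g *: (f v : L).
  apply/eqP; rewrite -subr_eq0; apply/eqP/(ac_separated LP) => n.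
  have := fF n _ (zero_action g n v); rewrite linearB linearZ => fv.
  have := zero_action g n (f v : L) => gv.
  exact: (mod_trans (S := adic_space (@HcC _ _ _ D) (restr (cc_H cc) L) (@is_x _ _ _ D) n)
    fv (mod_sym (S := adic_space (@HcC _ _ _ D) (restr (cc_H cc) L) (@is_x _ _ _ D) n) gv)).
move=> a u v; rewrite fD; congr (_ + _); have [t ->] := cc_surj a.
move: t; apply: tensor_ind => [|s t Es Et|t Et|g c].
- by rewrite raddf0 !scale0r; exact: (linear0 f).
- by rewrite raddfD !scalerDl fD Es Et.
- by rewrite raddfN !scaleNr fN Et.
- rewrite (cc_mulE cc g c) -scalerA fhat -scalerA; congr (_ *: _).
  exact: (linearZZ f c u).
Qed.

Lemma ring_invP c x : c != 0 ->
  let z := cc_H cc (Hx D x) + cc_H cc (Hc D c) in z * ring_inv z = 1.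
Proof.
move=> c0 /=; have [r [zr rz]] := completed_inverse x c0.
rewrite /ring_inv; case: xgetP => [r' -> []//|/(_ r)/= []//].
Qed.

(** The inverse r satisfies c (r t) = t - x (r t), and x gains one step: an induction up to n. *)
Lemma ring_inv_F (T : lmodType cc) c x n (t : T) : c != 0 ->
  @adic H (restr (cc_H cc) T) (@is_x _ _ _ D) n t ->
  @adic H (restr (cc_H cc) T) (@is_x _ _ _ D) n
    (ring_inv (cc_H cc (Hx D x) + cc_H cc (Hc D c)) *: t : T).
Proof.
move=> c0 tF; set r := ring_inv _.
have cE : Hc D c *: (r *: t : restr (cc_H cc) T) = (t : restr (cc_H cc) T) -
    Hx D x *: (r *: t : restr (cc_H cc) T).
  have : (t : T) = (cc_H cc (Hx D x) + cc_H cc (Hc D c)) *: (r *: t).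
    by rewrite scalerA ring_invP // scale1r.
  rewrite scalerDl => tE; rewrite {2}tE.
  rewrite -[Hx D x *: _]/(cc_H cc (Hx D x) *: (r *: t)).
  by rewrite [X in _ = X](addrC (_ : T)) addKr.
have step j : (j <= n)%N -> @adic H (restr (cc_H cc) T) (@is_x _ _ _ D) j (r *: t : T).
  elim: j => [|j IHj] jn; first exact: adic_all.
  have -> : (r *: t : T) = Hc D c^-1 *: (Hc D c *: (r *: t : restr (cc_H cc) T)).
    by rewrite scalerA /Hc -rmorphM mulVf // rmorph1 scale1r.
  apply: F_c; rewrite cE.
  apply: (spaceB (S := adic_space (@HcC _ _ _ D) (restr (cc_H cc) T) (@is_x _ _ _ D) j.+1)).
    exact: adicW tF.
  by apply: F_x; apply: IHj; exact: ltnW.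
exact: step (leqnn n).
Qed.

End CompletionAtZero.

(** * Induction to the centralizer algebra *)

Lemma mulr_swap (R : comPzRingType) (a x s y : R) : a * x * s * y = a * (y * s) * x.
Proof. by rewrite -!mulrA; congr (_ * _); rewrite mulrCA [RHS]mulrCA [x * y]mulrC. Qed.

Section Induction.
Variables (C : numClosedFieldType) (h : vectType C) (W : finGroupType).
Variables (D : cherednik_data h W) (DP : is_cherednik_data D) (b : h).
Local Notation W' := (stab DP b).
Local Notation D' := (stab_data DP b).
Local Notation DP' := (stab_dataP DP b).
Variable H0 : completed_cherednik D' 0.
Local Notation iota := (stab_incl H0).
Local Notation P := (funH_bimodule iota).
Local Notation sc a := (cc_H H0 (Hc D' a)).
Local Notation k' := (pcst (cher_rel D') : {rmorphism C -> cherednik D'}).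

Lemma iota1 : iota 1%g = 1.
Proof. by rewrite /stab_incl Hw1 rmorph1. Qed.

Lemma iotaM (s t : subg_of W') : iota (s * t)%g = iota s * iota t.
Proof. by rewrite /stab_incl HwM rmorphM. Qed.

Lemma equivariantP (f : funH iota) (s : subg_of W') g : f (sgval s * g)%g = iota s * f g.
Proof. by have /asboolP := fun_valP f; exact. Qed.

Definition iota_ext (g : W) : H0 := if g \in W' then iota (subg W' g) else 0.

Lemma iota_extM (s : subg_of W') g : iota_ext (sgval s * g)%g = iota s * iota_ext g.
Proof.
rewrite /iota_ext (groupMl g (subgP s)); case: ifPn => [gW|_]; last by rewrite mulr0.
rewrite -iotaM; congr iota; apply: val_inj => /=.
by rewrite !subgK // groupM ?subgP.
Qed.

Lemma iota_ext_sub g : g \in W' -> exists2 s, g = sgval s & iota_ext g = iota s.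
Proof. by move=> gW; exists (subg W' g); rewrite ?subgK // /iota_ext gW. Qed.

Lemma iota_ext_out g : g \notin W' -> iota_ext g = 0.
Proof. by rewrite /iota_ext => /negPf ->. Qed.

Lemma delta_equivariant (w : W) : equivariant iota (fun u => iota_ext (u * w^-1)%g).
Proof. by apply/asboolP => s u; rewrite -iota_extM mulgA. Qed.

(** Supported on the coset W' w, with value 1 at w. *)
Definition delta (w : W) : funH iota := FunH (delta_equivariant w).

Section Components.
Variable L : lmodType H0.
Local Notation T := (tensor P L).

(** Evaluation at w under the identification of P (x) L with the equivariant functions W -> L. *)
Definition comp (w : W) : T -> L := text (fun (f : P) l => (f : funH iota) w *: l).

Lemma comp_balanced w : balanced (fun (f : P) (l : L) => (f : funH iota) w *: l).
Proof.
split=> [f f' l|f l l'|f a l].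
- by rewrite -scalerDl.
- by rewrite scalerDr.
- by rewrite scalerA.
Qed.

Lemma comp_pure w (f : funH iota) l : comp w (pure (f : P) l) = f w *: l.
Proof. exact: (text_pure (comp_balanced w)). Qed.

Lemma compD w : {morph comp w : s t / s + t}.
Proof. exact: (textD (comp_balanced w)). Qed.

Lemma comp0 w : comp w 0 = 0.
Proof. exact: (text0 (comp_balanced w)). Qed.

Lemma sc_iota c s : sc c * iota s = iota s * sc c.
Proof. by rewrite /stab_incl -!rmorphM /Hc HcC. Qed.

(** Summing over all of W instead of coset representatives counts each term |W'| times, whence the
    scalar. *)
Lemma funH_delta (f : funH iota) :
  f = \sum_w funH_ract (delta w) (sc #|W'|%:R^-1 * f w).
Proof.
apply: val_inj; apply/funext => u /=.
have funD (I : finType) (F : I -> funH iota) : (\sum_i F i : funH iota) u = \sum_i F i u.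
  by apply: (big_morph (fun g : funH iota => g u)).
rewrite funD /= (bigID (fun w => (u * w^-1)%g \in W')) /= [X in _ + X]big1 ?addr0; last first.
  by move=> w /iota_ext_out ->; rewrite mul0r.
rewrite (eq_bigr (fun=> sc #|W'|%:R^-1 * f u)) => [|w uw]; last first.
  have [s uE ->] := iota_ext_sub uw.
  rewrite mulrA -sc_iota -mulrA -equivariantP -uE.
  by rewrite -mulgA mulVg mulg1.
rewrite sumr_const.
have -> : #|[pred w | (u * w^-1)%g \in W']| = #|W'|.
  rewrite -(card_preimset W' (f := fun w => (u * w^-1)%g)).
    by apply: eq_card => w; rewrite !inE.
  by move=> w1 w2 /mulgI/invg_inj.
rewrite -[RHS]mulr_natl mulrA; have -> : #|W'|%:R = sc #|W'|%:R by rewrite /Hc !rmorph_nat.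
rewrite -rmorphM /Hc -rmorphM mulfV ?rmorph1 ?mul1r //.
by rewrite pnatr_eq0 -lt0n cardG_gt0.
Qed.

Lemma component_sum (t : T) :
  t = \sum_w pure (delta w : P) (sc #|W'|%:R^-1 *: comp w t).
Proof.
move: t; apply: text_ext => [//|s t|f l].
  by rewrite -big_split; apply: eq_bigr => w _; rewrite compD scalerDr pureDr.
rewrite {1}(funH_delta f) (big_morph (fun p : P => pure p l) (fun p q => pureDl p q l) (id1 := 0)).
  by apply: eq_bigr => w _; rewrite (pure_bal (P := P) (delta w)) comp_pure scalerA.
by apply: (addIr (pure (0 : P) l)); rewrite -pureDl !add0r.
Qed.

Lemma comp_inj (t : T) : (forall w, comp w t = 0) -> t = 0.
Proof.
move=> t0; rewrite [t]component_sum big1 // => w _; rewrite t0 scaler0.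
by apply: (addIr (pure (delta w : P) (0 : L))); rewrite -pureDr !add0r.
Qed.

Lemma comp_delta w u l : comp u (pure (delta w : P) l) = iota_ext (u * w^-1)%g *: l.
Proof. exact: comp_pure. Qed.

Section Theta.
Variables (Hb : completed_cherednik D b) (th : theta_iso Hb H0).

Local Notation act u t := ((theta th u : Zcent H0) *: (t : T)).

Lemma comp_c a w t : comp w (act (cc_H Hb (Hc D a)) t) = sc a *: comp w t.
Proof.
move: t; apply: text_ext => [s t|s t|f l].
- by rewrite scalerDr compD.
- by rewrite compD scalerDr.
- by rewrite pureZ !comp_pure scalerA; congr (_ *: _); exact: theta_c.
Qed.

Lemma comp_x x w t : comp w (act (cc_H Hb (Hx D x)) t) =
  (cc_H H0 (Hx D' (dact D w x)) + sc (dact D w x b)) *: comp w t.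
Proof.
move: t; apply: text_ext => [s t|s t|f l].
- by rewrite scalerDr compD.
- by rewrite compD scalerDr.
- by rewrite pureZ !comp_pure scalerA; congr (_ *: _); exact: theta_x.
Qed.

Lemma comp_y a w t : comp w (act (cc_H Hb (Hy D a)) t) =
  cc_H H0 (Hy D' (rho D w a)) *: comp w t +
  \sum_(s in reflections D | s \notin W')
    sc (2 * cpar D s / (1 - lam D s) * alpha D s (rho D w a)) *:
      (ring_inv (cc_H H0 (Hx D' (alpha D s)) + sc (alpha D s b)) *:
        (comp (s * w)%g t - comp w t)).
Proof.
move: t; apply: text_ext => [s t|s t|f l].
- by rewrite scalerDr compD.
- rewrite compD scalerDr addrACA -big_split; congr (_ + _); apply: eq_bigr => r _.
  by rewrite !compD opprD addrACA !scalerDr.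
- rewrite pureZ !comp_pure scalerA.
  under eq_bigr => s _ do rewrite !comp_pure -scalerBl !scalerA.
  rewrite -scaler_suml -scalerDl; congr (_ *: _); exact: theta_y.
Qed.

End Theta.
End Components.

Section Shift.
Local Notation ppol := (pcst (@poly_rel C h) : {rmorphism C -> coord_ring h}).

Lemma shift_respects : respects_rel (@poly_rel C h) ppol (fun x => coordf x + ppol (x b)).
Proof.
move=> s t; case=> {s t} [c x x'|x x'] /=; last exact: coord_mulC.
rewrite add_lfunE scale_lfunE coordf_lin mulrDr addrACA; congr (_ + _).
by rewrite rmorphD rmorphM.
Qed.

(** Pullback under translation by b, the twist through which theta makes C[h] act on the component
    at 1. *)
Definition shift : {rmorphism coord_ring h -> coord_ring h} :=
  plift (@pcstC _ _ (@poly_rel C h)) shift_respects.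

Lemma shift_gen x : shift (coordf x) = coordf x + ppol (x b).
Proof. exact: plift_gen. Qed.

Lemma shift_cst c : shift (ppol c) = ppol c.
Proof. exact: plift_cst. Qed.

Lemma shift_eval p : poly_eval 0 (shift p) = poly_eval b p.
Proof.
elim/palg_ind: p => [c|x|p q IHp IHq|p q IHp IHq].
- by rewrite shift_cst !poly_eval_cst.
- by rewrite shift_gen rmorphD /= poly_eval_cst !poly_eval_gen linear0 add0r.
- by rewrite !rmorphD IHp IHq.
- by rewrite !rmorphM IHp IHq.
Qed.

Variables (Hb : completed_cherednik D b) (th : theta_iso Hb H0).
Local Notation act u t := ((theta th u : Zcent H0) *: t).

Lemma act_poly1 (L : lmodType H0) p (t : tensor P L) :
  comp 1%g (act (cc_H Hb (poly_toH D p)) t) =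
  cc_H H0 (poly_toH D' (shift p)) *: comp 1%g t.
Proof.
elim/palg_ind: p t => [c|x|p q IHp IHq|p q IHp IHq] t.
- by rewrite shift_cst !poly_toH_cst comp_c.
- rewrite shift_gen rmorphD /= poly_toH_cst !poly_toH_gen comp_x dact1 //.
  by rewrite rmorphD.
- by rewrite !rmorphD !scalerDl compD IHp IHq.
- by rewrite !rmorphM -!scalerA IHp IHq.
Qed.

(** [delta 1] is supported on W', whose elements fix b, so the constants (u x)(b) in the formula of
    theta all equal x(b). *)
Lemma ract_delta1 p : (theta th (cc_H Hb (poly_toH D p)) : centralizer iota) (delta 1%g) =
  funH_ract (delta 1%g) (cc_H H0 (poly_toH D' (shift p))).
Proof.
have deltaE u : delta 1%g u = iota_ext u by rewrite /= invg1 mulg1.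
elim/palg_ind: p => [c|x|p q IHp IHq|p q IHp IHq].
- apply: val_inj; apply/funext => u; rewrite /= shift_cst !poly_toH_cst theta_c deltaE invg1 mulg1.
  have [/iota_ext_sub[s _ ->]|/iota_ext_out ->] := boolP (u \in W').
    exact: sc_iota.
  by rewrite mulr0 mul0r.
- apply: val_inj; apply/funext => u.
  rewrite /= shift_gen rmorphD /= poly_toH_cst !poly_toH_gen theta_x deltaE invg1 mulg1.
  have [uW|/iota_ext_out ->] := boolP (u \in W'); last by rewrite mulr0 mul0r.
  have [s uE ->] := iota_ext_sub uW.
  have ub : dact D u x b = x b.
    have : (u^-1)%g \in W' by rewrite groupV.
    by rewrite inE /dact comp_lfunE => /eqP ->.
  rewrite ub mulrDl rmorphD mulrDr sc_iota; congr (_ + _).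
  by rewrite /stab_incl -!rmorphM Hwx uE.
- rewrite !rmorphD /= [LHS](congr2 +%R IHp IHq).
  by apply: val_inj; apply/funext => u /=; rewrite -mulrDr.
- rewrite !rmorphM -[LHS]/((theta th (cc_H Hb (poly_toH D p)) : centralizer iota)
    ((theta th (cc_H Hb (poly_toH D q)) : centralizer iota) (delta 1%g))) IHq.
  have /asboolP[_ zR] := cent_funP (theta th (cc_H Hb (poly_toH D p)) : centralizer iota).
  rewrite zR IHp; apply: val_inj; apply/funext => u /=.
  by rewrite -mulrA -!rmorphM.
Qed.

End Shift.

(** * The component at 1 as a retract of the completion at b *)

Section Retract.
Variables (Hb : completed_cherednik D b) (th : theta_iso Hb H0).
Variables (X : lmodType Hb) (K : lmodType H0).
Variables (psi : {linear tensor P K -> restr (theta_inv th) X}).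
Variables (psi' : {linear restr (theta_inv th) X -> tensor P K}).
Hypothesis psiK : cancel psi psi'.

Local Notation XH := (restr (cc_H Hb) X).
Local Notation KH := (restr (cc_H H0) K).

(** With [section], it makes K a direct summand of X over C[h], up to translation. Both maps respect
    the filtrations by invariants vanishing at b, so completeness passes from X to K. *)
Definition retraction (t : XH) : KH := comp 1%g (psi' t).
Definition section (l : KH) : XH := psi (pure (delta 1%g : P) (l : K)).

Lemma retractionD : {morph retraction : s t / s + t}.
Proof. by move=> s t; rewrite /retraction [psi' _](linearD psi') compD. Qed.

Lemma sectionD : {morph section : s t / s + t}.
Proof. by move=> s t; rewrite /section pureDr [LHS]linearD. Qed.

Lemma sectionK l : retraction (section l) = l.
Proof.
rewrite /retraction /section psiK comp_delta mulgV.
have [s s1 ->] := iota_ext_sub (group1 W').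
have -> : s = 1%g by apply: val_inj.
by rewrite iota1 scale1r.
Qed.

Lemma theta_action (u : Hb) (t : X) : u *: t = theta th u *: (t : restr (theta_inv th) X).
Proof. by rewrite restrE thetaK. Qed.

Lemma retraction_poly p (t : XH) :
  retraction (poly_toH D p *: t) = poly_toH D' (shift p) *: retraction t.
Proof.
rewrite /retraction [poly_toH D p *: t]theta_action.
by rewrite [psi' _](linearZZ psi') act_poly1.
Qed.

Lemma section_poly p (l : KH) :
  section (poly_toH D' (shift p) *: l) = poly_toH D p *: section l.
Proof.
rewrite [RHS]theta_action -[RHS](linearZZ psi) pureZ.
rewrite -[LHS]/(psi (pure (delta 1%g : P) (cc_H H0 (poly_toH D' (shift p)) *: (l : K)))).
rewrite -pure_bal; congr (psi (pure _ _)).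
exact/esym/ract_delta1.
Qed.

Definition J_shift (p : coord_ring h) : Prop :=
  exists2 a : invariant D, max_ideal D b a & p = shift (inv_incl D a).

Lemma J_shift0 p : J_shift p -> poly_eval 0 p = 0.
Proof. by move=> [a ma ->]; rewrite shift_eval. Qed.

Local Notation GX := (@adic _ XH (@J_at _ _ _ D b)).
Local Notation GK := (@adic _ KH (@poly_J _ _ _ D' J_shift)).

Lemma retraction_G n t : GX n t -> GK n (retraction t).
Proof.
apply: adic_map; first exact: retractionD.
move=> _ s [a ma ->]; exists (poly_toH D' (shift (inv_incl D a))).
  by exists (shift (inv_incl D a)) => //; exists a.
exact: retraction_poly.
Qed.

Lemma section_G n l : GK n l -> GX n (section l).
Proof.
apply: adic_map; first exact: sectionD.
move=> _ s [_ [a ma ->] ->]; exists (inv_toH D a); first by exists a.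
exact: section_poly.
Qed.

(** A factor x + c with c nonzero is invertible on K. It can be absorbed into l and replaced by x,
    leaving a pure power. *)
Lemma linear_factors (s : seq C) j x :
  (forall l : KH, GK 1 (poly_toH D' (coordf x ^+ j *
     \big[*%R/1]_(c <- s) (coordf x + pcst _ c)) *: l)) ->
  forall l : KH, GK 1 (Hx D' x ^+ (j + size s) *: l).
Proof.
elim: s j => [|c s IHs] j sG l.
  have := sG l; rewrite big_nil mulr1 rmorphXn poly_toH_gen.
  by rewrite addn0.
rewrite -addSnnS; apply: IHs => {}l.
have [c0|c0] := eqVneq c 0.
  by have := sG l; rewrite big_cons c0 rmorph0 addr0 mulrA -exprSr.
have [r [zr _]] := completed_inverse DP' H0 x c0.
have lE : l = poly_toH D' (coordf x + pcst _ c) *: (r *: (l : K) : KH).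
  rewrite rmorphD /= [X in (X + _) *: _]poly_toH_gen poly_toH_cst restrE rmorphD.
  by rewrite [RHS]scalerA zr scale1r.
rewrite lE scalerA -rmorphM; set S := \big[_/_]_(_ <- _) _.
have -> : coordf x ^+ j.+1 * S * (coordf x + pcst _ c) =
    (coordf x ^+ j * ((coordf x + pcst _ c) * S)) * coordf x.
  rewrite exprSr; exact: (mulr_swap (R := cring h)).
rewrite rmorphM -scalerA; have := sG (poly_toH D' (coordf x) *: (r *: (l : K) : KH)).
by rewrite big_cons.
Qed.

(** After translation by b, [shifted_orbit_relation] becomes a product of |W| factors x + x(b) - (w
    x)(b), to which [linear_factors] applies. *)
Lemma shift_xd x (l : KH) : GK 1 (Hx D' x ^+ #|W| *: l).
Proof.
pose s := [seq x b - dact D w x b | w <- index_enum W].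
have sW : (0 + size s)%N = #|W| by rewrite size_map /index_enum -enumT -cardE.
rewrite -sW; apply: linear_factors => {}l; rewrite expr0 mul1r /s big_map.
have [a [aI /(congr1 shift)]] := shifted_orbit_relation DP b x.
have shift_prod : shift (\prod_(w : W) (coordf x - pcst _ (dact D w x b))) =
    \big[*%R/1]_(w <- index_enum W) (coordf x + pcst _ (x b - dact D w x b)).
  rewrite (big_morph shift (rmorphM shift) (rmorph1 shift)).
  apply: eq_bigr => w _.
  by rewrite rmorphB /= shift_gen shift_cst rmorphB addrA.
rewrite shift_prod => ->; rewrite !rmorph_sum scaler_suml; apply: adic_sum => i _.
rewrite !rmorphM -scalerA; apply: adicM; last exact: adic_all.
by exists (shift (inv_incl D (a i))) => //; exists (a i).
Qed.

Lemma retract_complete :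
  cofinite (pcst (cher_rel D) : {rmorphism C -> cherednik D}) (GX 1) ->
  (forall t, (forall n, GX n t) -> t = 0) ->
  (forall u : nat -> XH, (forall n, GX n (u n.+1 - u n)) ->
     exists t, forall n, GX n (t - u n)) ->
  adically_complete KH.
Proof.
move=> [r [l lP]] sep cpl.
have retB s t : retraction (s - t) = retraction s - retraction t.
  by apply/eqP; rewrite eq_sym subr_eq -retractionD subrK.
have ret0 : retraction 0 = 0 by rewrite -[X in retraction X](subrr (0 : XH)) retB subrr.
apply: (comparison_complete J_shift0 shift_xd).
- exists r, (fun i => retraction (l i)) => v; have [c cP] := lP (section v).
  exists c; have := retraction_G cP; rewrite retB sectionK.
  rewrite /lcomb (big_morph retraction retractionD ret0).
  rewrite (eq_bigr (fun i => k' (c 0 i) *: retraction (l i))) // => i _.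
  by have := retraction_poly (pcst _ (c 0 i)) (l i); rewrite shift_cst !poly_toH_cst.
- move=> v vG; rewrite -[v]sectionK [section v](sep _) // => n.
  exact/section_G/vG.
- move=> u uG; have [|t tG] := cpl (fun n => section (u n)).
    move=> n; have -> : section (u n.+1) - section (u n) = section (u n.+1 - u n).
      by apply/eqP; rewrite subr_eq -sectionD subrK.
    exact: section_G.
  by exists (retraction t) => n; have := retraction_G (tG n); rewrite retB sectionK.
Qed.

End Retract.

(** * Finite generation of the induced module *)

Section InducedModule.
Variables (Hb : completed_cherednik D b) (th : theta_iso Hb H0).
Variables (L : lmodType H0).
Local Notation LH := (restr (cc_H H0) L).
Hypothesis LP : adically_complete LH.

Local Notation T := (restr (cc_H Hb) (restr (theta th) (tensor P L))).
Local Notation F := (@adic _ LH (@is_x _ _ _ D')).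
Local Notation Fsp n := (adic_space (@HcC _ _ _ D') LH (@is_x _ _ _ D') n).
Local Notation E := (submodT (nilpotent_sub T DP)).

Lemma alpha_stab s : s \in reflections D -> s \notin W' -> alpha D s b != 0.
Proof.
move=> sR; apply: contraNneq => ab; have : (s^-1)%g \in W'.
  by rewrite inE -subr_eq0 (reflEv DP) // ab mulr0 scale0r.
by rewrite groupV.
Qed.

Definition comp_filtration n (t : T) : Prop := forall w, F n (comp w t).

Lemma comp_action_y a w (t : T) : comp w (Hy D a *: t) =
  Hy D' (rho D w a) *: (comp w t : LH) +
  \sum_(s in reflections D | s \notin W')
    Hc D' (2 * cpar D s / (1 - lam D s) * alpha D s (rho D w a)) *:
      (ring_inv (cc_H H0 (Hx D' (alpha D s)) + sc (alpha D s b)) *: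
        (comp (s * w)%g t - comp w t) : LH).
Proof. exact: comp_y. Qed.

Lemma comp_action_c c w (t : T) : comp w (Hc D c *: t) = Hc D' c *: (comp w t : LH).
Proof. exact: comp_c. Qed.

(** For s outside W' the constant alpha_s(b) is nonzero, so the denominator is a unit preserving F
    n: the difference part of y loses no step. *)
Lemma singular_part_F n a w (t : T) : comp_filtration n t ->
  F n (\sum_(s in reflections D | s \notin W')
    Hc D' (2 * cpar D s / (1 - lam D s) * alpha D s (rho D w a)) *:
      (ring_inv (cc_H H0 (Hx D' (alpha D s)) + sc (alpha D s b)) *:
        (comp (s * w)%g t - comp w t) : LH)).
Proof.
move=> tF; apply: adic_sum => s /andP[sR sW]; apply: F_c.
apply: (ring_inv_F DP'); first exact: alpha_stab.
by apply: (spaceB (S := Fsp n)); exact: tF.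
Qed.

Definition comp_space (n : nat) : subspace (pcst (cher_rel D) : {rmorphism C -> cherednik D}) T.
Proof.
exists (comp_filtration n).
- by move=> w; rewrite comp0; exact: adic0.
- by move=> s t sF tF w; rewrite [comp w _]compD; exact: adicD.
- by move=> c t tF w; rewrite comp_action_c; exact: F_c.
Defined.

Lemma comp_filtration_y n a (t : T) : comp_filtration n.+1 t -> comp_filtration n (Hy D a *: t).
Proof.
move=> tF w; rewrite comp_action_y; apply: adicD; first exact: F_y.
by apply: singular_part_F => u; exact/adicS/tF.
Qed.

Lemma comp_cofinite n : cofinite (pcst (cher_rel D) : {rmorphism C -> cherednik D})
  (comp_filtration n).
Proof.
have [r [l lP]] := F_cofinite (ac_finite LP) n.
pose g (wi : W * 'I_r) : T := pure (delta wi.1 : P) (sc #|W'|%:R^-1 *: (l wi.2 : L)).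
apply: (@cofinite_fin _ _ _ T _ g) => t.
have [c cP] := choice (fun w => lP (comp w t)).
exists (fun wi => c wi.1 0 wi.2).
have compF u w (v : LH) : F n v -> F n (comp u (pure (delta w : P) (sc #|W'|%:R^-1 *: (v : L)))).
  move=> vF; rewrite comp_delta.
  have [/iota_ext_sub[s _ ->]|/iota_ext_out ->] := boolP ((u * w^-1)%g \in W').
    exact: (F_w (D := D') s (F_c _ vF)).
  by rewrite scale0r; exact: adic0.
have -> : t - \sum_i pcst (cher_rel D) (c i.1 0 i.2) *: g i =
    \sum_w pure (delta w : P) (sc #|W'|%:R^-1 *: (comp w t - lcomb k' l (c w) : L)).
  rewrite {1}[t](component_sum (L := L)).
  rewrite -(pair_bigA _ (fun w i => pcst (cher_rel D) (c w 0 i) *: g (w, i))) -sumrB.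
  apply: eq_bigr => w _.
  have pureN (v : L) : pure (delta w : P) (- v) = - pure (delta w : P) v.
    apply: (addIr (pure (delta w : P) v)); rewrite -pureDr !addNr.
    by apply: (addIr (pure (delta w : P) v)); rewrite -pureDr !add0r.
  rewrite scalerBr pureDr pureN; congr (_ - _).
  rewrite /lcomb scaler_sumr.
  rewrite (big_morph (fun v : L => pure (delta w : P) v) (pureDr (delta w : P))
    (id1 := 0)); last first.
    by apply: (addIr (pure (delta w : P) (0 : L))); rewrite -pureDr !add0r.
  apply: eq_bigr => i _; rewrite /g /=.
  rewrite -[LHS]/((theta th (cc_H Hb (Hc D (c w 0 i))) : Zcent H0) *: pure (delta w : P)
    (sc #|W'|%:R^-1 *: (l i : L))).
  rewrite pureZ.
  have -> : theta th (cc_H Hb (Hc D (c w 0 i))) *: (delta w : P) = ract (delta w : P)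
    (sc (c w 0 i)).
    apply: val_inj; apply/funext => u.
    rewrite [LHS]theta_c /= .
    have [/iota_ext_sub[s _ ->]|/iota_ext_out ->] := boolP ((u * w^-1)%g \in W').
      exact: sc_iota.
    by rewrite mulr0 mul0r.
  rewrite pure_bal; congr pure; rewrite !scalerA -!rmorphM; congr (cc_H H0 _ *: _).
  by rewrite mulrC.
move=> u; rewrite (big_morph (comp u) (compD u) (comp0 _ u)).
by apply: adic_sum => w _; exact: compF.
Qed.

(** If y t = 0, each y' sends a component of t to a difference part, hence into F j and not only F
    (j-1). So chi kills the component modulo F (j+1), as does Q(t - j); for j >= m they are coprime
    and t sinks one layer further. *)
Lemma comp_singular : exists m, forall n (t : T), (m <= n)%N -> comp_filtration n t ->
  (forall a, Hy D a *: t = 0) -> t = 0.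
Proof.
have [Q QP] := euler_boundP LP.
have [m mP] := coprime_shift (chi_neq0 D') QP.1; exists m => n t mn tF ty.
have step j : (m <= j)%N -> comp_filtration j t -> comp_filtration j.+1 t.
  move=> mj tFj w; set v : LH := comp w t.
  have yv y : F j (Hy D' y *: v).
    have := comp_action_y (rho D w^-1%g y) w t; rewrite ty comp0.
    rewrite -comp_lfunE -(rhoM DP) mulgV (rho1 DP) id_lfunE => /esym/eqP.
    rewrite addr_eq0 => /eqP ->; apply: (spaceN (S := Fsp j)).
    have -> : y = rho D w (rho D w^-1%g y).
      by rewrite -comp_lfunE -(rhoM DP) mulgV (rho1 DP) id_lfunE.
    exact: singular_part_F.
  apply: (coprime_in (D := D') (G := Fsp j.+1) _ (mP j mj)).
  - by move=> u; exact: F_eu.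
  - apply: (chi_kills (G := Fsp j.+1)) => [u|s]; first exact: F_eu.
    rewrite /eu_part scaler_suml; apply: adic_sum => i _; rewrite -scalerA; apply: F_x.
    rewrite scalerA; have -> : Hy D' (bas i) * Hw D' s = Hw D' s * Hy D' (rho D' s^-1%g (bas i)).
      by rewrite Hwy -comp_lfunE -(rhoM DP') mulgV (rho1 DP') id_lfunE.
    by rewrite -scalerA; apply: F_w; exact: yv.
  - by apply: (F_shift DP'); [exact: QP.2|exact: tFj].
apply: (comp_inj (L := L)) => w; apply: (ac_separated LP) => j.
have tFall i : comp_filtration (i + n) t.
  by elim: i => // i IHi; apply: step => //; exact: leq_trans mn (leq_addl _ _).
by apply: adicW (tFall j w); exact: leq_addr.
Qed.

Lemma induced_in_O : is_O E.
Proof.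
split; last by move=> v; apply/nilpotentP; exact: E_nilpotent.
have [m mP] := comp_singular.
apply: (fin_generated DP (G := fun n => space_restrict _ (comp_space n)) (m0 := m)).
- exact: E_nilpotent.
- by move=> n; apply: cofinite_restrict; exact: comp_cofinite.
- move=> n y v /space_restrictP vF; apply: space_restrictZ.
  exact: comp_filtration_y.
move=> n v mn /space_restrictP vF vy; apply: val_inj; apply: (mP n _ mn vF) => a.
by rewrite -sub_valZ vy.
Qed.

End InducedModule.
End Induction.

(** * Bijections between Hom-sets *)

(* A natural bijection Hom(F x, G y) ~ Hom(F' x, G' y), given by its graph. *)
Definition hom_iso (A B E E' : category) (F : functor A E) (G : functor B E)
    (F' : functor A E') (G' : functor B E') : Prop :=
  exists R : forall x y, arr (F x) (G y) -> arr (F' x) (G' y) -> Prop,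
    [/\ forall x y u, exists! v, R x y u v,
        forall x y v, exists! u, R x y u v &
        forall x x' y y' (f : arr x' x) (g : arr y y') u v, R x y u v ->
          R x' y' (cmp (fmap G g) (cmp u (fmap F f)))
                  (cmp (fmap G' g) (cmp v (fmap F' f)))].

Section HomIso.
Variables (A B E E' E2 : category).
Variables (F : functor A E) (G : functor B E) (F' : functor A E') (G' : functor B E').
Variables (F2 : functor A E2) (G2 : functor B E2).

Lemma hom_iso_trans : hom_iso F G F' G' -> hom_iso F' G' F2 G2 -> hom_iso F G F2 G2.
Proof.
move=> [R [Ru Rv Rn]] [S [Su Sv Sn]].
exists (fun x y u w => exists2 v, R x y u v & S x y v w); split.
- move=> x y u; have [v [uv uniq]] := Ru x y u; have [w [vw wuniq]] := Su x y v.
  by exists w; split=> [|w' [v' /uniq <- /wuniq]]; first by exists v.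
- move=> x y w; have [v [vw uniq]] := Sv x y w; have [u [uv uuniq]] := Rv x y v.
  by exists u; split=> [|u' [v' /[swap] /uniq <- /uuniq]]; first by exists v.
- move=> x x' y y' f g u w [v uv vw].
  by exists (cmp (fmap G' g) (cmp v (fmap F' f))); [exact: Rn|exact: Sn].
Qed.

Lemma hom_iso_comp (A' B' : category) (K : functor A' A) (L : functor B' B) :
  hom_iso F G F' G' -> hom_iso (F \oF K) (G \oF L) (F' \oF K) (G' \oF L).
Proof.
move=> [R [Ru Rv Rn]]; exists (fun x y u v => R (K x) (L y) u v); split.
- by move=> x y u; exact: Ru.
- by move=> x y v; exact: Rv.
- by move=> x x' y y' f g u v; exact: Rn.
Qed.

End HomIso.

Lemma hom_iso_adjoint (A B : category) (L : functor A B) (R : functor B A) :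
  hom_iso L (id_functor B) (id_functor A) R -> right_adjoint R L.
Proof.
move=> [S [Su Sv Sn]].
pose phi x y (u : arr (L x) y) : arr x (R y) := projT1 (cid (Su x y u)).
have phiP x y u : S x y u (phi x y u) by rewrite /phi; case: cid => v [].
have phiE x y u v : S x y u v -> phi x y u = v.
  by rewrite /phi; case: cid => v' [_ uniq] /= /uniq.
exists phi; split=> [x y|x x' y y' f g u]; last exact/phiE/(Sn _ _ _ _ f g)/phiP.
pose psi (v : arr x (R y)) : arr (L x) y := projT1 (cid (Sv x y v)).
have psiP v : S x y (psi v) v by rewrite /psi; case: cid => u [].
exists psi => [u|v]; last exact: phiE.
by rewrite /psi; case: cid => u' [_ uniq] /=; exact: uniq.
Qed.

Section Equivalence.
Variables (A B : category) (F : functor A B) (G : functor B A).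

Lemma cancel_left (X : category) (x y z : X) (i : arr y z) (u v : arr x y) :
  is_iso i -> cmp i u = cmp i v -> u = v.
Proof. by move=> [j [_ ji]] /(congr1 (cmp j)); rewrite !cmpA ji !cmp1m. Qed.

Lemma cancel_right (X : category) (x y z : X) (i : arr x y) (u v : arr y z) :
  is_iso i -> cmp u i = cmp v i -> u = v.
Proof. by move=> [j [ij _]] /(congr1 (fun w => cmp w j)); rewrite -!cmpA ij !cmpm1. Qed.

Lemma faithful (Y Z : category) (S : functor Y Z) (T : functor Z Y) :
  nat_isomorphic (T \oF S) (id_functor Y) ->
  forall x y (u v : arr x y), fmap S u = fmap S v -> u = v.
Proof.
move=> [eta [nat iso]] x y u v uv; apply: (cancel_right (iso x)).
by have := nat _ _ u; have := nat _ _ v; rewrite /= uv => -> ->.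
Qed.

(** The bijection is built from eta alone. No triangle identity relates eta and eps, so eps serves
    to show that G is full and faithful. *)
Lemma equivalence_hom_iso : quasi_inverse F G ->
  hom_iso F (id_functor B) (id_functor A) G.
Proof.
move=> [GF FG]; have [eta [etaN etaI]] := GF; have [eps [epsN epsI]] := FG.
exists (fun x y (u : arr (F x) y) (v : arr x (G y)) => cmp v (eta x) = fmap G u); split.
- move=> x y u; have [j [ej je]] := etaI x.
  exists (cmp (fmap G u) j); split=> [|v vu]; first by rewrite -cmpA je cmpm1.
  by rewrite -vu -cmpA ej cmpm1.
- move=> x y v; set w := cmp v (eta x); have [j [ej je]] := epsI (F x).
  exists (cmp (eps y) (cmp (fmap F w) j)); split=> [|u' u'w]; last first.
    apply: (faithful FG); rewrite -u'w; apply: (faithful GF).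
    apply: (cancel_left (epsI y)); have /= -> := epsN _ _ (cmp (eps y) (cmp (fmap F w) j)).
    by rewrite -!cmpA je cmpm1.
  apply: (faithful GF); apply: (cancel_left (epsI y)).
  have /= -> := epsN _ _ (cmp (eps y) (cmp (fmap F w) j)).
  by rewrite -!cmpA je cmpm1.
- move=> x x' y y' f g u v /= vu; have /= etaf := etaN _ _ f.
  by rewrite -!cmpA -etaf [cmp v _]cmpA vu !fmapM.
Qed.

Lemma quasi_inverse_sym : quasi_inverse F G -> quasi_inverse G F.
Proof. by case. Qed.

End Equivalence.

(** Composition of functors is associative by conversion, so every link is a generic bijection
    precomposed by [hom_iso_comp]; the categories are kept abstract for the composites to match. *)
Lemma adjunction_chain (M M' M2 Mb Z M0 : category)
    (O : M -> Prop) (O' : M' -> Prop) (O2 : M2 -> Prop)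
    (compl : functor M Mb) (th_inv : functor Mb Z) (Iinv : functor Z M0)
    (E0 : functor M0 M') (zeta : functor M' M2) (compl0 : functor M' M0)
    (I : functor M0 Z) (th : functor Z Mb) (rest : functor Mb M) (nil : functor M M)
    (zinv : functor (full_sub O2) (full_sub O'))
    (zetaO : forall X : full_sub O', O2 ((zeta \oF full_incl O') X))
    (KF := Iinv \oF (th_inv \oF (compl \oF full_incl O)))
    (EO : forall X : full_sub O, O' ((E0 \oF KF) X))
    (ResO : forall X : full_sub O,
       O2 ((zeta \oF E0 \oF Iinv \oF th_inv \oF compl \oF full_incl O) X))
    (IndO : forall Y : full_sub O2,
       O ((nil \oF rest \oF th \oF I \oF compl0 \oF full_incl O' \oF zinv) Y)) :
  quasi_inverse (corestrict zetaO) zinv ->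
  hom_iso (E0 \oF KF) (full_incl O') KF (compl0 \oF full_incl O') ->
  quasi_inverse I Iinv ->
  hom_iso th_inv (id_functor Z) (id_functor Mb) th ->
  hom_iso compl (id_functor Mb) (id_functor M) rest ->
  hom_iso (full_incl O) (id_functor M) (full_incl O) nil ->
  right_adjoint (corestrict IndO) (corestrict ResO).
Proof.
move=> zetaP EP IP thP complP nilP; apply: hom_iso_adjoint.
pose Q := compl0 \oF full_incl O' \oF zinv.
have S1 : hom_iso (corestrict ResO) (id_functor _) (E0 \oF KF) (full_incl O' \oF zinv) :=
  hom_iso_comp (corestrict EO) (id_functor _) (equivalence_hom_iso zetaP).
have S2 : hom_iso (E0 \oF KF) (full_incl O' \oF zinv) KF Q :=
  hom_iso_comp (id_functor _) zinv EP.
have S3 : hom_iso KF Q (th_inv \oF (compl \oF full_incl O)) (I \oF Q) :=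
  hom_iso_comp (th_inv \oF (compl \oF full_incl O)) Q (equivalence_hom_iso (quasi_inverse_sym IP)).
have S4 : hom_iso (th_inv \oF (compl \oF full_incl O)) (I \oF Q)
    (compl \oF full_incl O) (th \oF (I \oF Q)) :=
  hom_iso_comp (compl \oF full_incl O) (I \oF Q) thP.
have S5 : hom_iso (compl \oF full_incl O) (th \oF (I \oF Q))
    (full_incl O) (rest \oF (th \oF (I \oF Q))) :=
  hom_iso_comp (full_incl O) (th \oF (I \oF Q)) complP.
have S6 : hom_iso (full_incl O) (rest \oF (th \oF (I \oF Q)))
    (id_functor _) (corestrict IndO) :=
  hom_iso_comp (id_functor _) (rest \oF (th \oF (I \oF Q))) nilP.
exact: hom_iso_trans (hom_iso_trans S1 S2) (hom_iso_trans S3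
  (hom_iso_trans S4 (hom_iso_trans S5 S6))).
Qed.

(** * Change of rings *)

Section ModuleFunctors.

Lemma restr_hom_iso (A B : pzRingType) (f : {rmorphism A -> B}) (g : {rmorphism B -> A}) :
  cancel f g -> cancel g f ->
  hom_iso (restr_functor g) (id_functor (Mod B)) (id_functor (Mod A)) (restr_functor f).
Proof.
move=> fK gK.
exists (fun (X : lmodType A) (Q : lmodType B) (u : {linear restr g X -> Q})
  (v : {linear X -> restr f Q}) => forall x : X, u x = v x); split.
- move=> X Q u.
  have vlin : linear (u : X -> restr f Q).
    move=> a x y; rewrite restrE; have := linearP u (f a) (x : restr g X) y.
    by rewrite restrE fK.
  pose v : {linear X -> restr f Q} :=
    HB.pack_for {linear X -> restr f Q} (u : X -> restr f Q)
      (GRing.isLinear.Build _ _ _ _ (u : X -> restr f Q) vlin).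
  by exists v; split=> // v' uv; apply: linear_ext => x; exact: uv.
- move=> X Q v.
  have ulin : linear (v : restr g X -> Q).
    move=> b x y; rewrite restrE; have := linearP v (g b) (x : X) y.
    by rewrite restrE gK.
  pose u : {linear restr g X -> Q} :=
    HB.pack_for {linear restr g X -> Q} (v : restr g X -> Q)
      (GRing.isLinear.Build _ _ _ _ (v : restr g X -> Q) ulin).
  by exists u; split=> // u' uv; apply: linear_ext => x; rewrite uv.
- move=> X X' Q Q' p q u v uv x /=.
  by rewrite /restr_map_fun uv.
Qed.

Lemma extension_hom_iso (A B : pzRingType) (f : {rmorphism A -> B}) :
  hom_iso (tensor_functor (ext_bimodule f)) (id_functor (Mod B))
    (id_functor (Mod A)) (restr_functor f).
Proof.
pose one (M : lmodType A) (m : M) : tensor (ext_bimodule f) M := pure (1 : ext_bimodule f) m.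
have oneE (M : lmodType A) (b : B) (m : M) : pure (b : ext_bimodule f) m = b *: one M m.
  by rewrite /one pureZ /GRing.scale /= mulr1.
have oneP (M : lmodType A) a (m m' : M) : one M (a *: m + m') = f a *: one M m + one M m'.
  rewrite /one pureDr -pure_bal; congr (_ + _).
  by rewrite -oneE /= mul1r.
exists (fun (M : lmodType A) (Q : lmodType B) (u : {linear tensor (ext_bimodule f) M -> Q})
  (v : {linear M -> restr f Q}) => forall m : M, u (one M m) = v m); split.
- move=> M Q u.
  have vlin : linear ((fun m => u (one M m)) : M -> restr f Q).
    by move=> a m m'; rewrite oneP [LHS]linearP.
  pose v : {linear M -> restr f Q} :=
    HB.pack_for {linear M -> restr f Q} ((fun m => u (one M m)) : M -> restr f Q)
      (GRing.isLinear.Build _ _ _ _ ((fun m => u (one M m)) : M -> restr f Q) vlin).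
  by exists v; split=> // v' uv; apply: linear_ext => m; rewrite -uv.
- move=> M Q v.
  have bal : balanced (fun (b : ext_bimodule f) (m : M) => (b : B) *: (v m : Q)).
    split=> [b b' m|b m m'|b a m].
    + exact: scalerDl.
    + by rewrite linearD scalerDr.
    + by rewrite [v (_ *: _)](linearZZ v) [RHS](scalerA (b : B) (f a) (v m : Q)).
  have ulin : linear (text (fun (b : ext_bimodule f) (m : M) => (b : B) *: (v m : Q))).
    move=> b s t; rewrite (textD bal); congr (_ + _); move: s.
    apply: text_ext => [s s'|s s'|c m].
    * by rewrite scalerDr (textD bal).
    * by rewrite (textD bal) scalerDr.
    * by rewrite pureZ !(text_pure bal) scalerA.
  pose u : {linear tensor (ext_bimodule f) M -> Q} :=
    HB.pack_for {linear tensor (ext_bimodule f) M -> Q}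
      (text (fun (b : ext_bimodule f) (m : M) => (b : B) *: (v m : Q)))
      (GRing.isLinear.Build _ _ _ _ _ ulin).
  exists u; split=> [m|u' uv]; first by rewrite /= (text_pure bal) scale1r.
  apply: linear_ext; apply: text_ext => [s t|s t|b m].
  + exact: linearD.
  + exact: linearD.
  + by rewrite oneE !linearZ /= uv (text_pure bal) scale1r.
- move=> M M' Q Q' p q u v uv m /=.
  by rewrite /one tmap_pure -/(one M (p m)) uv.
Qed.

End ModuleFunctors.

Section Nilpotent.
Variables (C : numClosedFieldType) (h : vectType C) (W : finGroupType).
Variables (D : cherednik_data h W) (DP : is_cherednik_data D).

Lemma nilpotent_hom_iso :
  hom_iso (@full_incl (Mod (cherednik D)) (@is_O _ _ _ D)) (id_functor (Mod (cherednik D)))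
    (@full_incl (Mod (cherednik D)) (@is_O _ _ _ D)) (nilpotent_functor DP).
Proof.
exists (fun (M : category_O D) (T : lmodType (cherednik D))
  (u : {linear sval M -> T}) (v : {linear sval M -> submodT (nilpotent_sub T DP)}) =>
  forall m, sub_val (v m) = u m); split.
- move=> [M MO] T /= u.
  have uN m : sub_pred (nilpotent_sub T DP) (u m).
    apply/asboolP; exact: (@nilpotent_map _ _ _ D DP M T u m (MO.2 m)).
  pose v0 m : submodT (nilpotent_sub T DP) := SubMod (uN m).
  have vlin : linear v0 by move=> a m m'; apply: val_inj; exact: linearP.
  pose v : {linear M -> submodT (nilpotent_sub T DP)} :=
    HB.pack_for {linear M -> submodT (nilpotent_sub T DP)} v0
      (GRing.isLinear.Build _ _ _ _ v0 vlin).
  by exists v; split=> // v' uv; apply: linear_ext => m; apply: val_inj; rewrite /= uv.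
- move=> [M MO] T /= v.
  have ulin : linear (fun m => sub_val (v m)).
    by move=> a m m'; rewrite linearP.
  pose u : {linear M -> T} := HB.pack_for {linear M -> T} (fun m => sub_val (v m))
    (GRing.isLinear.Build _ _ _ _ _ ulin).
  by exists u; split=> // u' uv; apply: linear_ext => m; rewrite -uv.
- move=> M M' T T' p q u v uv m /=.
  by rewrite uv.
Qed.

End Nilpotent.

(** * The adjunction *)

Section NilpotentPartOfComplete.
Variables (C : numClosedFieldType) (h : vectType C) (W : finGroupType).
Variables (D : cherednik_data h W) (DP : is_cherednik_data D).
Variable cc : completed_cherednik D 0.
Variables (S : category) (KF : functor S (Mod cc)).
Hypothesis KP : forall x : S, adically_complete (restr (cc_H cc) (KF x : lmodType cc)).

Local Notation incl := (@full_incl (Mod (cherednik D)) (@is_O _ _ _ D)).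
Local Notation E K := (submodT (nilpotent_sub (restr (cc_H cc) K) DP)).

(** The relation says that u restricts to g. A map g extends by continuity, and the extension
    commutes with the completed invariants; conversely u preserves nilpotent vectors, which in the
    completion of N are those of N. *)
Lemma nilpotent_part_hom_iso :
  hom_iso (E_functor cc DP \oF KF) incl KF (completion_functor cc \oF incl).
Proof.
exists (fun (x : S) (N : category_O D) (g : {linear E (KF x) -> sval N})
  (u : {linear (KF x : lmodType cc) -> tensor (ext_bimodule (cc_H cc)) (sval N)}) =>
  forall e : E (KF x), u (sub_val e) = unit_fun cc (g e)); split.
- move=> x [N NO] /= g.
  have LP := completion_adically_complete DP cc NO.
  have [u0 u0E] := extend_map (KP x) LP (lin_comp (unit_fun cc (M := N)) g).
  have ulin := completed_linear DP u0 LP.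
  pose u : {linear (KF x : lmodType cc) -> tensor (ext_bimodule (cc_H cc)) N} :=
    HB.pack_for {linear (KF x : lmodType cc) -> tensor (ext_bimodule (cc_H cc)) N}
      (u0 : (KF x : lmodType cc) -> tensor (ext_bimodule (cc_H cc)) N)
      (GRing.isLinear.Build _ _ _ _ _ ulin).
  exists u; split=> [e|u' u'E]; first exact: u0E.
  apply: linear_ext.
  apply: (extend_unique (KP x) LP (f := u0)
    (f' := (restr_map_fun u' : {linear restr (cc_H cc) (KF x) -> restr (cc_H cc) _}))).
  by move=> e; rewrite [LHS]u0E; exact/esym/u'E.
- move=> x [N NO] /= u.
  have LP := completion_adically_complete DP cc NO.
  have dense := completion_F_dense DP NO (cc := cc).
  have strict := completion_F_strict DP NO (cc := cc).
  have inj := completion_inj DP NO strict.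
  have gE (e : E (KF x)) : exists n, u (sub_val e) = unit_fun cc n.
    apply: (completion_nilpotent DP NO LP dense).
    apply: (@nilpotent_map _ _ _ D DP _ _
      (restr_map_fun u : {linear restr (cc_H cc) (KF x) -> restr (cc_H cc) _})).
    by have /asboolP := sub_valP e.
  have [g0 g0E] := choice gE.
  have glin : linear g0.
    move=> a e e'; apply: inj; apply: etrans (esym (g0E _)) _.
    pose ru : {linear restr (cc_H cc) (KF x) -> restr (cc_H cc) _} := restr_map_fun u.
    apply: etrans (linearP ru a (sub_val e) (sub_val e')) _.
    apply: etrans _ (esym (linearP (unit_fun cc (M := N)) a (g0 e) (g0 e'))).
    exact: (congr2 (fun s t : restr (cc_H cc) _ => a *: s + t) (g0E e) (g0E e')).
  pose g : {linear E (KF x) -> N} :=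
    HB.pack_for {linear E (KF x) -> N} g0 (GRing.isLinear.Build _ _ _ _ g0 glin).
  exists g; split=> // g' g'E; apply: linear_ext => e; apply: inj.
  exact: etrans (esym (g0E e)) (g'E e).
- move=> x x' N N' f p g u ug e.
  have uge := ug (fmap (E_functor cc DP) (fmap KF f) e).
  apply: etrans (congr1 (tmap (P := ext_bimodule (cc_H cc)) p) uge) _.
  exact: tmap_pure.
Qed.

End NilpotentPartOfComplete.

(* Applied to abstract functors, this unfolds a long composite without       *)
(* reducing the functors it is made of.                                     *)
Lemma comp_functor_object (X0 X1 X2 X3 X4 X5 X6 : category) (P : X6 -> Prop)
    (F1 : functor X0 X1) (F2 : functor X1 X2) (F3 : functor X2 X3)
    (F4 : functor X3 X4) (F5 : functor X4 X5) (F6 : functor X5 X6) x :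
  P ((F6 \oF F5 \oF F4) (F3 (F2 (F1 x)))) ->
  P ((F6 \oF F5 \oF F4 \oF F3 \oF F2 \oF F1) x).
Proof. exact. Qed.

Section Adjunction.
Variables (C : numClosedFieldType) (h : vectType C) (W : finGroupType).
Variables (D : cherednik_data h W) (DP : is_cherednik_data D) (b : h).
Variables (U : {vspace h}) (UP : is_stable_complement (stab_data DP b) U).
Variables (Hb : completed_cherednik D b) (H0 : completed_cherednik (stab_data DP b) 0).
Variable th : theta_iso Hb H0.
Variable Iinv : functor (Mod (Zcent H0)) (Mod H0).
Hypothesis IinvP : quasi_inverse (induce (stab_incl H0)) Iinv.
Variable zinv : functor (category_O (ess_data (stab_data DP b) U)) (category_O (stab_data DP b)).
Hypothesis zinvP : is_zeta_inverse UP zinv.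

Local Notation DP' := (stab_dataP DP b).
Local Notation inclD := (@full_incl (Mod (cherednik D)) (@is_O _ _ _ D)).
Local Notation inclD' :=
  (@full_incl (Mod (cherednik (stab_data DP b))) (@is_O _ _ _ (stab_data DP b))).

Let XF : functor (category_O D) (Mod Hb) := completion_functor Hb \oF inclD.
Let YF : functor (category_O D) (Mod (Zcent H0)) := restr_functor (theta_inv th) \oF XF.
Let KF : functor (category_O D) (Mod H0) := Iinv \oF YF.

(** The isomorphism from I (Iinv Y) to Y presents the completion at b as P (x) KF x, so
    [retract_complete] applies. *)
Lemma KF_complete x : adically_complete (restr (cc_H H0) (KF x : lmodType H0)).
Proof.
have [_ [eps [_ epsI]]] := IinvP.
have [psi' [_ psiK]] := epsI (YF x).
have [sep cpl _ _ [cof _]] := completed_module DP Hb (svalP x).1.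
have K1 : cancel (eps (YF x)) psi'.
  by move=> t; exact: (congr1 (fun f : {linear _ -> _} => f t) psiK).
exact: (retract_complete (th := th) (X := XF x) K1 (cof 1%N) sep cpl).
Qed.

Lemma induced_functor_in_O (L : lmodType H0) :
  adically_complete (restr (cc_H H0) L) ->
  is_O ((E_functor Hb DP \oF restr_functor th \oF induce (stab_incl H0)) L).
Proof. exact: induced_in_O. Qed.

Lemma completed_functor_complete (N : category_O (stab_data DP b)) :
  adically_complete (restr (cc_H H0) (completion_functor H0 (sval N))).
Proof. exact: (completion_adically_complete DP' H0 (svalP N)). Qed.

Lemma induction_in_O N : is_O ((Ind th zinv) N).
Proof.
refine (@comp_functor_object _ _ _ _ _ _ (Mod (cherednik D))
  (fun M : lmodType (cherednik D) => is_O M) zinv inclD' (completion_functor H0)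
  (induce (stab_incl H0)) (restr_functor th) (E_functor Hb DP) N _).
exact/induced_functor_in_O/completed_functor_complete.
Qed.

Lemma parabolic_adjunction :
  exists (ResO : forall M : category_O D,
                   is_O ((comp_functor (Res UP th Iinv) (full_incl _)) M))
         (IndO : forall N : category_O (ess_data (stab_data DP b) U),
                   is_O ((Ind th zinv) N)),
    right_adjoint (corestrict IndO) (corestrict ResO).
Proof.
have [zetaO zetaP] := zinvP.
have EO (x : category_O D) : is_O ((E_functor H0 DP' \oF KF) x) := E_in_O DP' (KF_complete x).
have ResO (M : category_O D) : is_O ((comp_functor (Res UP th Iinv) (full_incl _)) M) :=
  zetaO (corestrict EO M).
exists ResO, induction_in_O.
refine (adjunction_chain (rest := restr_functor (cc_H Hb)) EO ResO induction_in_O zetaP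
  (nilpotent_part_hom_iso DP' KF_complete) IinvP (restr_hom_iso (thetaK th) (theta_invK th))
  (extension_hom_iso (cc_H Hb)) (nilpotent_hom_iso DP)).
Qed.

End Adjunction.

Theorem theorem3p10
  (R : realType) (h : vectType (complex R)) (W : finGroupType)
  (D : cherednik_data h W) (DP : is_cherednik_data D) (b : h)
  (U : {vspace h}) (UP : is_stable_complement (stab_data DP b) U)
  (Hb : completed_cherednik D b)
  (H0 : completed_cherednik (stab_data DP b) 0%R)
  (th : theta_iso Hb H0)
  (Iinv : functor (Mod (Zcent H0)) (Mod H0))
  (IinvP : quasi_inverse (induce (stab_incl H0)) Iinv)
  (zinv : functor (category_O (ess_data (stab_data DP b) U))
                  (category_O (stab_data DP b)))
  (zinvP : is_zeta_inverse UP zinv) :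
  exists (ResO : forall M : category_O D,
                   is_O ((comp_functor (Res UP th Iinv) (full_incl _)) M))
         (IndO : forall N : category_O (ess_data (stab_data DP b) U),
                   is_O ((Ind th zinv) N)),
    right_adjoint (corestrict IndO) (corestrict ResO).
Proof. exact: parabolic_adjunction. Qed.
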